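(* Let $K\subset\mathbb{R}^2$ be a convex domain with $d_{\rm tr}(K)\le 6^{-2}$ and suppose that $$L(K)^2\le (1+\varepsilon)\,6\sqrt{3}\,A(K,-K)$$ for some $\varepsilon\in[0,(6\cdot 180)^{-2}]$. Then $d_{\rm tr}(K)\le 400\sqrt{\varepsilon}$.
   Context: A convex domain is a compact convex subset of $\mathbb{R}^2$ with non-empty interior. $L(K)$ denotes the perimeter of $K$, and $-K=\{-x:x\in K\}$. For compact convex sets $K,M\subset\mathbb{R}^2$, $A(K)$ is the area of $K$ and $A(K,M)$ is the mixed area of $K$ and $M$, i.e. the symmetric functional determined by $A(\alpha K+\beta M)=\alpha^2A(K)+2\alpha\beta A(K,M)+\beta^2A(M)$ for all $\alpha,\beta\ge 0$, where $+$ on sets is Minkowski addition; in particular $A(K,K)=A(K)$. A regular triangle is a non-degenerate equilateral triangle (with its interior). For a convex domain $K$, $d_{\rm tr}(K)$ is the minimal $\rho\ge 0$ such that there exists a regular triangle $T$ with centroid $z$ satisfying $T-z\subset K-z\subset(1+\rho)(T-z)$, where $X-z=\{x-z:x\in X\}$ and $\lambda X=\{\lambda x:x\in X\}$. *)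

(* Defs.v *)
From HB Require Import structures.
From mathcomp Require Import all_boot all_order all_algebra.
From mathcomp Require Import all_classical all_reals all_analysis.
Import Order.TTheory GRing.Theory Num.Theory.
Import numFieldNormedType.Exports.

Set Implicit Arguments.
Unset Strict Implicit.
Unset Printing Implicit Defensive.

Local Open Scope classical_set_scope.
Local Open Scope ring_scope.

(* The library norm of [plane R] is the max-norm; it is used only through the
   topology it induces. Lengths are measured with [dist] below. *)
Notation plane R := (R^o * R^o)%type.

Definition dist {R : realType} (x y : plane R) : R :=
  Num.sqrt ((x.1 - y.1) ^+ 2 + (x.2 - y.2) ^+ 2).

Definition minkowski_sum {R : realType} (K M : set (plane R)) : set (plane R) :=
  [set x + y | x in K & y in M].

Definition dilate {R : realType} (a : R) (K : set (plane R)) : set (plane R) :=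
  [set a *: x | x in K].

Definition reflect_set {R : realType} (K : set (plane R)) : set (plane R) :=
  [set - x | x in K].

Definition translate_by {R : realType} (K : set (plane R)) (z : plane R) :
    set (plane R) :=
  [set x - z | x in K].

Definition convex_domain {R : realType} (K : set (plane R)) : Prop :=
  [/\ compact K, convex_set K & K° !=set0].

Definition area {R : realType} (K : set (plane R)) : R :=
  fine ((@lebesgue_measure R \x @lebesgue_measure R)%E K).

(* The number determined by the expansion of A(alpha K + beta M); it is unique,
   as one sees at alpha = beta = 1. The default value 0 is returned if no number
   satisfies the expansion, which does not happen for compact convex sets. *)
Definition mixed_area {R : realType} (K M : set (plane R)) : R :=
  xget 0 [set m : R | forall alpha beta : R, 0 <= alpha -> 0 <= beta ->
    area (minkowski_sum (dilate alpha K) (dilate beta M)) =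
    alpha ^+ 2 * area K + 2 * alpha * beta * m + beta ^+ 2 * area M].

Definition boundary {R : realType} (K : set (plane R)) : set (plane R) :=
  closure K `\` K°.

(* Positive exactly when the triangle a b c is non-degenerate and
   counterclockwise. *)
Definition orient {R : realType} (a b c : plane R) : R :=
  (b.1 - a.1) * (c.2 - a.2) - (b.2 - a.2) * (c.1 - a.1).

(* [p 0, ..., p (n - 1)] are successive vertices, in counterclockwise order
   along the boundary of K, of a convex polygon inscribed in K. *)
Definition inscribed_polygon {R : realType} (K : set (plane R)) (n : nat)
    (p : 'I_n -> plane R) : Prop :=
  (forall i, boundary K (p i)) /\
  (forall i j k : 'I_n, (i < j)%N -> (j < k)%N -> 0 < orient (p i) (p j) (p k)).

(* [ordS] is the cyclic successor, so the closing edge is included. *)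
Definition polygon_length {R : realType} (n : nat) (p : 'I_n -> plane R) : R :=
  \sum_(i < n) dist (p i) (p (ordS i)).

(* Arc length of the closed curve bounding a convex domain K: the supremum of
   the lengths of the closed polygons whose vertices follow one another along
   the boundary. Collinear consecutive vertices, which [orient] excludes, would
   not change any length. The value is finite for every convex domain. *)
Definition perimeter {R : realType} (K : set (plane R)) : \bar R :=
  ereal_sup [set l : \bar R | exists (n : nat) (p : 'I_n -> plane R),
    inscribed_polygon K p /\ l = (polygon_length p)%:E].

Definition triangle {R : realType} (a b c : plane R) : set (plane R) :=
  [set x | exists s t u : R, [/\ 0 <= s, 0 <= t, 0 <= u, s + t + u = 1 &
    x = s *: a + t *: b + u *: c]].

Definition centroid {R : realType} (a b c : plane R) : plane R :=
  3^-1 *: (a + b + c).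

Definition regular {R : realType} (a b c : plane R) : Prop :=
  [/\ 0 < dist a b, dist a b = dist b c & dist b c = dist c a].

Definition triangle_sandwich {R : realType} (K : set (plane R)) (rho : R) : Prop :=
  exists a b c : plane R,
    let T := triangle a b c in
    let z := centroid a b c in
    [/\ regular a b c,
        translate_by T z `<=` translate_by K z &
        translate_by K z `<=` dilate (1 + rho) (translate_by T z)].

(* The infimum is attained for a convex domain, so it is the minimal rho. *)
Definition dtr {R : realType} (K : set (plane R)) : R :=
  inf [set rho : R | 0 <= rho /\ triangle_sandwich K rho].

(* Main.v *)
Require Import Defs.
From HB Require Import structures.
From mathcomp Require Import all_boot all_order all_algebra.
From mathcomp Require Import all_classical all_reals all_analysis.
From mathcomp Require Import measurable_realfun.
From mathcomp Require Import ring lra zify.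
Import Order.TTheory GRing.Theory Num.Theory.
Import numFieldNormedType.Exports.

Set Implicit Arguments.
Unset Strict Implicit.
Unset Printing Implicit Defensive.

Local Open Scope classical_set_scope.
Local Open Scope ring_scope.

(** The extremal bodies of the inequality between perimeter and mixed area of K
and -K are the regular triangles. Below, after a similarity, K lies between the
regular triangle of inradius 1 centred at the origin and its dilate by a factor
1 + rho with rho <= 1 / 35 ([near_standard_exists]); c is the square root of 3,
and W k is the unit vector at 30 k degrees.

The two functionals enter through one inequality each. For six directions, images
of those of a regular hexagon under a linear map, the mixed area of K and -K is
at most that of the circumscribed hexagon and its reflection, an explicit
quadratic form in the support numbers ([mixed_area_le]): K leaves six corners of
its hexagon uncovered, each corner of the hexagon around K - K left uncovered by
K - K is at least as large as two opposite ones of K together, by slicing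
([leb2_corner_sum]), and twice the mixed area is area (K - K) - 2 area K. On the
other hand the perimeter is at least the length of each polygon whose vertices
are points of contact of K with supporting lines, in the order of the normals
([perimeter_ge_contacts]).

Take the polygon of the contact points with the twelve normals W k. Near each
corner of the triangle it has a contact point q with the normal of that corner,
and contact points with the two normals at 30 degrees from it. Reflecting in the
lines that support the sides straightens the three paths between the corner
points, and shows that the polygon is longer than the bound which the hexagon of
normals W 1, W 3, ..., W 11 allows for the mixed area by half the sum of the
distances by which the points q miss the neighbouring supporting lines. These
distances are therefore O(eps) ([corner_defects]). The hexagon of normals
W 0, W 2, ..., W 10 touches K near the corners only; by the preceding bound its
quadratic form is that of the triangle q1 q2 q3 up to O(eps), so that
L^2 <= 6 c area2 + 400 eps, where area2 is twice the area of q1 q2 q3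
([perimeter_le_triangle]).

This is an almost sharp isoperimetric inequality for the triangle itself, but L
is the perimeter of K: the caps of K beyond the sides, of heights t1, t2, t3, add
4 (t1 + t2 + t3)^2 to the square of the perimeter of the triangle
([hexagon_length]), and the triangle pays for the distance from q3 to the apex of
the equilateral triangle on q1 q2 ([isoperimetric_triangle]). Both are squares,
so the heights and that distance are O(sqrt eps); shrinking and stretching the
equilateral triangle on q1 q2 by factors 1 - O(sqrt eps) and 1 + O(sqrt eps)
gives the sandwich ([sandwich_of_near_equilateral]). *)

(** * Lebesgue measure of the plane under affine maps *)

Section area.
Context {R : realType}.
Local Notation mR := (measurableTypeR R).
Local Notation leb := (@lebesgue_measure R).
Local Notation leb2 := (leb \x leb)%E.

(** Uniqueness of Lebesgue measure: the rescaled push-forward has the right value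
on intervals. *)
Lemma lebesgue_preimage_affine_pos (k t : R) (A : set mR) :
  0 < k -> measurable A ->
  leb ((fun y : mR => k * y + t : mR) @^-1` A) = (k^-1%:E * leb A)%E.
Proof.
move=> k0 mA.
have mf : measurable_fun setT (fun y : mR => k * y + t : mR).
  by apply: measurable_funD => //; exact: measurable_funM.
pose kp : {nonneg R} := NngNum (ltW k0).
pose m' := mscale kp (pushforward leb (fun y : mR => k * y + t : mR)).
suff -> : leb A = m' mf A.
  by rewrite /m' /mscale /pushforward/= muleA -EFinM mulVf ?mul1e// gt_eqF.
apply: lebesgue_measure_unique => // _ [[a b]] _ <-/=.
rewrite /m' /mscale /pushforward/=.
rewrite /pushforward (_ : _ @^-1` _ = `](a - t) / k, (b - t) / k]%classic); last first.
  apply/seteqP; split=> y /=; rewrite !in_itv/= ltr_pdivrMr// ler_pdivlMr//;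
    by move=> /andP[h1 h2]; apply/andP; split; nra.
rewrite !lebesgue_measure_itv/= !lte_fin.
rewrite ltr_pM2r ?invr_gt0// ltrD2r; case: ifP => ab; last by rewrite mule0.
by rewrite -!EFinD -EFinM; congr EFin; field; rewrite gt_eqF.
Qed.

Lemma lebesgue_preimage_affine (k t : R) (A : set mR) :
  k != 0 -> measurable A ->
  leb ((fun y : mR => k * y + t : mR) @^-1` A) = (`|k|^-1%:E * leb A)%E.
Proof.
move=> kn0 mA; have [k0|k0] := ltP 0 k.
  by rewrite lebesgue_preimage_affine_pos// gtr0_norm.
have {}k0 : 0 < - k by rewrite oppr_gt0 lt_neqAle kn0.
have mN : measurable_fun setT (-%R : mR -> mR) by exact: oppr_measurable.
rewrite -(normrN k) gtr0_norm// -[in RHS]lebesgue_measureN//.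
rewrite -(lebesgue_preimage_affine_pos (- t))//; last first.
  by rewrite -[X in measurable X]setTI; exact: mN.
congr leb; apply/seteqP; split=> y /=;
  by rewrite (_ : - (- k * y - t) = k * y + t)//; ring.
Qed.

Lemma leb2_preimage_fiber (k : R) (f : mR -> mR) (A : set (mR * mR)) :
  k != 0 -> measurable_fun setT f -> measurable A ->
  leb2 ((fun z : mR * mR => (z.1, k * z.2 + f z.1 : mR)) @^-1` A) =
    (`|k|^-1%:E * leb2 A)%E.
Proof.
move=> k0 mf mA; rewrite /product_measure1.
rewrite -ge0_integralZl//; first last.
  exact: measurable_fun_xsection.
apply: eq_integral => x _ /=.
by rewrite -(lebesgue_preimage_affine (f x))//; exact: measurable_xsection.
Qed.

Lemma leb2_preimage_swap (A : set (mR * mR)) : measurable A ->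
  leb2 ((fun z : mR * mR => (z.2, z.1)) @^-1` A) = leb2 A.
Proof.
move=> mA; have ms : measurable_fun setT (fun z : mR * mR => (z.2, z.1)).
  exact: measurable_fun_pair.
apply/esym; apply: (@product_measure_unique _ _ _ _ _ _ _
  (pushforward leb2 (fun z : mR * mR => (z.2, z.1)))) => // X Y mX mY.
rewrite /= /pushforward (_ : _ @^-1` _ = Y `*` X).
  by rewrite product_measure1E// muleC.
by apply/seteqP; split=> -[a b]/= [].
Qed.

Definition lin2 (a b c d : R) (z : plane R) : plane R :=
  (a * z.1 + b * z.2, c * z.1 + d * z.2).

Lemma leb2_preimage_lin2_neq0 (a b c d : R) (A : set (mR * mR)) :
  a != 0 -> a * d - b * c != 0 -> measurable A ->
  leb2 (lin2 a b c d @^-1` A) = (`|a * d - b * c|^-1%:E * leb2 A)%E.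
Proof.
move=> a0 D0 mA.
have mM (k : R) : measurable_fun setT (fun y : mR => k * y : mR).
  exact: measurable_funM.
have mfib (k l : R) : measurable_fun setT
    (fun z : mR * mR => (z.1, k * z.2 + l * z.1 : mR)).
  apply: measurable_fun_pair => //; apply: measurable_funD.
    by apply: measurable_funM.
  by apply: measurable_funM.
have mfib' (k l : R) : measurable_fun setT
    (fun z : mR * mR => (k * z.1 + l * z.2 : mR, z.2)).
  apply: measurable_fun_pair => //; apply: measurable_funD.
    by apply: measurable_funM.
  by apply: measurable_funM.
have msw : measurable_fun setT (fun z : mR * mR => (z.2, z.1)).
  exact: measurable_fun_pair.
(* x' = a x + b y and then y' = (c / a) x' + (D / a) y. *)
pose A1 := (fun z : mR * mR => (z.1, (a * d - b * c) / a * z.2 + c / a * z.1)) @^-1` A.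
have mA1 : measurable A1 by rewrite -[A1]setTI; exact: mfib.
have A1E : leb2 A1 = (`|(a * d - b * c) / a|^-1%:E * leb2 A)%E.
  by apply: leb2_preimage_fiber => //; rewrite mulf_neq0// invr_neq0.
pose A2 := (fun z : mR * mR => (z.2, z.1)) @^-1` A1.
have mA2 : measurable A2 by rewrite -[A2]setTI; exact: msw.
pose A3 := (fun z : mR * mR => (z.1, a * z.2 + b * z.1)) @^-1` A2.
have mA3 : measurable A3 by rewrite -[A3]setTI; exact: mfib.
have A3E : leb2 A3 = (`|a|^-1%:E * leb2 A2)%E.
  exact: leb2_preimage_fiber.
have -> : lin2 a b c d @^-1` A = (fun z : mR * mR => (z.2, z.1)) @^-1` A3.
  apply/seteqP; split=> -[x y] /=; rewrite /lin2 /A3 /A2 /A1/=;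
  by rewrite (_ : (a * d - b * c) / a * y + c / a * (a * x + b * y) =
                 c * x + d * y)//; field.
rewrite leb2_preimage_swap// A3E leb2_preimage_swap// A1E muleA -EFinM.
by congr (_%:E * _)%E; rewrite normrM normfV invfM invrK mulrCA mulVf ?mulr1 ?normr_eq0.
Qed.

(** When a = 0, exchanging the coordinates leads back to the case a != 0. *)
Lemma leb2_preimage_lin2 (a b c d : R) (A : set (mR * mR)) :
  a * d - b * c != 0 -> measurable A ->
  leb2 (lin2 a b c d @^-1` A) = (`|a * d - b * c|^-1%:E * leb2 A)%E.
Proof.
move=> D0 mA; have [a0|] := eqVneq a 0; last first.
  by move=> a0; exact: leb2_preimage_lin2_neq0.
have b0 : b != 0 by apply: contraNneq D0 => ->; rewrite a0 !mul0r subrr.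
have ms : measurable_fun setT (fun z : mR * mR => (z.2, z.1)).
  exact: measurable_fun_pair.
have mlin : measurable_fun setT
    (fun z : mR * mR => (b * z.1 + a * z.2 : mR, d * z.1 + c * z.2 : mR)).
  apply: measurable_fun_pair; apply: measurable_funD; apply: measurable_funM => //.
rewrite -normrN opprB -leb2_preimage_lin2_neq0//; last first.
  by rewrite -oppr_eq0 opprB.
rewrite -[RHS]leb2_preimage_swap; last first.
  by rewrite -[X in measurable X]setTI; apply: mlin.
congr leb2; apply/seteqP; split=> -[x y] /=; rewrite /lin2/=;
  by rewrite (addrC (a * _)) (addrC (c * _)).
Qed.

Lemma leb2_preimage_shift (t : plane R) (A : set (mR * mR)) : measurable A ->
  leb2 ((fun z : plane R => z + t) @^-1` A) = leb2 A.
Proof.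
move=> mA.
have mfib (l : R) : measurable_fun setT
    (fun z : mR * mR => (z.1, 1 * z.2 + l : mR)).
  by apply: measurable_fun_pair => //; apply: measurable_funD;
    [apply: measurable_funM|].
have msw : measurable_fun setT (fun z : mR * mR => (z.2, z.1)).
  exact: measurable_fun_pair.
pose A1 := (fun z : mR * mR => (z.1, 1 * z.2 + t.2 : mR)) @^-1` A.
have mA1 : measurable A1 by rewrite -[A1]setTI; exact: mfib.
pose A2 := (fun z : mR * mR => (z.2, z.1)) @^-1` A1.
have mA2 : measurable A2 by rewrite -[A2]setTI; exact: msw.
pose A3 := (fun z : mR * mR => (z.1, 1 * z.2 + t.1 : mR)) @^-1` A2.
have mA3 : measurable A3 by rewrite -[A3]setTI; exact: mfib.
have -> : (fun z : plane R => z + t) @^-1` A =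
    (fun z : mR * mR => (z.2, z.1)) @^-1` A3.
  apply/seteqP; split=> -[x y] /=; rewrite /A3 /A2 /A1/= !mul1r;
  by rewrite -[(x, y) + t]/(x + t.1, y + t.2).
rewrite leb2_preimage_swap// (@leb2_preimage_fiber 1 (fun=> t.1))//.
rewrite leb2_preimage_swap// (@leb2_preimage_fiber 1 (fun=> t.2))//.
by rewrite normr1 invr1 !mul1e.
Qed.

(** Every open set of the plane is a countable union of rational boxes. *)
Lemma open_measurable_plane (O : set (plane R)) : open O ->
  measurable (O : set (mR * mR)).
Proof.
move=> oO.
pose box (q : (rat * rat) * (rat * rat)) : set (mR * mR) :=
  `](ratr q.1.1 : R), (ratr q.1.2 : R)[%classic `*`
  `](ratr q.2.1 : R), (ratr q.2.2 : R)[%classic.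
have -> : (O : set (mR * mR)) =
    \bigcup_q (if `[< box q `<=` O >] then box q else set0).
  apply/seteqP; split=> [z Oz|z [q _]]; last by case: asboolP => // h; exact: h.
  have /nbhs_ballP[e /= e0 he] : nbhs (z : plane R) O by exact: open_nbhs_nbhs.
  have lo (x : R) : x - e < x by rewrite ltrBlDr ltrDl.
  have hi (x : R) : x < x + e by rewrite ltrDl.
  have [a1 a1P] := rat_in_itvoo (lo z.1); have [b1 b1P] := rat_in_itvoo (hi z.1).
  have [a2 a2P] := rat_in_itvoo (lo z.2); have [b2 b2P] := rat_in_itvoo (hi z.2).
  move: a1P b1P a2P b2P; rewrite !in_itv/= => /andP[? ?] /andP[? ?] /andP[? ?] /andP[? ?].
  exists ((a1, b1), (a2, b2)) => //; case: asboolP => [_|[]].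
    by split => /=; rewrite in_itv/=; apply/andP.
  move=> w [/=]; rewrite !in_itv/= => /andP[? ?] /andP[? ?]; apply: he.
  by split; rewrite /ball/= /ball/= ltr_distl; apply/andP; split; lra.
apply: countable_bigcupT_measurable => // q; case: asboolP => // _.
exact: measurableX.
Qed.

Lemma closed_measurable_plane (C : set (plane R)) : closed C ->
  measurable (C : set (mR * mR)).
Proof.
move=> cC; rewrite -(setCK C); apply: measurableC; apply: open_measurable_plane.
exact: closed_openC.
Qed.

Lemma compact_measurable_plane (C : set (plane R)) : compact C ->
  measurable (C : set (mR * mR)).
Proof.
move=> cC; apply: closed_measurable_plane; exact: compact_closed.
Qed.

Lemma leb2U (A B : set (mR * mR)) : measurable A -> measurable B ->
  A `&` B = set0 -> leb2 (A `|` B) = (leb2 A + leb2 B)%E.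
Proof. by move=> mA mB AB; rewrite measureU. Qed.

End area.

(** * Linear functionals and corners *)

Section plane_geometry.
Context {R : realType}.
Implicit Types (K M : set (plane R)) (v w x : plane R).

Lemma plane_eq x y : x.1 = y.1 -> x.2 = y.2 -> x = y.
Proof. by case: x y => ? ? [? ?] /= -> ->. Qed.

Lemma fstD x y : (x + y).1 = x.1 + y.1. Proof. by []. Qed.
Lemma sndD x y : (x + y).2 = x.2 + y.2. Proof. by []. Qed.
Lemma fstN x : (- x).1 = - x.1. Proof. by []. Qed.
Lemma sndN x : (- x).2 = - x.2. Proof. by []. Qed.
Lemma fstZ (a : R) x : (a *: x).1 = a * x.1. Proof. by []. Qed.
Lemma sndZ (a : R) x : (a *: x).2 = a * x.2. Proof. by []. Qed.
Lemma fst0 : (0 : plane R).1 = 0. Proof. by []. Qed.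
Lemma snd0 : (0 : plane R).2 = 0. Proof. by []. Qed.
Definition planeE := (fst0, snd0, fstD, sndD, fstN, sndN, fstZ, sndZ).

Definition dot v x : R := v.1 * x.1 + v.2 * x.2.
Definition crs v x : R := v.1 * x.2 - v.2 * x.1.

Lemma dotD v x y : dot v (x + y) = dot v x + dot v y.
Proof. by rewrite /dot !mulrDr addrACA. Qed.

Lemma dotN v x : dot v (- x) = - dot v x.
Proof. by rewrite /dot !mulrN opprD. Qed.

Lemma dotB v x y : dot v (x - y) = dot v x - dot v y.
Proof. by rewrite dotD dotN. Qed.

Lemma dotZ v (a : R) x : dot v (a *: x) = a * dot v x.
Proof. by rewrite /dot !planeE; ring. Qed.

Lemma dotDl v w x : dot (v + w) x = dot v x + dot w x.
Proof. by rewrite /dot !mulrDl addrACA. Qed.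

Lemma dotNl v x : dot (- v) x = - dot v x.
Proof. by rewrite /dot !mulNr opprD. Qed.

Lemma dotBl v w x : dot (v - w) x = dot v x - dot w x.
Proof. by rewrite dotDl dotNl. Qed.

Lemma dotZl (a : R) v x : dot (a *: v) x = a * dot v x.
Proof. by rewrite /dot !planeE; ring. Qed.

Lemma fst_continuous_plane : continuous (fst : plane R -> R).
Proof. by move=> x; exact: cvg_fst. Qed.

Lemma snd_continuous_plane : continuous (snd : plane R -> R).
Proof. by move=> x; exact: cvg_snd. Qed.

Lemma dot_continuous v : continuous (dot v : plane R -> R).
Proof.
move=> x; apply: cvgD; apply: cvgM; try exact: cvg_cst.
  exact: fst_continuous_plane.
exact: snd_continuous_plane.
Qed.

Lemma compact_dot_max K v : compact K -> K !=set0 ->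
  exists2 t, K t & forall k, K k -> dot v k <= dot v t.
Proof.
move=> cK K0.
have [|t tK tmax] := compact_EVT_max (f := dot v) K0 cK.
  by apply: continuous_subspaceT; exact: dot_continuous.
by exists t => [|k Kk]; [rewrite inE in tK|apply: tmax; rewrite inE].
Qed.

(** The part of the half-planes [dot v x <= a], [dot w x <= b] that no
translate of the opposite quadrant with apex in K reaches: what a corner of a
circumscribed polygon has in excess of K. *)
Definition corner v w (a b : R) K : set (plane R) :=
  [set x | [/\ dot v x <= a, dot w x <= b &
    forall k, K k -> dot v k < dot v x \/ dot w k < dot w x]].

Lemma closed_dot_le v (a : R) : closed [set x | dot v x <= a].
Proof.
rewrite (_ : [set x | _] = dot v @^-1` [set y : R | y <= a])//.
by apply: (preimage_closed _ (@closed_le R a)) => x _; exact: dot_continuous.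
Qed.

Lemma open_dot_lt v (a : R) : open [set x | dot v x < a].
Proof.
rewrite (_ : [set x | _] = dot v @^-1` [set y : R | y < a])//.
by apply: (open_comp _ (@open_lt R a)) => x _; exact: dot_continuous.
Qed.

(** Compactness makes the distance to the apexes attained, whence the region
below them is closed. *)
Lemma open_unreached v w K : compact K ->
  open [set x | forall k, K k -> dot v k < dot v x \/ dot w k < dot w x].
Proof.
move=> cK; have [K0|K0] := pselect (K !=set0); last first.
  rewrite (_ : [set x | _] = setT); first exact: openT.
  by apply/seteqP; split=> x // _ k Kk; exfalso; apply: K0; exists k.
rewrite openE => x /= xK.
have cB u : continuous (fun k : plane R => dot u x - dot u k : R^o).
  by move=> k; apply: cvgB; [exact: cvg_cst|exact: dot_continuous].
have [|t tK tmin] := compact_EVT_min (f := (fun k : plane R =>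
    dot v x - dot v k : R^o) \max (fun k => dot w x - dot w k : R^o)) K0 cK.
  by apply: continuous_subspaceT => k; apply: continuous_max; exact: cB.
rewrite /= in tmin.
set m := Num.max _ _ in tmin.
have m0 : 0 < m.
  rewrite inE in tK; rewrite lt_max !subr_gt0.
  by case: (xK _ tK) => ->; rewrite ?orbT.
have nv : nbhs x [set y | dot v x - m < dot v y].
  apply: open_nbhs_nbhs; split; last by rewrite /= ltrBlDr ltrDl.
  rewrite (_ : [set y | _] = [set y | dot (- v) y < m - dot v x]); first exact: open_dot_lt.
  by apply/seteqP; split=> y /=; rewrite dotNl; lra.
have nw : nbhs x [set y | dot w x - m < dot w y].
  apply: open_nbhs_nbhs; split; last by rewrite /= ltrBlDr ltrDl.
  rewrite (_ : [set y | _] = [set y | dot (- w) y < m - dot w x]); first exact: open_dot_lt.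
  by apply/seteqP; split=> y /=; rewrite dotNl; lra.
rewrite /interior; near=> y => k Kk.
have yv : dot v x - m < dot v y by near: y.
have yw : dot w x - m < dot w y by near: y.
have := tmin k; rewrite inE => /(_ Kk); rewrite le_max => /orP[h|h]; [left|right]; lra.
Unshelve. all: by end_near. Qed.

Lemma measurable_corner v w a b K : compact K ->
  measurable (corner v w a b K : set (measurableTypeR R * measurableTypeR R)).
Proof.
move=> cK; rewrite (_ : corner _ _ _ _ _ = [set x | dot v x <= a] `&`
  [set x | dot w x <= b] `&`
  [set x | forall k, K k -> dot v k < dot v x \/ dot w k < dot w x]); last first.
  by apply/seteqP; split=> x [] => [|[]].
apply: measurableI; last by apply: open_measurable_plane; exact: open_unreached.
by apply: measurableI; apply: closed_measurable_plane; exact: closed_dot_le.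
Qed.

End plane_geometry.

(** * Corners of a Minkowski sum *)

Section corners.
Context {R : realType}.
Implicit Types (K M P Q : set (plane R)) (v w x : plane R).
Local Notation mR := (measurableTypeR R).
Local Notation leb := (@lebesgue_measure R).
Local Notation leb2 := (leb \x leb)%E.

Lemma compact_minkowski_sum K M : compact K -> compact M ->
  compact (minkowski_sum K M).
Proof.
move=> cK cM.
rewrite (_ : minkowski_sum K M =
    (fun z : plane R * plane R => z.1 + z.2) @` (K `*` M)).
  apply: continuous_compact; last exact: compact_setX.
  apply: continuous_subspaceT => z; apply: cvgD; [exact: cvg_fst|exact: cvg_snd].
apply/seteqP; split=> [_ [k Kk [m Mm <-]]|_ [[k m] [/= Kk Mm] <-]].
  by exists (k, m).
by exists k => //; exists m.
Qed.

(** The region under the staircase of P, in the closed first quadrant. *)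
Definition under P : set (plane R) :=
  [set z | [/\ 0 <= z.1, 0 <= z.2 & forall p, P p -> z.1 < p.1 \/ z.2 < p.2]].

Lemma underE P : under P = corner (-1, 0) (0, -1) 0 0 P.
Proof.
apply/seteqP; split=> z [h1 h2 h3]; split; move: h1 h2; rewrite /dot/= ?mul0r ?addr0 ?add0r;
  try lra; move=> _ _ p /h3; rewrite /dot/=; case=> h; [left|right|left|right]; lra.
Qed.

Lemma measurable_under P : compact P -> measurable (under P : set (mR * mR)).
Proof. by move=> cP; rewrite underE; exact: measurable_corner. Qed.

Lemma corner_under v w a b K :
  corner v w a b K = (fun x => (a - dot v x, b - dot w x)) @^-1`
    under [set (a - dot v k, b - dot w k) | k in K].
Proof.
apply/seteqP; split=> x [h1 h2 h3].
  split => /=; [lra|lra|] => _ [k Kk <-]/=.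
  by case: (h3 _ Kk) => h; [left|right]; lra.
split; move: h1 h2 => /=; try lra.
move=> _ _ k Kk; have [||] := h3 (a - dot v k, b - dot w k); first by exists k.
  by move=> /= h; left; lra.
by move=> /= h; right; lra.
Qed.

Lemma compact_chart v w a b K : compact K ->
  compact ([set (a - dot v k, b - dot w k) | k in K] : set (plane R)).
Proof.
move=> cK; apply: continuous_compact => //; apply: continuous_subspaceT => x.
have c u (e : R) : continuous (fun k : plane R => e - dot u k : R^o).
  by move=> k; apply: cvgB; [exact: cvg_cst|exact: dot_continuous].
exact: (cvg_pair (c v a x) (c w b x)).
Qed.

Lemma leb2_chart v w (a b : R) (A : set (mR * mR)) :
  crs v w != 0 -> measurable A ->
  leb2 ((fun x : plane R => (a - dot v x, b - dot w x)) @^-1` A) =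
    (`|crs v w|^-1%:E * leb2 A)%E.
Proof.
move=> vw mA; rewrite -[in RHS](leb2_preimage_shift (a, b))//.
have -> : crs v w = (- v.1) * (- w.2) - (- v.2) * (- w.1).
  by rewrite /crs; ring.
have E (x : plane R) : lin2 (- v.1) (- v.2) (- w.1) (- w.2) x + (a, b) =
    (a - dot v x, b - dot w x) :> plane R.
  by apply: plane_eq; rewrite !planeE /lin2 /dot /=; ring.
rewrite -leb2_preimage_lin2.
- by congr leb2; apply/seteqP; split=> x; rewrite /preimage/mkset E.
- by move: vw; rewrite /crs !mulrNN.
- rewrite -[_ @^-1` _]setTI.
  apply: (_ : measurable_fun setT (fun z : mR * mR => (z.1 + a : mR, z.2 + b : mR))) => //.
  by apply: measurable_fun_pair; apply: measurable_funD.
Qed.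

Lemma xsection_under P (s : R) : compact P -> 0 <= s ->
  (exists2 p, P p & p.1 = 0) -> (forall p, P p -> 0 <= p.2) ->
  exists al : R, [/\ 0 <= al, xsection (under P : set (mR * mR)) s = `[0, al[%classic &
    forall p, P p -> p.1 <= s -> al <= p.2].
Proof.
move=> cP s0 [p0 Pp0 p01] Pge0.
have cPs : compact (P `&` [set p | dot (1, 0) p <= s]).
  by apply: compact_closedI => //; exact: closed_dot_le.
have dE p : dot (1, 0) p = p.1 by rewrite /dot/= mul1r mul0r addr0.
have [|t [Pt /= ts] tmin] := compact_dot_max (0, -1) cPs.
  by exists p0; split => //=; rewrite dE p01.
have {}tmin p : P p -> p.1 <= s -> t.2 <= p.2.
  move=> Pp ps; have : P p /\ dot (1, 0) p <= s by rewrite dE.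
  by move=> /tmin; rewrite /dot/= !mul0r !add0r; lra.
exists t.2; split => //; first exact: Pge0.
apply/seteqP; split=> y; rewrite /xsection/= inE in_itv/=.
  move=> [/= _ y0 h]; rewrite y0/=; case: (h _ Pt) => //.
  by rewrite dE in ts; lra.
move=> /andP[y0 yt]; split => //= p Pp; have [|sp] := ltP s p.1; first by left.
by right; exact: lt_le_trans yt (tmin _ Pp sp).
Qed.

(** Slicewise: a point of P + Q of abscissa at most s is a sum of points of
P and Q of abscissa at most s, so heights under the staircases add. *)
Lemma leb2_under_sum P Q : compact P -> compact Q ->
  (exists2 p, P p & p.1 = 0) -> (exists2 p, Q p & p.1 = 0) ->
  (forall p, P p -> 0 <= p.1 /\ 0 <= p.2) ->
  (forall p, Q p -> 0 <= p.1 /\ 0 <= p.2) ->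
  (leb2 (under P) + leb2 (under Q) <= leb2 (under (minkowski_sum P Q)))%E.
Proof.
move=> cP cQ P1 Q1 P0 Q0.
have cPQ := compact_minkowski_sum cP cQ.
rewrite /product_measure1 -ge0_integralD//; first last.
- by apply: measurable_fun_xsection; exact: measurable_under.
- by apply: measurable_fun_xsection; exact: measurable_under.
apply: ge0_le_integral => //.
- by move=> x _; rewrite adde_ge0.
- by apply: emeasurable_funD; apply: measurable_fun_xsection; exact: measurable_under.
- by apply: measurable_fun_xsection; exact: measurable_under.
move=> s _ /=; have [s0|s0] := ltP s 0.
  have e (A : set (plane R)) : xsection (under A : set (mR * mR)) s = set0.
    by apply/seteqP; split=> y; rewrite /xsection/= ?inE// => -[/=]; lra.
  by rewrite !e measure0 adde0.
have [p /P0[_ ?]|al [al0 -> alP]] := xsection_under cP s0 P1; first by [].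
have [p /Q0[_ ?]|be [be0 -> beQ]] := xsection_under cQ s0 Q1; first by [].
apply: (@le_trans _ _ (leb `[0, al + be[%classic)).
  rewrite !lebesgue_measure_itv/= !lte_fin.
  case: ifP => ha; case: ifP => hb; case: ifP => hc; rewrite -?EFinD ?adde0 ?add0e lee_fin; lra.
apply: le_measure; rewrite ?inE//.
  by apply: measurable_xsection; exact: measurable_under.
move=> y; rewrite /xsection/= in_itv/= inE => /andP[y0 yab]; split => //=.
move=> _ [p Pp [q Qq <-]]; rewrite -[(p + q).1]/(p.1 + q.1) -[(p + q).2]/(p.2 + q.2).
have [_|sp] := ltP s (p.1 + q.1); first by left.
right; have [? _] := P0 _ Pp; have [? _] := Q0 _ Qq.
have := alP _ Pp; have := beQ _ Qq => h1 h2.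
have {}h1 := h1 ltac:(lra); have {}h2 := h2 ltac:(lra); lra.
Qed.

(** In the coordinates (a - v, b - w) a corner is the region under a staircase,
and the chart of a sum is the sum of the charts. *)
Lemma leb2_corner_sum v w (a b c d : R) K M : crs v w != 0 ->
  compact K -> compact M ->
  (forall k, K k -> dot v k <= a /\ dot w k <= b) ->
  (forall k, M k -> dot v k <= c /\ dot w k <= d) ->
  (exists2 k, K k & dot v k = a) -> (exists2 k, M k & dot v k = c) ->
  (leb2 (corner v w a b K) + leb2 (corner v w c d M) <=
   leb2 (corner v w (a + c) (b + d) (minkowski_sum K M)))%E.
Proof.
move=> vw cK cM Kab Mcd [k0 Kk0 k0a] [m0 Mm0 m0c].
have cKM := compact_minkowski_sum cK cM.
rewrite !corner_under !leb2_chart//; try by apply: measurable_under; exact: compact_chart.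
rewrite -ge0_muleDr//; apply: lee_pmul => //.
  by rewrite adde_ge0.
apply: le_trans (leb2_under_sum _ _ _ _ _ _) _; try exact: compact_chart.
- by exists (a - dot v k0, b - dot w k0); [exists k0|rewrite /= k0a subrr].
- by exists (c - dot v m0, d - dot w m0); [exists m0|rewrite /= m0c subrr].
- by move=> _ [k /Kab[? ?] <-]/=; split; lra.
- by move=> _ [k /Mcd[? ?] <-]/=; split; lra.
have mKM : measurable (under [set (a + c - dot v k, b + d - dot w k) |
    k in minkowski_sum K M] : set (mR * mR)).
  by apply: measurable_under; exact: compact_chart.
have msum : measurable (under (minkowski_sum
    [set (a - dot v k, b - dot w k) | k in K]
    [set (c - dot v k, d - dot w k) | k in M]) : set (mR * mR)).
  by apply: measurable_under; apply: compact_minkowski_sum; exact: compact_chart.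
apply: le_measure; rewrite ?inE// => z [z1 z2 h].
split => // p [u [k Kk [m Mm <-{u}]] <-{p}].
apply: (h (a + c - dot v (k + m), b + d - dot w (k + m))).
exists (a - dot v k, b - dot w k); first by exists k.
exists (c - dot v m, d - dot w m); first by exists m.
by apply: plane_eq; rewrite !planeE /= !dotD; ring.
Qed.

Lemma leb2_corner_opp v w a b K : compact K ->
  leb2 (corner v w a b (reflect_set K)) = leb2 (corner (- v) (- w) a b K).
Proof.
move=> cK.
have -> : corner v w a b (reflect_set K) =
    lin2 (-1) 0 0 (-1) @^-1` corner (- v) (- w) a b K.
  have e x : lin2 (-1) 0 0 (-1) x = - x :> plane R.
    by case: x => x1 x2; rewrite /lin2/= !mul0r addr0 add0r !mulN1r.
  apply/seteqP; split=> x /=; rewrite ?e => -[h1 h2 h3].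
    split; rewrite ?dotNl ?dotN ?opprK// => k Kk.
    have [||] := h3 (- k); first by exists k.
      by rewrite !dotNl !dotN; left; lra.
    by rewrite !dotNl !dotN; right; lra.
  move: h1 h2; rewrite !dotNl !dotN !opprK => h1 h2; split => // _ [k Kk <-].
  by case: (h3 _ Kk); rewrite !dotNl !dotN; [left|right]; lra.
rewrite leb2_preimage_lin2//; last exact: measurable_corner.
by rewrite mulr0 subr0 mulrNN mulr1 normr1 invr1 mul1e.
Qed.

End corners.

(** * Area of a hexagon with sides in three directions *)

Section hexagons.
Context {R : realType}.
Implicit Types (K M P Q : set (plane R)) (v w x : plane R).
Local Notation mR := (measurableTypeR R).
Local Notation leb := (@lebesgue_measure R).
Local Notation leb2 := (leb \x leb)%E.

Definition right_triangle (s : R) : set (plane R) :=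
  [set z | [/\ 0 <= z.1, 0 <= z.2 & z.1 + z.2 < s]].

Lemma leb2_box (a b c d : R) : a <= b -> c <= d ->
  leb2 [set z : mR * mR | a <= z.1 <= b /\ c <= z.2 <= d] =
    ((b - a) * (d - c))%:E.
Proof.
move=> ab cd; rewrite (_ : [set z | _] = `[a, b]%classic `*` `[c, d]%classic).
  rewrite product_measure1E//= !lebesgue_measure_itv/= !lte_fin.
  case: ltP => h1; case: ltP => h2; rewrite -?EFinD ?mul0e ?mule0 -?EFinM//; congr EFin.
  - by rewrite (_ : c = d) ?subrr ?mulr0//; lra.
  - by rewrite (_ : a = b) ?subrr ?mul0r//; lra.
  - by rewrite (_ : a = b) ?subrr ?mul0r//; lra.
by apply/seteqP; split=> z /=; rewrite !in_itv.
Qed.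

Lemma measurable_right_triangle s : measurable (right_triangle s : set (mR * mR)).
Proof.
rewrite (_ : right_triangle s = [set x | dot (-1, 0) x <= 0] `&`
  [set x | dot (0, -1) x <= 0] `&` [set x | dot (1, 1) x < s]).
  apply: measurableI; last by apply: open_measurable_plane; exact: open_dot_lt.
  by apply: measurableI; apply: closed_measurable_plane; exact: closed_dot_le.
apply/seteqP; split=> z; rewrite /dot/= ?mul0r ?mul1r ?addr0 ?add0r.
  by move=> [? ? ?]; split; [split|]; rewrite /=; lra.
by move=> [[/= ? ?] ?]; split; lra.
Qed.

(** The square on two legs splits into the triangle, its mirror image in the
centre of the square, and a diagonal, which is negligible. *)
Lemma leb2_right_triangle (s : R) : 0 <= s ->
  leb2 (right_triangle s) = (s ^+ 2 / 2)%:E.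
Proof.
move=> s0.
pose B := [set z : mR * mR | 0 <= z.1 <= s /\ 0 <= z.2 <= s].
pose T' := (fun x : plane R => (s - dot (1, 0) x, s - dot (0, 1) x)) @^-1`
  right_triangle s.
pose D := [set z : mR * mR | 0 <= z.1 <= s /\ z.2 = s - z.1].
have dE (x : plane R) : (dot (1, 0) x = x.1) * (dot (0, 1) x = x.2).
  by rewrite /dot/= !mul1r !mul0r add0r addr0.
have mT := measurable_right_triangle s.
have c1 : crs (1, 0) (0, 1) != 0 :> R by rewrite /crs/= mulr1 mul0r subr0 oner_neq0.
have T'E : leb2 T' = leb2 (right_triangle s).
  rewrite leb2_chart//.
  by rewrite /crs/= mulr1 mul0r subr0 normr1 invr1 mul1e.
have mD : measurable D.
  rewrite (_ : D = [set x : plane R | dot (-1, 0) x <= 0] `&`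
    [set x : plane R | dot (1, 0) x <= s] `&` ([set x : plane R | dot (1, 1) x <= s] `&`
    [set x : plane R | dot (-1, -1) x <= - s])).
    by repeat apply: measurableI; apply: closed_measurable_plane; exact: closed_dot_le.
  apply/seteqP; split=> z; rewrite /dot/= ?mul0r ?mul1r ?addr0 ?add0r.
    by move=> [/andP[? ?] ->]; split; split; rewrite /=; lra.
  by move=> [[/= ? ?] [/= ? ?]]; split; [apply/andP; split|]; lra.
have mB : measurable B.
  rewrite (_ : B = `[0, s]%classic `*` `[0, s]%classic); first exact: measurableX.
  by apply/seteqP; split=> z /=; rewrite !in_itv.
have mT' : measurable (T' : set (mR * mR)).
  rewrite (_ : T' = B `\` (right_triangle s `|` D)).
    by apply: measurableD => //; exact: measurableU.
  apply/seteqP; split=> z; rewrite /T' /right_triangle /B /D/= !dE.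
    move=> [? ? ?]; split; first by split; apply/andP; split; lra.
    by move=> [[]|[]]; lra.
  move=> [[/andP[? ?] /andP[? ?]] h]; split; try lra.
  have [h1|h1|h1] := ltgtP (z.1 + z.2) s; try lra.
    by exfalso; apply: h; left.
have D0 : leb2 D = 0%E.
  rewrite /product_measure1; apply: integral0_eq => x _ /=.
  have [h|h] := boolP (0 <= x <= s).
    rewrite (_ : xsection D x = [set s - x]) ?lebesgue_measure_set1//.
    by apply/seteqP; split=> y; rewrite /xsection/D/= inE/=; [case|split].
  rewrite (_ : xsection D x = set0) ?measure0//.
  by apply/seteqP; split=> y //; rewrite /xsection/= inE => -[]; rewrite (negbTE h).
have BE : B = right_triangle s `|` T' `|` D.
  apply/seteqP; split=> z; rewrite /T' /right_triangle /B /D/= !dE.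
    move=> [/andP[? ?] /andP[? ?]]; have [h1|h1|h1] := ltgtP (z.1 + z.2) s.
    - by left; left.
    - by left; right; split; lra.
    - by right; split; [apply/andP|lra].
  by move=> [[[? ? ?]|[? ? ?]]|[/andP[? ?] ?]]; split; apply/andP; split; lra.
have := leb2_box s0 s0; rewrite -/B BE leb2U//; first last.
- apply/seteqP; split=> z //; rewrite /T' /right_triangle /D/= !dE.
  by move=> [[[]|[]] ? ? ? []]; lra.
- exact: measurableU.
rewrite leb2U//; last first.
  by apply/seteqP; split=> z //; rewrite /T' /right_triangle/= !dE => -[[? ? ?] []]; lra.
rewrite D0 adde0 T'E subr0.
case: (leb2 _) => [r|//|//] => -[h]; congr EFin; lra.
Qed.

Definition hexagon (h : nat -> R) : set (plane R) :=
  [set z | [/\ [/\ z.1 <= h 0%N, z.2 <= h 1%N & z.2 - z.1 <= h 2%N],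
    - z.1 <= h 3%N, - z.2 <= h 4%N & z.1 - z.2 <= h 5%N]].

(** The hexagon is a box from which two right triangles at opposite vertices are
cut off; the inequalities between the h i keep these triangles inside the box
and apart from each other. *)
Lemma leb2_hexagon (h : nat -> R) :
  h 0%N <= h 5%N + h 1%N -> h 1%N <= h 0%N + h 2%N -> h 3%N <= h 2%N + h 4%N ->
  h 4%N <= h 3%N + h 5%N -> 0 <= h 2%N + h 5%N ->
  h 2%N <= h 1%N + h 3%N -> h 5%N <= h 0%N + h 4%N ->
  0 <= h 0%N + h 3%N -> 0 <= h 1%N + h 4%N ->
  measurable (hexagon h : set (mR * mR)) /\
  leb2 (hexagon h) = ((h 0%N + h 3%N) * (h 1%N + h 4%N)
    - (h 1%N + h 3%N - h 2%N) ^+ 2 / 2 - (h 0%N + h 4%N - h 5%N) ^+ 2 / 2)%:E.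
Proof.
move=> h0 h1 h3 h4 h25 h2 h5 h03 h14.
pose B := [set z : mR * mR | - h 3%N <= z.1 <= h 0%N /\ - h 4%N <= z.2 <= h 1%N].
pose T1 := (fun x : plane R => (h 3%N - dot (-1, 0) x, h 1%N - dot (0, 1) x)) @^-1`
  right_triangle (h 1%N + h 3%N - h 2%N).
pose T2 := (fun x : plane R => (h 0%N - dot (1, 0) x, h 4%N - dot (0, -1) x)) @^-1`
  right_triangle (h 0%N + h 4%N - h 5%N).
have dE (x : plane R) : (dot (1, 0) x = x.1) * (dot (0, 1) x = x.2) *
    ((dot (-1, 0) x = - x.1) * (dot (0, -1) x = - x.2)).
  by rewrite /dot/= !mulN1r !mul1r !mul0r !add0r !addr0.
have T1E : leb2 T1 = ((h 1%N + h 3%N - h 2%N) ^+ 2 / 2)%:E.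
  rewrite leb2_chart; [rewrite leb2_right_triangle; [|lra]|..].
  - by rewrite /crs/= mul0r subr0 mulr1 normrN1 invr1 mul1e.
  - by rewrite /crs/= mul0r subr0 mulr1 oppr_eq0 oner_neq0.
  - exact: measurable_right_triangle.
have T2E : leb2 T2 = ((h 0%N + h 4%N - h 5%N) ^+ 2 / 2)%:E.
  rewrite leb2_chart; [rewrite leb2_right_triangle; [|lra]|..].
  - by rewrite /crs/= mul0r subr0 mul1r normrN1 invr1 mul1e.
  - by rewrite /crs/= mul0r subr0 mul1r oppr_eq0 oner_neq0.
  - exact: measurable_right_triangle.
have mH : measurable (hexagon h : set (mR * mR)).
  rewrite (_ : hexagon h = ([set x | dot (1, 0) x <= h 0%N] `&`
    [set x | dot (0, 1) x <= h 1%N] `&` [set x | dot (-1, 1) x <= h 2%N]) `&`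
    ([set x | dot (-1, 0) x <= h 3%N] `&`
    [set x | dot (0, -1) x <= h 4%N] `&` [set x | dot (1, -1) x <= h 5%N])).
    by repeat apply: measurableI; apply: closed_measurable_plane; exact: closed_dot_le.
  apply/seteqP; split=> z; rewrite /hexagon /dot/= ?mul0r ?mul1r ?addr0 ?add0r.
    by move=> [[? ? ?] ? ? ?]; split; (split; [split|]); rewrite /=; lra.
  by move=> [[[/= ? ?] ?] [[/= ? ?] ?]]; split; [split|..]; lra.
have mB : measurable B.
  rewrite (_ : B = `[- h 3%N, h 0%N]%classic `*` `[- h 4%N, h 1%N]%classic).
    exact: measurableX.
  by apply/seteqP; split=> z /=; rewrite !in_itv.
have T1P z : T1 z <-> [/\ - h 3%N <= z.1, z.2 <= h 1%N & h 2%N < z.2 - z.1].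
  by rewrite /T1 /right_triangle/= !dE; split=> -[? ? ?]; split; lra.
have T2P z : T2 z <-> [/\ z.1 <= h 0%N, - h 4%N <= z.2 & h 5%N < z.1 - z.2].
  by rewrite /T2 /right_triangle/= !dE; split=> -[? ? ?]; split; lra.
have mT1 : measurable (T1 : set (mR * mR)).
  rewrite (_ : T1 = [set x | dot (-1, 0) x <= h 3%N] `&`
    [set x | dot (0, 1) x <= h 1%N] `&` [set x | dot (1, -1) x < - h 2%N]).
    apply: measurableI; last by apply: open_measurable_plane; exact: open_dot_lt.
    by apply: measurableI; apply: closed_measurable_plane; exact: closed_dot_le.
  apply/seteqP; split=> z.
    by move=> /T1P[? ? ?]; split; [split|]; rewrite /= /dot/=; lra.
  by rewrite /dot/= => -[[/= ? ?] ?]; apply/T1P; split; lra.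
have mT2 : measurable (T2 : set (mR * mR)).
  rewrite (_ : T2 = [set x | dot (0, -1) x <= h 4%N] `&`
    [set x | dot (1, 0) x <= h 0%N] `&` [set x | dot (-1, 1) x < - h 5%N]).
    apply: measurableI; last by apply: open_measurable_plane; exact: open_dot_lt.
    by apply: measurableI; apply: closed_measurable_plane; exact: closed_dot_le.
  apply/seteqP; split=> z.
    by move=> /T2P[? ? ?]; split; [split|]; rewrite /= /dot/=; lra.
  by rewrite /dot/= => -[[/= ? ?] ?]; apply/T2P; split; lra.
split => //.
have BE : B = (hexagon h `|` T1) `|` T2.
  apply/seteqP; split=> z.
    move=> [/andP[? ?] /andP[? ?]].
    have [?|?] := ltP (h 2%N) (z.2 - z.1); first by left; right; apply/T1P.
    have [?|?] := ltP (h 5%N) (z.1 - z.2); first by right; apply/T2P.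
    by left; left; split; [split|..] => //; lra.
  move=> [[[[? ? ?] ? ? ?]|/T1P[? ? ?]]|/T2P[? ? ?]];
    by split; apply/andP; split; lra.
have := @leb2_box (- h 3%N) (h 0%N) (- h 4%N) (h 1%N) ltac:(lra) ltac:(lra).
rewrite -/B BE leb2U//; first last.
- apply/seteqP; split=> z // [[[[? ? ?] ? ? ?]|/T1P[? ? ?]] /T2P[? ? ?]]; lra.
- exact: measurableU.
rewrite leb2U//; last first.
  by apply/seteqP; split=> z // [[[? ? ?] ? ? ?] /T1P[? ? ?]]; lra.
rewrite T1E T2E !opprK.
case: (leb2 _) => [r|//|//]; rewrite -!EFinD => -[e]; congr EFin; lra.
Qed.

End hexagons.

(** * A convex body inside a circumscribed hexagon *)

Section mixed_area_bound.
Context {R : realType}.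
Implicit Types (K M S : set (plane R)) (u v w x y : plane R).
Local Notation mR := (measurableTypeR R).
Local Notation leb := (@lebesgue_measure R).
Local Notation leb2 := (leb \x leb)%E.

Definition segment_closed K := forall x y (t : R),
  K x -> K y -> 0 <= t -> t <= 1 -> K (t *: x + (1 - t) *: y).

Lemma convex_set_segment K : convex_set K -> segment_closed K.
Proof.
move=> cK x y t Kx Ky t0 t1.
have := cK x y (Itv01 t0 t1); rewrite !inE => /(_ Kx Ky).
exact.
Qed.

Lemma segment_closed_sum K M : segment_closed K -> segment_closed M ->
  segment_closed (minkowski_sum K M).
Proof.
move=> cK cM _ _ t [x Kx [x' Mx' <-]] [y Ky [y' My' <-]] t0 t1.
exists (t *: x + (1 - t) *: y); first exact: cK.
exists (t *: x' + (1 - t) *: y'); first exact: cM.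
by rewrite !scalerDr addrACA.
Qed.

Lemma segment_closed_opp K : segment_closed K -> segment_closed (reflect_set K).
Proof.
move=> cK _ _ t [x Kx <-] [y Ky <-] t0 t1.
by exists (t *: x + (1 - t) *: y); [exact: cK|rewrite opprD !scalerN].
Qed.

Lemma compact_opp K : compact K -> compact (reflect_set K).
Proof.
move=> cK; apply: continuous_compact => //; apply: continuous_subspaceT => x.
by apply: cvgN; exact: cvg_id.
Qed.

(** The normal at the point of K nearest to [x]. *)
Lemma separate_point K x : compact K -> segment_closed K -> K !=set0 -> ~ K x ->
  exists u, forall k, K k -> dot u k < dot u x.
Proof.
move=> cK sK K0 Kx.
pose f (k : plane R) : R^o := (k.1 - x.1) ^+ 2 + (k.2 - x.2) ^+ 2.
have cf : continuous f.
  move=> k; apply: cvgD; apply: cvgM; apply: cvgB; try exact: cvg_cst;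
    by [exact: cvg_fst|exact: cvg_snd].
have [|c cK' cmin] := compact_EVT_min (f := f) K0 cK.
  exact: continuous_subspaceT.
have {}cmin k : K k -> f c <= f k by move=> Kk; apply: cmin; rewrite inE.
rewrite inE in cK'.
have N0 : 0 < f c.
  rewrite lt_neqAle addr_ge0 ?sqr_ge0// andbT eq_sym; apply/negP.
  rewrite /f paddr_eq0 ?sqr_ge0// !sqrf_eq0 !subr_eq0 => /andP[/eqP e1 /eqP e2].
  by apply: Kx; rewrite -(@plane_eq _ c x).
exists (x - c) => k Kk.
suff kc : dot (x - c) (k - c) <= 0.
  have : dot (x - c) (x - c) = f c by rewrite /f /dot !planeE; ring.
  move: kc; rewrite !dotB; lra.
rewrite leNgt; apply/negP => a0.
set a := dot _ _ in a0; pose b := f c; pose N := (k.1 - c.1) ^+ 2 + (k.2 - c.2) ^+ 2.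
have N0' : 0 <= N by rewrite addr_ge0 ?sqr_ge0.
(* moving from c towards k by the ratio t changes the squared distance by
   -2 t a + t^2 N *)
pose t := a / (a + N).
have t0 : 0 < t by rewrite divr_gt0//; lra.
have t1 : t <= 1 by rewrite ler_pdivrMr; lra.
have tN : t * (a + N) = a by rewrite /t mulfVK// gt_eqF//; lra.
have := cmin _ (sK _ _ _ Kk cK' (ltW t0) t1).
have -> : f (t *: k + (1 - t) *: c) = f c - 2 * t * a + t ^+ 2 * N.
  by rewrite /f /a /N /dot !planeE; ring.
nra.
Qed.

(** Six directions in cyclic order; for [v], [w] unit vectors at 60 degrees
these are the normals of a regular hexagon. *)
Definition hexdir v w (i : nat) : plane R :=
  nth v [:: v; w; w - v; - v; - w; v - w] (i %% 6).

(** The normal of a line that separates x from K lies in one of the six cones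
spanned by consecutive directions. *)
Lemma hexagon_cover v w K (h : nat -> R) x : crs v w != 0 ->
  compact K -> segment_closed K -> K !=set0 -> h 6%N = h 0%N ->
  (forall i, (i < 6)%N -> dot (hexdir v w i) x <= h i) -> ~ K x ->
  exists2 i, (i < 6)%N &
    corner (hexdir v w i) (hexdir v w i.+1) (h i) (h i.+1) K x.
Proof.
move=> vw cK sK K0 h6 xh Kx.
have [u uK] := separate_point cK sK K0 Kx.
have xh' i : (i < 6)%N -> dot (hexdir v w i.+1) x <= h i.+1.
  move=> i6; have [->|i5] := eqVneq i 5%N; first by rewrite h6; exact: (xh 0%N).
  by apply: xh; rewrite ltn_neqAle i6 andbT; apply: contra_neq i5 => -[].
(* the direction u lies in one of the six cones *)
pose al := crs u w / crs v w; pose be := crs v u / crs v w.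
have uE y : dot u y = al * dot v y + be * dot w y.
  have -> : dot u y = ((crs u w) * dot v y + (crs v u) * dot w y) / crs v w.
    by rewrite /dot /crs; field; rewrite -/(crs v w).
  by rewrite /al /be; field.
suff [i i6 [a [b [a0 b0 ab]]]] : exists2 i, (i < 6)%N & exists a b, [/\ 0 <= a, 0 <= b &
    forall y, dot u y = a * dot (hexdir v w i) y + b * dot (hexdir v w i.+1) y].
  exists i => //; split; [exact: xh|exact: xh'|] => k Kk.
  have := uK _ Kk; rewrite !ab => abk.
  have [?|h1] := ltP (dot (hexdir v w i) k) (dot (hexdir v w i) x); first by left.
  have [?|h2] := ltP (dot (hexdir v w i.+1) k) (dot (hexdir v w i.+1) x); first by right.
  by exfalso; nra.
have [a0|a0] := leP 0 al; have [b0|b0] := leP 0 be.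
- by exists 0%N => //; exists al, be; split => // y; rewrite uE.
- have [ab|ab] := leP 0 (al + be).
    exists 5%N => //; exists (- be), (al + be); split => //; first lra.
    by move=> y; rewrite uE /hexdir/= dotBl; ring.
  exists 4%N => //; exists (- (al + be)), al; split => //; first lra.
  by move=> y; rewrite uE /hexdir/= dotBl dotNl; ring.
- have [ab|ab] := leP 0 (al + be).
    exists 1%N => //; exists (al + be), (- al); split => //; first lra.
    by move=> y; rewrite uE /hexdir/= dotBl; ring.
  exists 2%N => //; exists be, (- (al + be)); split => //; first lra.
  by move=> y; rewrite uE /hexdir/= dotBl dotNl; ring.
- exists 3%N => //; exists (- al), (- be); split; try lra.
  by move=> y; rewrite uE /hexdir/= !dotNl; ring.
Qed.

(** The contact point t of the side common to the two corners would have to lie on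
both sides of x along that side. *)
Lemma corner_disjoint1 v w (a b c : R) K t x : K t -> dot w t = b ->
  corner v w a b K x -> corner w (w - v) b c K x -> False.
Proof.
move=> Kt tb [_ xb h1] [_ _ h2].
by move: (h1 _ Kt) (h2 _ Kt); rewrite !dotBl tb => -[?|?] [?|?]; lra.
Qed.

Lemma corner_disjoint2 v w (a b c d : R) K t t' x :
  K t -> dot w t = b -> K t' -> dot (w - v) t' = c ->
  (forall k, K k -> dot w k <= b /\ dot (w - v) k <= c) ->
  corner v w a b K x -> corner (w - v) (- v) c d K x -> False.
Proof.
move=> Kt tb Kt' tc Kbc [_ xb h1] [xc _ h2].
have [_] := Kbc _ Kt; have [+ _] := Kbc _ Kt'; move: tc xc.
move: (h1 _ Kt) (h2 _ Kt').
by rewrite !dotBl !dotNl => -[?|?] [?|?]; lra.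
Qed.

(** A segment from the centre of symmetry to a contact point meets both
opposite corners' quadrants. *)
Lemma corner_disjoint3 v w (a b a' b' : R) S t t' x :
  segment_closed S -> (forall s, S s -> S (- s)) ->
  S t -> dot v t = a -> S t' -> dot w t' = b ->
  corner v w a b S x -> corner (- v) (- w) a' b' S x -> False.
Proof.
move=> sS oS St ta St' tb [xa xb h1] [xa' xb' h2].
have S0 : S 0.
  have := sS _ _ 2^-1 St (oS _ St) ltac:(lra) ltac:(lra).
  rewrite (_ : _ *: t + _ = 0)//; by apply: plane_eq; rewrite !planeE; field.
have d0 u : dot u (0 : plane R) = 0 by rewrite /dot/= !mulr0 addr0.
have Sl z (l : R) : S z -> 0 <= l -> l <= 1 -> S (l *: z).
  move=> Sz l0 l1; have := sS _ _ l Sz S0 l0 l1.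
  by rewrite scaler0 addr0.
have := h1 _ S0; have := h2 _ S0; rewrite !dotNl !d0 oppr0.
have [p0|p0] := ltP 0 (dot v x).
  have [q0|q0] := ltP (dot w x) 0; last by lra.
  move=> _ _; pose l := dot v x / a.
  have a0 : 0 < a by lra.
  have l0 : 0 <= l by rewrite divr_ge0//; lra.
  have l1 : l <= 1 by rewrite ler_pdivrMr//; lra.
  have lv : l * dot v t = dot v x by rewrite ta /l mulfVK// gt_eqF.
  have := h1 _ (Sl _ _ St l0 l1); have := h2 _ (Sl _ _ St l0 l1).
  by rewrite !dotNl !dotZ lv; lra.
have [q0|q0] := ltP 0 (dot w x); last by lra.
move=> [h|h] _; last by lra.
pose l := dot w x / b.
have b0 : 0 < b by lra.
have l0 : 0 <= l by rewrite divr_ge0//; lra.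
have l1 : l <= 1 by rewrite ler_pdivrMr//; lra.
have lw : l * dot w t' = dot w x by rewrite tb /l mulfVK// gt_eqF.
have := h1 _ (Sl _ _ St' l0 l1); have := h2 _ (Sl _ _ St' l0 l1).
by rewrite !dotNl !dotZ lw; lra.
Qed.

Lemma hexdirD v w k m : hexdir v w (k + m) = hexdir v w (k %% 6 + m).
Proof. by rewrite /hexdir modnDml. Qed.

Lemma hexdir_add2 v w k : hexdir v w k.+2 = hexdir v w k.+1 - hexdir v w k.
Proof.
have -> : hexdir v w k.+2 = hexdir v w (k %% 6 + 2) by rewrite -hexdirD addn2.
have -> : hexdir v w k.+1 = hexdir v w (k %% 6 + 1) by rewrite -hexdirD addn1.
have -> : hexdir v w k = hexdir v w (k %% 6 + 0) by rewrite -hexdirD addn0.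
have : (k %% 6 < 6)%N by rewrite ltn_mod.
case: (k %% 6)%N => [|[|[|[|[|[|//]]]]]] _; rewrite /hexdir/= ?opprK ?opprB//;
by apply: plane_eq; rewrite !planeE; ring.
Qed.

Lemma hexdir_add3 v w k : hexdir v w k.+3 = - hexdir v w k.
Proof. by rewrite hexdir_add2 hexdir_add2 addrAC subrr sub0r. Qed.

(** Two of the six corners are at cyclic distance 1, 2 or 3. *)
Lemma hexagon_corners_disjoint v w (t : nat -> plane R) S i j x :
  segment_closed S -> (forall s, S s -> S (- s)) ->
  (forall k, S (t k) /\
    forall s, S s -> dot (hexdir v w k) s <= dot (hexdir v w k) (t k)) ->
  (forall k, t (k + 6)%N = t k) ->
  let h k := dot (hexdir v w k) (t k) in
  let C k := corner (hexdir v w k) (hexdir v w k.+1) (h k) (h k.+1) S in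
  (i < j < 6)%N -> C i x -> C j x -> False.
Proof.
move=> sS oS tS t6 h C ij Ci Cj.
have St k : S (t k) by apply: (tS k).1.
have hS k s : S s -> dot (hexdir v w k) s <= h k by apply: (tS k).2.
have d1 k : C k x -> C k.+1 x -> False.
  by rewrite /C [hexdir _ _ k.+2]hexdir_add2; apply: corner_disjoint1 (St k.+1) _.
have d2 k : C k x -> C k.+2 x -> False.
  rewrite /C hexdir_add3 hexdir_add2.
  apply: (@corner_disjoint2 _ _ _ _ _ _ _ (t k.+1) (t k.+2)) => //.
    by rewrite -hexdir_add2.
  by move=> s Ss; rewrite -hexdir_add2; split; exact: hS.
have d3 k : C k x -> C k.+3 x -> False.
  rewrite /C !hexdir_add3.
  exact: (@corner_disjoint3 _ _ _ _ _ _ _ (t k) (t k.+1)).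
have C6 k : C (k + 6)%N = C k.
  have e m : hexdir v w (m + 6) = hexdir v w m by rewrite /hexdir modnDr.
  by rewrite /C /h -addSn !e !t6.
have [e|[e|[e|[e|e]]]] : j = i.+1 \/ (j = i.+2 \/ (j = i.+3 \/
    ((i + 6)%N = j.+2 \/ (i + 6)%N = j.+1))) by lia.
- by apply: (d1 i) => //; rewrite -e.
- by apply: (d2 i) => //; rewrite -e.
- by apply: (d3 i) => //; rewrite -e.
- by apply: (d2 j) => //; rewrite -e C6.
- by apply: (d1 j) => //; rewrite -e C6.
Qed.

End mixed_area_bound.

(** * Mixed area and circumscribed hexagons *)

Section mixed_area_le.
Context {R : realType}.
Implicit Types (K M S : set (plane R)) (u v w x y : plane R).
Local Notation mR := (measurableTypeR R).
Local Notation leb := (@lebesgue_measure R).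
Local Notation leb2 := (leb \x leb)%E.

Definition contacts v w K (t : nat -> plane R) := (forall k, t (k + 6)%N = t k) /\
  forall k, K (t k) /\
    forall s, K s -> dot (hexdir v w k) s <= dot (hexdir v w k) (t k).

Definition supp v w (t : nat -> plane R) k : R := dot (hexdir v w k) (t k).

Lemma hexdir_period v w k : hexdir v w (k + 6) = hexdir v w k.
Proof. by rewrite /hexdir modnDr. Qed.

Lemma contacts_sub v w K t k : contacts v w K t ->
  supp v w t k.+1 <= supp v w t k + supp v w t k.+2.
Proof.
move=> [_ tK].
have -> : supp v w t k.+1 = dot (hexdir v w k) (t k.+1) + dot (hexdir v w k.+2) (t k.+1).
  by rewrite -dotDl hexdir_add2 addrC subrK.
by apply: lerD; apply: (tK _).2; exact: (tK _).1.
Qed.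

Lemma contacts_opp v w K t k : contacts v w K t ->
  0 <= supp v w t k + supp v w t k.+3.
Proof.
move=> [_ tK]; have := (tK k.+3).2 _ (tK k).1.
by rewrite /supp hexdir_add3 !dotNl; lra.
Qed.

Definition hexagon_around v w (h : nat -> R) : set (plane R) :=
  [set x | forall k, (k < 6)%N -> dot (hexdir v w k) x <= h k].

Lemma leb2_hexagon_around v w K t : crs v w != 0 -> contacts v w K t ->
  let h := supp v w t in
  measurable (hexagon_around v w h : set (mR * mR)) /\
  leb2 (hexagon_around v w h) = (`|crs v w|^-1 *
   ((h 0%N + h 3%N) * (h 1%N + h 4%N)
    - (h 1%N + h 3%N - h 2%N) ^+ 2 / 2 - (h 0%N + h 4%N - h 5%N) ^+ 2 / 2))%:E.
Proof.
move=> vw tK h.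
have h6 k : h (k + 6)%N = h k by rewrite /h /supp hexdir_period tK.1.
have [||||||||| mH HE] := @leb2_hexagon _ h.
- by rewrite -(h6 0%N) -(h6 1%N) addrC; rewrite addrC; exact: (contacts_sub 5%N tK).
- exact: (contacts_sub 0%N tK).
- exact: (contacts_sub 2%N tK).
- exact: (contacts_sub 3%N tK).
- exact: (contacts_opp 2%N tK).
- exact: (contacts_sub 1%N tK).
- by rewrite -(h6 0%N) addrC; exact: (contacts_sub 4%N tK).
- exact: (contacts_opp 0%N tK).
- exact: (contacts_opp 1%N tK).
have -> : hexagon_around v w h = lin2 v.1 v.2 w.1 w.2 @^-1` hexagon h.
  have e x : (dot (hexdir v w 0) x = dot v x) * (dot (hexdir v w 1) x = dot w x) *
    (dot (hexdir v w 2) x = dot w x - dot v x) *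
    ((dot (hexdir v w 3) x = - dot v x) * (dot (hexdir v w 4) x = - dot w x) *
    (dot (hexdir v w 5) x = dot v x - dot w x)).
    by rewrite /hexdir/= !dotBl !dotNl.
  apply/seteqP; split=> x H.
    have := H 0%N isT; have := H 1%N isT; have := H 2%N isT.
    have := H 3%N isT; have := H 4%N isT; have := H 5%N isT.
    by rewrite !e => *; split; [split|..].
  move: H => [[? ? ?] ? ? ?].
  by case=> [|[|[|[|[|[|//]]]]]] _; rewrite e.
split; last by rewrite leb2_preimage_lin2// HE EFinM.
rewrite -[_ @^-1` _]setTI.
apply: (_ : measurable_fun setT (fun z : mR * mR => (v.1 * z.1 + v.2 * z.2 : mR, w.1 * z.1 + w.2 * z.2 : mR))) => //.
by apply: measurable_fun_pair; apply: measurable_funD; apply: measurable_funM.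
Qed.

Lemma contacts_difference v w K t : contacts v w K t ->
  contacts v w (minkowski_sum K (reflect_set K)) (fun k => t k - t k.+3).
Proof.
move=> [t6 tK]; split=> [k|k]; first by rewrite -addSn -addSn -addSn !t6.
split.
  by exists (t k); [exact: (tK k).1|exists (- t k.+3) => //; exists (t k.+3) => //; exact: (tK _).1].
move=> _ [x Kx [_ [y Ky <-] <-]]; rewrite dotB dotB lerB//; first exact: (tK k).2.
by have := (tK k.+3).2 _ Ky; rewrite hexdir_add3 !dotNl lerN2.
Qed.

Lemma corner_sub_hexagon v w S t k x : contacts v w S t -> (k < 6)%N ->
  corner (hexdir v w k) (hexdir v w k.+1) (supp v w t k) (supp v w t k.+1) S x ->
  hexagon_around v w (supp v w t) x.
Proof.
move=> [t6 tS] k6 [h1 h2 h3] j j6.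
have e m : supp v w t (m + 6) = supp v w t m by rewrite /supp hexdir_period t6.
suff H m : (m < 6)%N -> dot (hexdir v w (k + m)) x <= supp v w t (k + m).
  have [m m6 [<-|jm]] : exists2 m, (m < 6)%N & (k + m = j \/ k + m = j + 6)%N.
    by exists ((j + 6 - k) %% 6)%N; lia.
  - exact: H.
  - by have := H _ m6; rewrite jm e hexdir_period.
have hk : dot (hexdir v w k.+1) (t k) < dot (hexdir v w k.+1) x.
  by case: (h3 _ (tS k).1) => //; move: h1; rewrite /supp; lra.
have hk1 : dot (hexdir v w k) (t k.+1) < dot (hexdir v w k) x.
  by case: (h3 _ (tS k.+1).1) => //; move: h2; rewrite /supp; lra.
have := (tS k.+2).2 _ (tS k.+1).1; have := (tS k.+3).2 _ (tS k.+1).1.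
have := (tS k.+4).2 _ (tS k).1; have := (tS k.+4.+1).2 _ (tS k).1.
rewrite -/(supp v w t k.+4.+1) -/(supp v w t k.+4).
rewrite -/(supp v w t k.+2) -/(supp v w t k.+3) !hexdir_add3 hexdir_add2 !dotNl !dotBl.
have : dot (hexdir v w k) (t k) = supp v w t k by [].
have : dot (hexdir v w k.+1) (t k.+1) = supp v w t k.+1 by [].
move=> e1 e2 e3 e4 e5 e6.
case: m => [|[|[|[|[|[|//]]]]]] _; rewrite ?addnS ?addn0 ?hexdir_add3 ?hexdir_add2 ?dotNl ?dotBl; lra.
Qed.

(** The mixed area, in affine coordinates, of a hexagon and its reflection. *)
Definition hexform (h : nat -> R) : R :=
  (h 0%N + h 3%N) * (h 1%N + h 4%N) -
  (h 1%N + h 3%N - h 2%N) * (h 0%N + h 4%N - h 5%N).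

(** The corners of the difference body are at least as large as the two
opposite corners of K together, whereas K leaves six corners of its hexagon
uncovered: hence passing from K to its circumscribed hexagon does not decrease
area (K - K) - 2 area K, i.e. twice the mixed area of K and -K. *)
Lemma area_difference_le v w K t : crs v w != 0 ->
  compact K -> segment_closed K -> contacts v w K t ->
  `|crs v w| * (area (minkowski_sum K (reflect_set K)) - 2 * area K) <=
    2 * hexform (supp v w t).
Proof.
move=> vw cK sK tK; set h := supp v w t; set S := minkowski_sum _ _.
have cN := compact_opp cK.
have cS : compact S by exact: compact_minkowski_sum.
have sS : segment_closed S.
  by apply: segment_closed_sum => //; exact: segment_closed_opp.
have oS s : S s -> S (- s).
  move=> [x Kx [_ [y Ky <-] <-]]; exists y => //; exists (- x); first by exists x.
  by rewrite opprB addrC.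
have tS := contacts_difference tK; rewrite -/S in tS.
have h6 k : h (k + 6)%N = h k by rewrite /h /supp hexdir_period tK.1.
pose H := supp v w (fun k => t k - t k.+3).
have HE k : H k = h k + h k.+3.
  by rewrite /H /h /supp hexdir_add3 dotB dotNl.
have [mXK XKE] := leb2_hexagon_around vw tK.
have [mXS XSE] := leb2_hexagon_around vw tS.
pose D k := corner (hexdir v w k) (hexdir v w k.+1) (h k) (h k.+1) K.
pose E k := corner (hexdir v w k) (hexdir v w k.+1) (H k) (H k.+1) S.
have mD k : measurable (D k : set (mR * mR)) by exact: measurable_corner.
have mE k : measurable (E k : set (mR * mR)) by exact: measurable_corner.
have mK : measurable (K : set (mR * mR)) by exact: compact_measurable_plane.
have mS : measurable (S : set (mR * mR)) by exact: compact_measurable_plane.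
have crsE k : crs (hexdir v w k) (hexdir v w k.+1) = crs v w.
  have -> : hexdir v w k.+1 = hexdir v w (k %% 6 + 1) by rewrite -hexdirD addn1.
  have -> : hexdir v w k = hexdir v w (k %% 6 + 0) by rewrite -hexdirD addn0.
  have : (k %% 6 < 6)%N by rewrite ltn_mod.
  case: (k %% 6)%N => [|[|[|[|[|[|//]]]]]] _; rewrite /hexdir/= /crs ?planeE; ring.
have DE k : (leb2 (D k) + leb2 (D (k + 3)%N) <= leb2 (E k))%E.
  rewrite /D !addn3.
  have -> : leb2 (corner (hexdir v w k.+3) (hexdir v w k.+4) (h k.+3) (h k.+4) K) =
      leb2 (corner (hexdir v w k) (hexdir v w k.+1) (h k.+3) (h k.+4) (reflect_set K)).
    by rewrite (leb2_corner_opp (hexdir v w k) (hexdir v w k.+1) _ _ cK) -!hexdir_add3.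
  rewrite /E !HE; apply: leb2_corner_sum => //.
  - by rewrite crsE.
  - by move=> x Kx; split; apply: (tK.2 _).2.
  - move=> _ [x Kx <-]; rewrite !dotN -!dotNl -!hexdir_add3.
    by split; apply: (tK.2 _).2.
  - by exists (t k) => //; exact: (tK.2 _).1.
  - exists (- t k.+3); last by rewrite dotN -dotNl -hexdir_add3.
    by exists (t k.+3) => //; exact: (tK.2 _).1.
(* K - K and its corners are disjoint parts of the hexagon around K - K *)
have GS : (\sum_(k < 6) leb2 (E k) + leb2 S <=
    leb2 (hexagon_around v w H))%E.
  pose G (k : nat) : set (mR * mR) := if (k < 6)%N then E k else S.
  have mG k : measurable (G k) by rewrite /G; case: ifP.
  have tG : trivIset [set: 'I_7] (G : 'I_7 -> set (mR * mR)).
    have ne i j x : (i < j)%N -> (j < 7)%N -> G i x -> G j x -> False.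
      rewrite /G => ij j7; have -> : (i < 6)%N by lia.
      case: ifP => [j6|j6].
        by apply: (hexagon_corners_disjoint sS oS tS.2 tS.1); rewrite ij.
      by move=> [_ _ h1] /h1; rewrite !ltxx => -[].
    apply/trivIsetP => i j _ _ ij; apply/seteqP; split=> x // [Gi Gj].
    have [h1|h1|h1] := ltngtP i j.
    - exact: (ne i j x).
    - exact: (ne j i x).
    - by move/eqP: ij; apply; apply: val_inj.
  have /= GE := measure_bigsetU_ord leb2 xpredT (fun i : 'I_7 => mG i) tG.
  rewrite [X in (X <= _)%E](_ : _ = \sum_(i < 7) leb2 (G i)); last first.
    by rewrite [RHS]big_ord_recr/=; congr (_ + _)%E; apply: eq_bigr => -[i i6] _ /=; rewrite /G/= i6.
  rewrite -GE; apply: le_measure; rewrite ?inE//.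
    by apply: bigsetU_measurable.
  move=> x; rewrite -(bigcup_mkord 7 G) => -[i /= i7]; rewrite /G; case: ifP => [i6|_].
    exact: corner_sub_hexagon.
  by move=> Sx k _; exact: (tS.2 _).2.
(* the hexagon around K is covered by K and its corners *)
have XK : (leb2 (hexagon_around v w h) <= \sum_(k < 6) leb2 (D k) + leb2 K)%E.
  pose G (k : nat) : set (mR * mR) := if (k < 6)%N then D k else K.
  have mG k : measurable (G k) by rewrite /G; case: ifP.
  rewrite [X in (_ <= X)%E](_ : _ = \sum_(i < 7) leb2 (G i)); last first.
    by rewrite [RHS]big_ord_recr/=; congr (_ + _)%E; apply: eq_bigr => -[i i6] _ /=; rewrite /G/= i6.
  apply: content_subadditive => // x Xx.
  rewrite -(bigcup_mkord 7 G); have [Kx|Kx] := pselect (K x); first by exists 6%N.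
  have [||i i6 Dx] := hexagon_cover vw cK sK _ _ Xx Kx.
  - by exists (t 0%N); exact: (tK.2 _).1.
  - exact: (h6 0%N).
  - by exists i => /=; [exact: ltnW|rewrite /G i6].
have XSfin : leb2 (hexagon_around v w H) \is a fin_num by rewrite XSE.
have XKfin : leb2 (hexagon_around v w h) \is a fin_num by rewrite XKE.
have Sfin : leb2 S \is a fin_num.
  rewrite ge0_fin_numE//; apply: le_lt_trans (ltry (fine (leb2 (hexagon_around v w H)))).
  by rewrite (fineK XSfin); apply: le_trans GS; rewrite leeDr// sume_ge0.
have Kfin : leb2 K \is a fin_num.
  rewrite ge0_fin_numE//; apply: le_lt_trans (ltry (fine (leb2 (hexagon_around v w h)))).
  rewrite (fineK XKfin); apply: le_measure; rewrite ?inE// => x Kx k _.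
  exact: (tK.2 _).2.
have Efin k : (k < 6)%N -> leb2 (E k) \is a fin_num.
  move=> k6; rewrite ge0_fin_numE//; apply: le_lt_trans (ltry (fine (leb2 (hexagon_around v w H)))).
  rewrite (fineK XSfin); apply: le_measure; rewrite ?inE// => x.
  exact: corner_sub_hexagon.
have Dfin k : (k < 6)%N -> leb2 (D k) \is a fin_num.
  move=> k6; have := Efin _ k6; rewrite (ge0_fin_numE (measure_ge0 _ _)) => Ek.
  rewrite (ge0_fin_numE (measure_ge0 _ _)); apply: le_lt_trans Ek.
  by apply: le_trans (DE k); rewrite leeDl// measure_ge0.
have D6 k : D (k + 6)%N = D k.
  by rewrite /D -addSn !hexdir_period !h6.
pose e k := fine (leb2 (E k)); pose d k := fine (leb2 (D k)).
have eE k : (k < 6)%N -> leb2 (E k) = (e k)%:E by move=> /Efin/fineK.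
have dE k : (k < 6)%N -> leb2 (D k) = (d k)%:E by move=> /Dfin/fineK.
have {}XK : fine (leb2 (hexagon_around v w h)) <= \sum_(k < 6) d k + area K.
  rewrite -lee_fin (fineK XKfin) EFinD -sumEFin (fineK Kfin).
  by rewrite (eq_bigr (fun k : 'I_6 => leb2 (D k)))// => -[k k6] _; rewrite dE.
have {}GS : \sum_(k < 6) e k + area S <= fine (leb2 (hexagon_around v w H)).
  rewrite -lee_fin (fineK XSfin) EFinD -sumEFin (fineK Sfin).
  by rewrite (eq_bigr (fun k : 'I_6 => leb2 (E k)))// => -[k k6] _; rewrite eE.
have {}DE k j : (k < 6)%N -> (j < 6)%N -> D (k + 3)%N = D j -> d k + d j <= e k.
  by move=> k6 j6 kj; move: (DE k); rewrite kj (dE k k6) (dE j j6) (eE k k6) -EFinD lee_fin.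
have d0 := DE 0%N 3%N isT isT erefl; have d1 := DE 1%N 4%N isT isT erefl.
have d2 := DE 2%N 5%N isT isT erefl; have d3 := DE 3%N 0%N isT isT (D6 0%N).
have d4 := DE 4%N 1%N isT isT (D6 1%N); have d5 := DE 5%N 2%N isT isT (D6 2%N).
have c0 : 0 < `|crs v w| by rewrite normr_gt0.
have {}XKE : `|crs v w| * fine (leb2 (hexagon_around v w h)) = (h 0%N + h 3%N) * (h 1%N + h 4%N)
    - (h 1%N + h 3%N - h 2%N) ^+ 2 / 2 - (h 0%N + h 4%N - h 5%N) ^+ 2 / 2.
  by rewrite XKE/= mulVKf// gt_eqF.
have {}XSE : `|crs v w| * fine (leb2 (hexagon_around v w H)) = (H 0%N + H 3%N) * (H 1%N + H 4%N)
    - (H 1%N + H 3%N - H 2%N) ^+ 2 / 2 - (H 0%N + H 4%N - H 5%N) ^+ 2 / 2.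
  by rewrite XSE/= mulVKf// gt_eqF.
move: GS XK; rewrite !big_ord_recr !big_ord0/= => GS XK.
have le : area S - 2 * area K <= fine (leb2 (hexagon_around v w H)) -
    2 * fine (leb2 (hexagon_around v w h)).
  move: (fine _) (fine _) (area S) (area K) (d _) (d _) (d _) (d _) (d _) (d _)
    (e _) (e _) (e _) (e _) (e _) (e _) d0 d1 d2 d3 d4 d5 GS XK => *; lra.
apply: le_trans (ler_wpM2l (ltW c0) le) _.
rewrite mulrBr XSE mulrCA XKE !HE (h6 0%N) (h6 1%N) (h6 2%N) /hexform -subr_ge0.
by rewrite le_eqVlt; apply/orP; left; apply/eqP; field.
Qed.

(** The expansion at alpha = beta = 1 determines the mixed area. *)
Lemma mixed_area_le v w K t : crs v w != 0 ->
  compact K -> segment_closed K -> contacts v w K t ->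
  `|crs v w| * mixed_area K (reflect_set K) <= hexform (supp v w t).
Proof.
move=> vw cK sK tK; rewrite /mixed_area; set P := (X in xget _ X).
have [ex|ne] := pselect (exists m, P m); last first.
  case: xgetP => [m _ Pm|_]; first by exfalso; apply: ne; exists m.
  (* the default value 0: the second product of hexform has the smaller factors *)
  rewrite mulr0; have c k := contacts_sub k tK; have o k := contacts_opp k tK.
  have e k : supp v w t (k + 6) = supp v w t k by rewrite /supp hexdir_period tK.1.
  have := c 0%N; have := c 1%N; have := c 2%N; have := c 4%N; have := c 5%N.
  have := c 3%N; have := e 0%N; have := e 1%N; have := o 0%N; have := o 1%N.
  rewrite /hexform /= => o1 o0 e1 e0 *; rewrite subr_ge0 ler_pM//; lra.
have := xgetPex 0 ex => /(_ 1 1 ler01 ler01).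
have d1 M : dilate 1 M = M.
  apply/seteqP; split=> [_ [x Mx <-]|x Mx]; first by rewrite scale1r.
  by exists x => //; rewrite scale1r.
rewrite !d1 !expr1n !mul1r mulr1.
have -> : area (reflect_set K) = area K.
  have mK : measurable (K : set (mR * mR)) by exact: compact_measurable_plane.
  rewrite /area; congr fine.
  have -> : reflect_set K = lin2 (-1) 0 0 (-1) @^-1` K.
    have e x : lin2 (-1) 0 0 (-1) x = - x :> plane R.
      by apply: plane_eq; rewrite !planeE /lin2/=; ring.
    apply/seteqP; split=> [_ [x Kx <-]|x]; rewrite /preimage/mkset e ?opprK// => Kx.
    by exists (- x) => //; rewrite opprK.
  rewrite leb2_preimage_lin2//.
  by rewrite mulr0 subr0 mulrNN mulr1 normr1 invr1 mul1e.
move=> m1; have := area_difference_le vw cK sK tK.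
rewrite {}m1; set m := xget _ _; set c := `|_|; move: (area K) => a; nra.
Qed.

End mixed_area_le.

(** * Polygons of contact points and the perimeter *)

Section perimeter.
Context {R : realType}.
Implicit Types (K : set (plane R)) (u v w p q x y z : plane R) (s t : seq (plane R)).

Fixpoint walk x s : R := if s is y :: s' then dist x y + walk y s' else 0.

Definition closed_length s : R := if s is x :: s' then walk x (rcons s' x) else 0.

Lemma dist_refl x : dist x x = 0.
Proof. by rewrite /dist !subrr expr0n/= addr0 sqrtr0. Qed.

Lemma walk_rcons x s y : walk x (rcons s y) = walk x s + dist (last x s) y.
Proof. by elim: s x => [|z s IH] x /=; [rewrite addrC|rewrite IH addrA]. Qed.

Lemma closed_length_rot1 s : closed_length (rot 1 s) = closed_length s.
Proof.
case: s => [|x [|y s]]//; rewrite rot1_cons /=.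
by rewrite !walk_rcons !last_rcons; ring.
Qed.

Lemma closed_length_rot n s : closed_length (rot n s) = closed_length s.
Proof.
elim: n => [|n IH]; first by rewrite rot0.
have [ns|ns] := ltnP n (size s); first by rewrite rotS// closed_length_rot1.
by rewrite rot_oversize// leqW.
Qed.

Lemma closed_lengthE s : closed_length s =
  \sum_(i < size s) dist (nth 0 s i) (nth 0 s (i.+1 %% size s)).
Proof.
case: s => [|x s]; first by rewrite big_ord0.
have walkE t y : walk y t = \sum_(i < size t) dist (nth 0 (y :: t) i) (nth 0 t i).
  elim: t y => [|z t IH] y /=; first by rewrite big_ord0.
  by rewrite big_ord_recl/= IH.
rewrite /closed_length walkE size_rcons; apply: eq_bigr => -[i /= il] _.
congr dist.
  by case: i il => [|i]//= il; rewrite nth_rcons -ltnS il.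
rewrite nth_rcons; have [is_|is_] := ltnP i (size s).
  by rewrite modn_small.
have -> : i = size s by lia.
by rewrite eqxx modnn.
Qed.

(** Repetitions are allowed, because different normals may have the same point of
contact. *)
Definition convex_position s := forall i j k, (i < j)%N -> (j < k)%N ->
  (k < size s)%N -> let x := nth 0 s i in let y := nth 0 s j in
  let z := nth 0 s k in x != y -> y != z -> z != x -> 0 < orient x y z.

Lemma orient_rot x y z : orient y z x = orient x y z.
Proof. by rewrite /orient; ring. Qed.

Lemma orient_swap x y z : orient y x z = - orient x y z.
Proof. by rewrite /orient; ring. Qed.

Lemma orient_swapr x y z : orient x z y = - orient x y z.
Proof. by rewrite /orient; ring. Qed.

Lemma convex_position_rot1 s : convex_position s -> convex_position (rot 1 s).
Proof.
case: s => [|x s]//; rewrite rot1_cons => H i j k ij jk; rewrite size_rcons ltnS => ks.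
have is_ : (i < size s)%N by lia.
have js : (j < size s)%N by lia.
rewrite !nth_rcons is_ js /=; case: ltnP => ks'.
  exact: (H i.+1 j.+1 k.+1).
have -> : k = size s by lia.
by rewrite eqxx => h1 h2 h3; rewrite orient_rot; apply: (H 0%N i.+1 j.+1).
Qed.

Lemma convex_position_rot n s : convex_position s -> convex_position (rot n s).
Proof.
move=> H; elim: n => [|n IH]; first by rewrite rot0.
have [ns|ns] := ltnP n (size s); first by rewrite rotS//; exact: convex_position_rot1.
by rewrite rot_oversize// leqW.
Qed.

Lemma convex_position_behead x s : convex_position (x :: s) -> convex_position s.
Proof. by move=> H i j k ij jk ks; exact: (H i.+1 j.+1 k.+1). Qed.

(** If a point is repeated, then one of the two arcs between its occurrences is
constant: otherwise it would be met both before and after some pair of other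
points. Hence some two cyclically consecutive points are equal. *)
Lemma repeated_neighbours s : convex_position s -> ~~ uniq s ->
  (exists x y z, [/\ x \in s, y \in s, z \in s & [/\ x != y, y != z & z != x]]) ->
  exists n x t, rot n s = x :: x :: t.
Proof.
move=> cs us [x0 [y0 [z0 [xs ys zs [xy yz zx]]]]].
have sep i k j l : (i < k < j)%N -> (j < size s)%N -> (l < size s)%N ->
    nth 0 s i = nth 0 s j -> (l < i)%N || (j < l)%N ->
    nth 0 s k != nth 0 s i -> nth 0 s l != nth 0 s i -> nth 0 s l != nth 0 s k -> False.
  move=> /andP[ik kj] js ls ij lij ki li' lk.
  have ki' := ki; rewrite eq_sym in ki'; have li'' := li'; rewrite eq_sym in li''.
  have lk' := lk; rewrite eq_sym in lk'.
  case/orP: lij => [li|jl].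
    have /= := cs l i k li ik (ltn_trans kj js) li' ki' lk'.
    have /= := cs l k j (ltn_trans li ik) kj js; rewrite -ij => /(_ lk ki li'').
    by rewrite orient_swapr; lra.
  have /= := cs i k l ik (ltn_trans kj jl) ls ki' lk' li'.
  have /= := cs k j l kj jl ls; rewrite -ij => /(_ ki li'' lk).
  by rewrite orient_swap; lra.
(* a repetition with no third occurrence in between *)
have [d [i [id ij ne]]] : exists d i, [/\ (i + d.+1 < size s)%N,
    nth 0 s i = nth 0 s (i + d.+1) &
    forall k, (i < k < i + d.+1)%N -> nth 0 s k != nth 0 s i].
  have ex : exists d, [exists i : 'I_(size s), (i + d.+1 < size s)%N &&
      (nth 0 s i == nth 0 s (i + d.+1))].
    have /(uniqPn 0)[i [j [ij js e]]] := us.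
    exists (j - i).-1; apply/existsP; exists (Ordinal (ltn_trans ij js)) => /=.
    have -> : (i + (j - i).-1.+1 = j)%N by lia.
    by rewrite js e eqxx.
  have [d /existsP[i /andP[id /eqP e]] dmin] := ex_minnP ex.
  exists d, i; split => // k /andP[ik kd]; apply/negP => /eqP ek.
  have := dmin (k - i).-1; have -> : [exists i0 : 'I_(size s),
      (i0 + (k - i).-1.+1 < size s)%N && (nth 0 s i0 == nth 0 s (i0 + (k - i).-1.+1))].
    apply/existsP; exists i; have -> : (i + (k - i).-1.+1 = k)%N by lia.
    by rewrite ek eqxx andbT; lia.
  by move=> /(_ isT); lia.
set j := (i + d.+1)%N in id ij ne.
(* rotating to a pair of equal cyclic neighbours *)
have adj k : (k < size s)%N -> nth 0 s k = nth 0 s (k.+1 %% size s) -> (1 < size s)%N ->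
    exists n x t, rot n s = x :: x :: t.
  move=> ks e s1; exists k.
  have sr : size (rot k s) = size s by rewrite size_rot.
  have n0 : nth 0 (rot k s) 0 = nth 0 s k.
    by rewrite nth_cat size_drop subn_gt0 ks nth_drop addn0.
  have n1 : nth 0 (rot k s) 1 = nth 0 s (k.+1 %% size s).
    rewrite nth_cat size_drop; case: ifP => h.
      have kS : (k.+1 < size s)%N by move: h; rewrite ltn_subRL addn1.
      by rewrite nth_drop addn1 modn_small.
    move: h; rewrite ltn_subRL addn1 => /negbT; rewrite -leqNgt => h.
    have kE : k.+1 = size s by apply/eqP; rewrite eqn_leq ks.
    by rewrite kE modnn -kE subSnn subnn nth_take// -ltnS kE.
  case: (rot k s) sr n0 n1 => [|a [|b t]]/= sr n0 n1; try lia.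
  by exists a, t; rewrite n1 -e -n0.
have s1 : (1 < size s)%N by lia.
have [d0|d0] := posnP d.
  apply: (adj i) => //; first lia.
  by rewrite modn_small; [rewrite ij /j d0 addn1|lia].
(* everything outside the arc from i to j is equal to the repeated point *)
have out l : (l < size s)%N -> (l < i)%N || (j < l)%N -> nth 0 s l = nth 0 s i.
  move=> ls lij; apply/eqP/negPn/negP => li.
  have kb k : (i < k < j)%N -> nth 0 s l = nth 0 s k.
    move=> ikj; apply/eqP/negPn/negP => lk.
    exact: (sep i k j l) ikj id ls ij lij (ne _ ikj) li lk.
  have i1 : (i < i.+1 < j)%N by rewrite /j; lia.
  have two m : (m < size s)%N -> nth 0 s m = nth 0 s i \/ nth 0 s m = nth 0 s i.+1.
    move=> ms; have [ikm|] := boolP (i < m < j)%N.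
      by right; rewrite -(kb m)// -(kb i.+1).
    rewrite negb_and -!leqNgt => /orP[mi|jm].
      have [->|mi'] := eqVneq m i; first by left.
      have [->|mi''] := eqVneq (nth 0 s m) (nth 0 s i); first by left.
      right; apply/eqP/negPn/negP => mk.
      apply: (sep i i.+1 j m) => //; first by rewrite ltn_neqAle mi' mi.
      exact: ne.
    have [->|mj'] := eqVneq m j; first by left.
    have [->|mi''] := eqVneq (nth 0 s m) (nth 0 s i); first by left.
    right; apply/eqP/negPn/negP => mk.
    apply: (sep i i.+1 j m) => //; first by rewrite [(j < m)%N]ltn_neqAle eq_sym mj' jm orbT.
    exact: ne.
  have mem x : x \in s -> x = nth 0 s i \/ x = nth 0 s i.+1.
    by move=> /(nthP 0)[m ms <-]; exact: two.
  move: xy yz zx; case: (mem _ xs) => ->; case: (mem _ ys) => ->; case: (mem _ zs) => ->;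
    by rewrite ?eqxx.
have [js|js] := ltnP j.+1 (size s).
  by apply: (adj j) => //; rewrite modn_small// -ij out// ltnSn orbT.
have jE : j.+1 = size s by apply/eqP; rewrite eqn_leq js id.
apply: (adj j) => //; rewrite jE modnn -ij.
by have [->//|i0] := posnP i; rewrite out ?i0//; lia.
Qed.

(** Deleting one of two equal neighbours changes neither the length nor the convex
position. *)
Lemma convex_position_undup s : convex_position s ->
  (exists x y z, [/\ x \in s, y \in s, z \in s & [/\ x != y, y != z & z != x]]) ->
  exists s', [/\ {subset s' <= s}, uniq s', convex_position s' &
    closed_length s' = closed_length s].
Proof.
have [n] := ubnP (size s); elim: n s => // n IH s sn cs d3.
have [us|us] := boolP (uniq s); first by exists s; split.
have [m [x [t st]]] := repeated_neighbours cs us d3.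
have ms : rot m s =i s by exact: mem_rot.
have [||| s' [s's us' cs' ls']] := IH (x :: t); last first.
- exists s'; split => //.
    by move=> y /s's; rewrite -ms st !inE => ->; rewrite orbT.
  by rewrite ls' -(closed_length_rot m s) st /= dist_refl add0r.
- have [a [b [c [as_ bs cs_ ne]]]] := d3; exists a, b, c; move: as_ bs cs_.
  by rewrite -!ms st !inE !orbA !orbb.
- by apply: (@convex_position_behead x); rewrite -st; exact: convex_position_rot.
- by have := size_rot m s; rewrite st /=; lia.
Qed.

(** [p] is the last point, counterclockwise, of the face of K of normal [v]:
an extreme point of K. *)
Definition extreme_contact K v p := K p /\ forall k, K k ->
  dot v k < dot v p \/ (dot v k = dot v p /\ crs v k <= crs v p).

Lemma extreme_contact_le K v p k : extreme_contact K v p -> K k -> dot v k <= dot v p.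
Proof. by move=> [_ H] /H[/ltW//|[-> _]]. Qed.

Lemma crsE v k : crs v k = dot (- v.2, v.1) k.
Proof. by rewrite /crs /dot/=; ring. Qed.

Lemma extreme_contact_exists K v : compact K -> K !=set0 ->
  exists p, extreme_contact K v p.
Proof.
move=> cK K0; have [q Kq qmax] := compact_dot_max v cK K0.
have cF : compact (K `&` [set k | dot (- v) k <= dot (- v) q]).
  by apply: compact_closedI => //; exact: closed_dot_le.
have [|p [Kp /= pq] pmax] := compact_dot_max (- v.2, v.1) cF; first by exists q; split=> /=.
have pqE : dot v p = dot v q.
  by have := qmax _ Kp; move: pq; rewrite !dotNl; lra.
exists p; split => // k Kk; have := qmax _ Kk; rewrite -pqE le_eqVlt => /orP[/eqP e|]; last by left.
right; split => //; rewrite !crsE; apply: pmax; split => //=.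
by rewrite !dotNl e pqE.
Qed.

(** Since p is maximal in the lexicographic order of (dot v, crs v), it is an
extreme point of K. *)
Lemma extreme_contact_between K v p x y (l : R) : (v.1 != 0) || (v.2 != 0) ->
  extreme_contact K v p -> K x -> K y -> 0 < l -> l < 1 ->
  p = l *: x + (1 - l) *: y -> x = y.
Proof.
move=> v0 [Kp H] Kx Ky l0 l1 pE.
have pd u : dot u p = l * dot u x + (1 - l) * dot u y by rewrite pE dotD !dotZ.
have e1 : dot v x = dot v p /\ dot v y = dot v p.
  have := pd v; case: (H _ Kx) => [hx|[hx _]]; case: (H _ Ky) => [hy|[hy _]] e; split; nra.
have e2 : crs v x = crs v y.
  have := pd (- v.2, v.1); rewrite -!crsE.
  have [ex ey] := e1; case: (H _ Kx) => [|[_ hx]]; first by rewrite ex ltxx.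
  by case: (H _ Ky) => [|[_ hy]]; [rewrite ey ltxx|nra].
have {}e1 : dot v x = dot v y by case: e1 => -> ->.
have N0 : v.1 ^+ 2 + v.2 ^+ 2 != 0.
  by rewrite paddr_eq0 ?sqr_ge0// !sqrf_eq0 negb_and.
apply: plane_eq; apply: (mulfI N0); move: e1 e2; rewrite /dot /crs => e1 e2.
  have -> : (v.1 ^+ 2 + v.2 ^+ 2) * x.1 =
    v.1 * (v.1 * x.1 + v.2 * x.2) - v.2 * (v.1 * x.2 - v.2 * x.1) by ring.
  by rewrite e1 e2; ring.
have -> : (v.1 ^+ 2 + v.2 ^+ 2) * x.2 =
  v.2 * (v.1 * x.1 + v.2 * x.2) + v.1 * (v.1 * x.2 - v.2 * x.1) by ring.
by rewrite e1 e2; ring.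
Qed.

(** The normals [u], [v], [w] are in counterclockwise cyclic order; at most one
of the three angles between them reaches 180 degrees. *)
Definition ccw_normals u v w :=
  [\/ 0 < crs u v /\ 0 < crs v w, 0 < crs v w /\ 0 < crs w u |
      0 < crs w u /\ 0 < crs u v].

Lemma normal_edges (a b p q r : plane R) : 0 < crs a b -> orient p q r < 0 ->
  dot a q <= dot a p -> dot a r <= dot a p -> dot b p <= dot b q ->
  dot b r <= dot b q -> 0 < dot a (r - q) /\ dot b (p - r) < 0.
Proof.
move=> ab o h1 h2 h3 h4; have D : 0 < crs a b * - orient p q r by rewrite mulr_gt0// oppr_gt0.
have E1 : dot a (r - q) * dot b (q - p) - dot a (q - p) * dot b (r - q) =
    crs a b * - orient p q r by rewrite /orient /crs /dot !planeE; ring.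
have E2 : dot a (q - p) * dot b (p - r) - dot a (p - r) * dot b (q - p) =
    crs a b * - orient p q r by rewrite /orient /crs /dot !planeE; ring.
move: E1 E2; rewrite !dotB => E1 E2; split; nra.
Qed.

(** In a clockwise triangle x y z, the normal cones at x, y, z are met clockwise
too; the sign of <v, x - z> detects this. *)
Lemma orient_ge0_normals u v w x y z : 0 < crs u v -> 0 < crs v w ->
  dot u y <= dot u x -> dot u z <= dot u x -> dot v x <= dot v y ->
  dot v z <= dot v y -> dot w x <= dot w z -> dot w y <= dot w z ->
  0 <= orient x y z.
Proof.
move=> uv vw uy uz vx vz wx wy; rewrite leNgt; apply/negP => o.
have [_] := normal_edges uv o uy uz vx vz.
have [] := @normal_edges _ _ y z x vw _ vz vx wy wx; first by rewrite orient_rot.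
lra.
Qed.

Definition nonzero v := (v.1 != 0) || (v.2 != 0).

Lemma crs_nonzero u v : 0 < crs u v -> nonzero u /\ nonzero v.
Proof.
rewrite /crs /nonzero; split; rewrite -negb_and; apply/negP => /andP[/eqP e1 /eqP e2];
  by move: H; rewrite e1 e2; lra.
Qed.

Lemma collinear_between x y z : x != y -> y != z -> z != x -> orient x y z = 0 ->
  exists2 l : R, 0 < l < 1 & [\/ x = l *: y + (1 - l) *: z,
    y = l *: z + (1 - l) *: x | z = l *: x + (1 - l) *: y].
Proof.
move=> xy yz zx o.
have [m zE] : exists m : R, z = x + m *: (y - x).
  have [e|e] := eqVneq (y.1 - x.1) 0.
    have e2 : y.2 - x.2 != 0.
      by apply: contra xy => /eqP e2; apply/eqP/plane_eq; lra.
    exists ((z.2 - x.2) / (y.2 - x.2)); apply: plane_eq; rewrite !planeE.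
      move: o; rewrite /orient e mul0r sub0r => /eqP; rewrite oppr_eq0 mulf_eq0 (negbTE e2)/=.
      by rewrite mulr0 => /eqP; lra.
    by field.
  exists ((z.1 - x.1) / (y.1 - x.1)); apply: plane_eq; rewrite !planeE.
    by field.
  apply: (mulfI e); move: o; rewrite /orient => o.
  by rewrite mulrDr mulrA mulrCA divff//; lra.
have [m0|m0|m0] := ltgtP m 0.
- exists (- m / (1 - m)); first by rewrite divr_gt0/= ?ltr_pdivrMr; lra.
  by apply: Or31; rewrite zE; apply: plane_eq; rewrite !planeE; field; lra.
- have [m1|m1|m1] := ltgtP m 1.
  + exists (1 - m); first lra.
    by apply: Or33; rewrite zE; apply: plane_eq; rewrite !planeE; field.
  + exists (m^-1); first by rewrite invr_gt0 invf_lt1; lra.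
    by apply: Or32; rewrite zE; apply: plane_eq; rewrite !planeE; field; lra.
  + by move: yz; rewrite zE m1 scale1r addrC subrK eqxx.
- by move: zx; rewrite zE m0 scale0r addr0 eqxx.
Qed.

(** The order of the normals gives a weakly counterclockwise triangle; it is not
flat, because an extreme point is not between two others. *)
Lemma orient_gt0_contacts K u v w x y z : ccw_normals u v w ->
  extreme_contact K u x -> extreme_contact K v y -> extreme_contact K w z ->
  x != y -> y != z -> z != x -> 0 < orient x y z.
Proof.
move=> uvw cx cy cz xy yz zx.
have ux := extreme_contact_le cx; have vy := extreme_contact_le cy.
have wz := extreme_contact_le cz.
have [[Kx _] [Ky _] [Kz _]] := And3 cx cy cz.
have [u0 v0 w0] : [/\ nonzero u, nonzero v & nonzero w].
  by case: uvw => -[/crs_nonzero[? ?] /crs_nonzero[? ?]].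
have o : 0 <= orient x y z.
  case: uvw => -[h1 h2].
  - by apply: (orient_ge0_normals h1 h2); auto.
  - by rewrite -orient_rot; apply: (orient_ge0_normals h1 h2); auto.
  - by rewrite orient_rot; apply: (orient_ge0_normals h1 h2); auto.
rewrite lt_neqAle o andbT eq_sym; apply/eqP => o0.
have [l /andP[l0 l1] []] := collinear_between xy yz zx o0.
- move=> /(extreme_contact_between u0 cx Ky Kz l0 l1) e.
  by rewrite e eqxx in yz.
- move=> /(extreme_contact_between v0 cy Kz Kx l0 l1) e.
  by rewrite e eqxx in zx.
- move=> /(extreme_contact_between w0 cz Kx Ky l0 l1) e.
  by rewrite e eqxx in xy.
Qed.

Lemma boundary_extreme_contact K v p : nonzero v -> extreme_contact K v p ->
  boundary K p.
Proof.
move=> v0 [Kp H]; split; first exact: subset_closure.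
move=> /nbhs_ballP[e /= e0 pe].
have N0 : 0 < 1 + `|v.1| + `|v.2| by rewrite -addrA ltr_pwDl// addr_ge0.
pose t := e / 2 / (1 + `|v.1| + `|v.2|).
have t0 : 0 < t by rewrite !divr_gt0.
have tN : t * (1 + `|v.1| + `|v.2|) = e / 2 by rewrite /t mulfVK// gt_eqF.
have a1 : 0 <= `|v.1| by []. have a2 : 0 <= `|v.2| by [].
have /H : K (p + t *: v).
  apply: pe; split; rewrite /ball/= /ball/=  opprD addNKr normrN normrM gtr0_norm//; nra.
have N2 : 0 < dot v v.
  rewrite /dot -!expr2 lt_def addr_ge0 ?sqr_ge0// andbT.
  by rewrite paddr_eq0 ?sqr_ge0// !sqrf_eq0 negb_and.
by rewrite dotD dotZ => -[|[]]; nra.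
Qed.

(** Merging the contact points that coincide leaves an inscribed polygon of the same
length. *)
Theorem perimeter_ge_contacts K n (v p : nat -> plane R) :
  (forall i, (i < n)%N -> extreme_contact K (v i) (p i)) ->
  (forall i, (i < n)%N -> nonzero (v i)) ->
  (forall i j k, (i < j)%N -> (j < k)%N -> (k < n)%N -> ccw_normals (v i) (v j) (v k)) ->
  (exists i j k, [/\ (i < n)%N, (j < n)%N, (k < n)%N &
    [/\ p i != p j, p j != p k & p k != p i]]) ->
  ((closed_length (mkseq p n))%:E <= perimeter K)%E.
Proof.
move=> cp v0 cv [i0 [j0 [k0 [i0n j0n k0n ne]]]].
have cs : convex_position (mkseq p n).
  move=> i j k ij jk; rewrite size_mkseq => kn.
  rewrite !nth_mkseq//=; try lia.
  apply: orient_gt0_contacts (cv i j k ij jk kn) _ _ _; apply: cp; lia.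
have [|s [sp us cs' <-]] := convex_position_undup cs.
  by exists (p i0), (p j0), (p k0); split => //; apply/map_f; rewrite mem_iota.
apply: ereal_sup_ubound; exists (size s), (fun i : 'I_(size s) => nth 0 s i).
split; last by rewrite closed_lengthE /polygon_length.
have ni i j : (i < j)%N -> (j < size s)%N -> nth 0 s i != nth 0 s j.
  by move=> ij js; rewrite nth_uniq ?neq_ltn ?ij//; apply: ltn_trans js.
split=> [i|i j k ij jk].
  have /sp/mapP[m] : nth 0 s i \in s by exact: mem_nth.
  rewrite mem_iota /= add0n => mn ->; exact: boundary_extreme_contact (v0 _ mn) (cp _ mn).
apply: cs' => //; [exact: ni|exact: ni|].
by rewrite eq_sym; apply: ni => //; exact: ltn_trans jk.
Qed.

End perimeter.

(** * The twelve directions and unfolded paths *)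

Section regular_directions.
Context {R : realType}.
Implicit Types (K : set (plane R)) (u v w p q x y z a b : plane R).

Lemma dot_le_dist v x y : v.1 ^+ 2 + v.2 ^+ 2 <= 1 -> dot v (y - x) <= dist x y.
Proof.
move=> v1; have [d0|d0] := leP (dot v (y - x)) 0.
  by apply: le_trans d0 _; rewrite sqrtr_ge0.
rewrite /dist -(ger0_norm (ltW d0)) -sqrtr_sqr ler_sqrt; last first.
  by rewrite addr_ge0 ?sqr_ge0.
rewrite /dot !planeE; set s := x.1; set t := x.2; set s' := y.1; set t' := y.2.
have h : 0 <= (v.1 * (t' - t) - v.2 * (s' - s)) ^+ 2 by rewrite sqr_ge0.
have h2 : (v.1 ^+ 2 + v.2 ^+ 2) * ((s - s') ^+ 2 + (t - t') ^+ 2) <=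
    (s - s') ^+ 2 + (t - t') ^+ 2.
  by rewrite ler_piMl// addr_ge0 ?sqr_ge0.
apply: le_trans h2; rewrite -subr_ge0; apply: le_trans h _.
by rewrite le_eqVlt; apply/orP; left; apply/eqP; ring.
Qed.

Local Notation c := (Num.sqrt (3 : R)).

Lemma sqrt3_sqr : c * c = 3.
Proof. by rewrite -expr2 sqr_sqrtr. Qed.

Lemma sqrt3_bounds : 45 / 26 < c /\ c < 26 / 15.
Proof.
have c0 : 0 <= c by exact: sqrtr_ge0.
have := sqrt3_sqr; split; nra.
Qed.

(** Unit vectors at the multiples of 30 degrees. *)
Definition twelfth (k : nat) : plane R := nth 0
  [:: (1, 0); (c / 2, 2^-1); (2^-1, c / 2); (0, 1); (- 2^-1, c / 2);
      (- (c / 2), 2^-1); (-1, 0); (- (c / 2), - 2^-1); (- 2^-1, - (c / 2));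
      (0, -1); (2^-1, - (c / 2)); (c / 2, - 2^-1)] (k %% 12).

Lemma twelfth_period k : twelfth (k + 12) = twelfth k.
Proof. by rewrite /twelfth modnDr. Qed.

Lemma twelfth_mod k m : twelfth (k + m) = twelfth (k %% 12 + m).
Proof. by rewrite /twelfth modnDml. Qed.

Lemma twelfth_sum4 k : twelfth (k + 2) = twelfth k + twelfth (k + 4).
Proof.
have c2 := sqrt3_sqr; rewrite -[X in _ = twelfth X + _](addn0 k).
rewrite (twelfth_mod k 0) (twelfth_mod k 2) (twelfth_mod k 4).
have : (k %% 12 < 12)%N by rewrite ltn_mod.
by case: (k %% 12)%N => [|[|[|[|[|[|[|[|[|[|[|[|//]]]]]]]]]]]] _;
  apply: plane_eq; rewrite !planeE /twelfth /=; field.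
Qed.

Lemma twelfth_sum2 k : c *: twelfth (k + 1) = twelfth k + twelfth (k + 2).
Proof.
have c2 := sqrt3_sqr; rewrite -[X in _ = twelfth X + _](addn0 k).
rewrite (twelfth_mod k 0) (twelfth_mod k 1) (twelfth_mod k 2).
have : (k %% 12 < 12)%N by rewrite ltn_mod.
by case: (k %% 12)%N => [|[|[|[|[|[|[|[|[|[|[|[|//]]]]]]]]]]]] _;
  apply: plane_eq; rewrite !planeE /twelfth /=; lra.
Qed.

Lemma twelfth_quarter k : twelfth (k + 3) = (- (twelfth k).2, (twelfth k).1).
Proof.
have c2 := sqrt3_sqr; rewrite -[X in _ = (- (twelfth X).2, (twelfth X).1)](addn0 k).
rewrite (twelfth_mod k 0) (twelfth_mod k 3).
have : (k %% 12 < 12)%N by rewrite ltn_mod.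
by case: (k %% 12)%N => [|[|[|[|[|[|[|[|[|[|[|[|//]]]]]]]]]]]] _;
  apply: plane_eq; rewrite /twelfth /=; lra.
Qed.

Lemma twelfth_frame k :
  twelfth (k + 1) = (c / 2) *: twelfth (k + 2) - 2^-1 *: twelfth (k + 5) /\
  twelfth (k + 3) = (c / 2) *: twelfth (k + 2) + 2^-1 *: twelfth (k + 5).
Proof.
have c2 := sqrt3_sqr.
rewrite (twelfth_mod k 1) (twelfth_mod k 2) (twelfth_mod k 3) (twelfth_mod k 5).
have : (k %% 12 < 12)%N by rewrite ltn_mod.
by case: (k %% 12)%N => [|[|[|[|[|[|[|[|[|[|[|[|//]]]]]]]]]]]] _; split;
  apply: plane_eq; rewrite !planeE /twelfth /=; lra.
Qed.

Lemma dot_sum4 k x : dot (twelfth (k + 2)) x = dot (twelfth k) x + dot (twelfth (k + 4)) x.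
Proof. by rewrite twelfth_sum4 dotDl. Qed.

Lemma twelfth_opp6 k : twelfth k = - twelfth (k + 6).
Proof.
rewrite (_ : k + 6 = k + 3 + 3)%N; last by lia.
by rewrite !twelfth_quarter /=; apply: plane_eq; rewrite !planeE/= opprK.
Qed.

Lemma dot_opp6 k x : dot (twelfth k) x = - dot (twelfth (k + 6)) x.
Proof. by rewrite twelfth_opp6 dotNl. Qed.

Lemma dot_sum2 k x :
  c * dot (twelfth (k + 1)) x = dot (twelfth k) x + dot (twelfth (k + 2)) x.
Proof. by rewrite -dotZl twelfth_sum2 dotDl. Qed.

Lemma twelfth_unit k : (twelfth k).1 ^+ 2 + (twelfth k).2 ^+ 2 = 1.
Proof.
have c2 := sqrt3_sqr; rewrite /twelfth; have : (k %% 12 < 12)%N by rewrite ltn_mod.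
by case: (k %% 12)%N => [|[|[|[|[|[|[|[|[|[|[|[|//]]]]]]]]]]]] _ /=; nra.
Qed.

Lemma nonzero_twelfth k : nonzero (twelfth k).
Proof.
rewrite /nonzero -negb_and; apply/negP => /andP[/eqP e1 /eqP e2].
by have := twelfth_unit k; rewrite e1 e2 expr0n/= addr0 => /eqP; rewrite eq_sym oner_eq0.
Qed.

Lemma crs_twelfth k d : (0 < d < 6)%N -> 0 < crs (twelfth k) (twelfth (k + d)).
Proof.
have c2 := sqrt3_sqr; have [c1 _] := sqrt3_bounds.
have -> : twelfth (k + d) = twelfth (k %% 12 + d) by rewrite /twelfth modnDml.
have -> : twelfth k = twelfth (k %% 12) by rewrite /twelfth modn_mod.
have : (k %% 12 < 12)%N by rewrite ltn_mod.
case: (k %% 12)%N => [|[|[|[|[|[|[|[|[|[|[|[|//]]]]]]]]]]]] _;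
by case: d => [|[|[|[|[|[|//]]]]]] _ //; rewrite /twelfth /crs /=; nra.
Qed.

Lemma ccw_twelfth i j k : (i < j)%N -> (j < k)%N -> (k < 12)%N ->
  ccw_normals (twelfth i) (twelfth j) (twelfth k).
Proof.
move=> ij jk k12.
have gap m l : (m < l)%N -> (l < m + 6)%N -> 0 < crs (twelfth m) (twelfth l).
  by move=> ml lm; rewrite -(subnKC (ltnW ml)); apply: crs_twelfth; lia.
have [d1|d1] := ltnP j (i + 6).
  have [d2|d2] := ltnP k (j + 6); first by apply: Or31; split; exact: gap.
  apply: Or33; split; last exact: gap.
  by rewrite -(twelfth_period i); apply: gap; lia.
apply: Or32; split; first by apply: gap; lia.
by rewrite -(twelfth_period i); apply: gap; lia.
Qed.

(** The mirror image of the second half of the path in the line through [q]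
of normal [n] unfolds the path; C and S are the coordinates of a unit vector in
the frame (t, n), and equality holds when it points along the unfolded path. *)
Lemma reflected_path_length t n a q b (C S : R) :
  t.1 ^+ 2 + t.2 ^+ 2 = 1 -> n = (- t.2, t.1) \/ n = (t.2, - t.1) ->
  C ^+ 2 + S ^+ 2 = 1 ->
  C * dot t (b - a) + S * (2 * dot n q - dot n a - dot n b) <=
    dist a q + dist q b.
Proof.
move=> t1 nE CS.
have n1 : (C * t.1 + S * n.1) ^+ 2 + (C * t.2 + S * n.2) ^+ 2 = 1.
  have -> : (C * t.1 + S * n.1) ^+ 2 + (C * t.2 + S * n.2) ^+ 2 =
      (C ^+ 2 + S ^+ 2) * (t.1 ^+ 2 + t.2 ^+ 2) by case: nE => ->/=; ring.
  by rewrite CS t1 mulr1.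
have n2 : (C * t.1 - S * n.1) ^+ 2 + (C * t.2 - S * n.2) ^+ 2 = 1.
  have -> : (C * t.1 - S * n.1) ^+ 2 + (C * t.2 - S * n.2) ^+ 2 =
      (C ^+ 2 + S ^+ 2) * (t.1 ^+ 2 + t.2 ^+ 2) by case: nE => ->/=; ring.
  by rewrite CS t1 mulr1.
have := @dot_le_dist (C *: t + S *: n) a q; rewrite !planeE n1 => /(_ (lexx _)) h1.
have := @dot_le_dist (C *: t - S *: n) q b; rewrite !planeE n2 => /(_ (lexx _)) h2.
apply: le_trans (lerD h1 h2); rewrite !dotDl !dotNl !dotZl !dotB.
by rewrite le_eqVlt; apply/orP; left; apply/eqP; ring.
Qed.

(** Contact points with the two lines at 30 degrees from the normal [n] make
the path longer by half the distance by which those lines miss its ends: the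
first and the last edge are tested against the unit vectors of the unfolded path
corrected by u / 2 and - u' / 2, whose length is still at most 1 by the
hypothesis on C and S. *)
Lemma reflected_path_length_extra t n u u' a p q p' b (C S : R) :
  t.1 ^+ 2 + t.2 ^+ 2 = 1 -> n = (- t.2, t.1) \/ n = (t.2, - t.1) ->
  C ^+ 2 + S ^+ 2 = 1 -> 2 * c * S + 1 <= 2 * C ->
  u = (c / 2) *: n - 2^-1 *: t -> u' = (c / 2) *: n + 2^-1 *: t ->
  C * dot t (b - a) + S * (2 * dot n q - dot n a - dot n b) +
    (dot u (p - a) + dot u' (p' - b)) / 2 <=
    dist a p + dist p q + dist q p' + dist p' b.
Proof.
move=> t1 nE CS cs uE u'E; have c2 := sqrt3_sqr.
have E :
    (C * t.1 + S * n.1 + 2^-1 * (c / 2 * n.1 - 2^-1 * t.1)) ^+ 2 +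
    (C * t.2 + S * n.2 + 2^-1 * (c / 2 * n.2 - 2^-1 * t.2)) ^+ 2 =
    (C ^+ 2 + S ^+ 2 + (c * S - C) / 2 + (c * c + 1) / 16) *
    (t.1 ^+ 2 + t.2 ^+ 2) by case: nE => ->/=; field.
have E' :
    (C * t.1 - S * n.1 - 2^-1 * (c / 2 * n.1 + 2^-1 * t.1)) ^+ 2 +
    (C * t.2 - S * n.2 - 2^-1 * (c / 2 * n.2 + 2^-1 * t.2)) ^+ 2 =
    (C ^+ 2 + S ^+ 2 + (c * S - C) / 2 + (c * c + 1) / 16) *
    (t.1 ^+ 2 + t.2 ^+ 2) by case: nE => ->/=; field.
have n1 : (C * t.1 + S * n.1) ^+ 2 + (C * t.2 + S * n.2) ^+ 2 = 1.
  have -> : (C * t.1 + S * n.1) ^+ 2 + (C * t.2 + S * n.2) ^+ 2 =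
      (C ^+ 2 + S ^+ 2) * (t.1 ^+ 2 + t.2 ^+ 2) by case: nE => ->/=; ring.
  by rewrite CS t1 mulr1.
have n2 : (C * t.1 - S * n.1) ^+ 2 + (C * t.2 - S * n.2) ^+ 2 = 1.
  have -> : (C * t.1 - S * n.1) ^+ 2 + (C * t.2 - S * n.2) ^+ 2 =
      (C ^+ 2 + S ^+ 2) * (t.1 ^+ 2 + t.2 ^+ 2) by case: nE => ->/=; ring.
  by rewrite CS t1 mulr1.
have h1 : dot (C *: t + S *: n + 2^-1 *: u) (p - a) <= dist a p.
  by apply: dot_le_dist; rewrite uE !planeE E t1 mulr1 CS c2; lra.
have h2 : dot (C *: t + S *: n) (q - p) <= dist p q.
  by apply: dot_le_dist; rewrite !planeE n1.
have h3 : dot (C *: t - S *: n) (p' - q) <= dist q p'.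
  by apply: dot_le_dist; rewrite !planeE n2.
have h4 : dot (C *: t - S *: n - 2^-1 *: u') (b - p') <= dist p' b.
  by apply: dot_le_dist; rewrite u'E !planeE E' t1 mulr1 CS c2; lra.
apply: le_trans (lerD (lerD (lerD h1 h2) h3) h4).
rewrite !dotDl !dotNl !dotZl !dotB.
by rewrite le_eqVlt; apply/orP; left; apply/eqP; field.
Qed.

End regular_directions.

(** * The polygon of twelve contact points *)

Section near_regular.
Context {R : realType}.
Implicit Types (K : set (plane R)) (u v w p q x y z a b : plane R).
Local Notation c := (Num.sqrt (3 : R)).
Local Notation W := (@twelfth R).

(** What the argument uses of the perimeter and of the mixed area of K and -K,
in a form that is stable under similarities. *)
Definition bounds_contact_polygons K (L : R) := forall n (v p : nat -> plane R),
  (forall i, (i < n)%N -> extreme_contact K (v i) (p i)) ->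
  (forall i, (i < n)%N -> nonzero (v i)) ->
  (forall i j k, (i < j)%N -> (j < k)%N -> (k < n)%N -> ccw_normals (v i) (v j) (v k)) ->
  (exists i j k, [/\ (i < n)%N, (j < n)%N, (k < n)%N &
    [/\ p i != p j, p j != p k & p k != p i]]) ->
  closed_length (mkseq p n) <= L.

Definition bounded_by_hexagons K (A : R) := forall v w t, crs v w != 0 ->
  contacts v w K t -> `|crs v w| * A <= hexform (supp v w t).

(** The sandwich between the regular triangle of inradius 1 centred at the origin,
with vertices on the rays of W 3, W 7, W 11, and its dilate. *)
Definition near_standard K (rho : R) := [/\ K (2 *: W 3), K (2 *: W 7), K (2 *: W 11) &
  forall x, K x -> [/\ dot (W 1) x <= 1 + rho, dot (W 5) x <= 1 + rho &
    dot (W 9) x <= 1 + rho]].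

Lemma hexdir_twelfth m i : (m < 2)%N -> hexdir (W m) (W m.+2) i = W (m + i.*2).
Proof.
move=> m2; have -> : W (m + i.*2) = W (m + (i %% 6).*2).
  by rewrite /twelfth; congr nth; lia.
have : (i %% 6 < 6)%N by rewrite ltn_mod.
rewrite /hexdir; case: m m2 => [|[|//]] _;
by case: (i %% 6)%N => [|[|[|[|[|[|//]]]]]] _; apply: plane_eq; rewrite ?planeE /twelfth /= ?planeE /=; field.
Qed.

(** The defect is a sum of squares of differences of the lengths of alternate
sides of the hexagon. *)
Lemma hexform_odd_le (h1 h3 h5 h7 h9 h11 : R) :
  12 * ((h1 + h7) * (h3 + h9) - (h3 + h7 - h5) * (h1 + h9 - h11)) <=
  3 * (h3 + h7 + h11) ^+ 2 + (2 * (h1 + h5 + h9) - (h3 + h7 + h11)) ^+ 2.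
Proof.
have h := addr_ge0 (addr_ge0 (sqr_ge0 (h1 + h5 - h3 - (h5 + h9 - h7)))
  (sqr_ge0 (h5 + h9 - h7 - (h9 + h1 - h11)))) (sqr_ge0 (h9 + h1 - h11 - (h1 + h5 - h3))).
rewrite -subr_ge0 (_ : _ - _ = 2 * ((h1 + h5 - h3 - (h5 + h9 - h7)) ^+ 2 +
  (h5 + h9 - h7 - (h9 + h1 - h11)) ^+ 2 + (h9 + h1 - h11 - (h1 + h5 - h3)) ^+ 2)); first lra.
by ring.
Qed.

Definition mid_range (x : R) : bool := 12 / 7 <= x <= 25 / 14.

(** [hexform] as a function of six numbers. *)
Definition hexform6 (h0 h2 h4 h6 h8 h10 : R) : R :=
  (h0 + h6) * (h2 + h8) - (h2 + h6 - h4) * (h0 + h8 - h10).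

(** A quadratic form, whose linear coefficients are at most 13 / 7 in the range
considered; the quadratic part takes up the rest of the factor 2. *)
Lemma hexform6_perturb (a0 a2 a4 a6 a8 a10 l0 l2 l4 l6 l8 l10 : R) :
  [/\ mid_range a0, mid_range a2, mid_range a4 & [/\ mid_range a6,
    mid_range a8 & mid_range a10]] ->
  [/\ 0 <= l0, 0 <= l2, 0 <= l4 & [/\ 0 <= l6, 0 <= l8 & 0 <= l10]] ->
  l0 + l2 + l4 + l6 + l8 + l10 <= 10^-1 ->
  hexform6 (a0 + l0) (a2 + l2) (a4 + l4) (a6 + l6) (a8 + l8) (a10 + l10) <=
  hexform6 a0 a2 a4 a6 a8 a10 + 2 * (l0 + l2 + l4 + l6 + l8 + l10).
Proof.
move=> [/andP[? ?] /andP[? ?] /andP[? ?] [/andP[? ?] /andP[? ?] /andP[? ?]]].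
move=> [p0 p2 p4 [p6 p8 p10]]; set s := l0 + l2 + l4 + l6 + l8 + l10 => s1.
have q : hexform6 l0 l2 l4 l6 l8 l10 <= s * s.
  rewrite -subr_ge0 (_ : s * s - _ = l0 * l0 + l2 * l2 + l4 * l4 + l6 * l6 + l8 * l8
    + l10 * l10 + 2 * (l0 * l2 + l2 * l4 + l4 * l6 + l6 * l8 + l8 * l10 + l10 * l0)
    + (l0 * l4 + l4 * l8 + l8 * l0 + l2 * l6 + l6 * l10 + l10 * l2)
    + 3 * (l0 * l6 + l2 * l8 + l4 * l10)).
    by rewrite !(addr_ge0, mulr_ge0).
  by rewrite /s /hexform6; ring.
have s0 : 0 <= s by rewrite !addr_ge0.
have ss : s * s <= s * 10^-1 by rewrite ler_wpM2l.
have -> : hexform6 (a0 + l0) (a2 + l2) (a4 + l4) (a6 + l6) (a8 + l8) (a10 + l10) =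
    hexform6 a0 a2 a4 a6 a8 a10 + hexform6 l0 l2 l4 l6 l8 l10 +
    (l0 * (a4 + a8 - a6) + l2 * (a6 + a10 - a8) + l4 * (a8 + a0 - a10) +
     l6 * (a10 + a2 - a0) + l8 * (a0 + a4 - a2) + l10 * (a2 + a6 - a4)).
  by rewrite /hexform6; ring.
have h (l d : R) : 0 <= l -> d <= 13 / 7 -> l * d <= l * (13 / 7) by move=> *; rewrite ler_wpM2l.
have := h l0 (a4 + a8 - a6) p0 ltac:(lra); have := h l2 (a6 + a10 - a8) p2 ltac:(lra).
have := h l4 (a8 + a0 - a10) p4 ltac:(lra); have := h l6 (a10 + a2 - a0) p6 ltac:(lra).
have := h l8 (a0 + a4 - a2) p8 ltac:(lra); have := h l10 (a2 + a6 - a4) p10 ltac:(lra).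
by move: ss q; rewrite /s; lra.
Qed.

Lemma hexform6_range (a0 a2 a4 a6 a8 a10 : R) :
  [/\ mid_range a0, mid_range a2, mid_range a4 & [/\ mid_range a6,
    mid_range a8 & mid_range a10]] ->
  8 <= hexform6 a0 a2 a4 a6 a8 a10 /\ hexform6 a0 a2 a4 a6 a8 a10 <= 141 / 14.
Proof.
move=> [/andP[? ?] /andP[? ?] /andP[? ?] [/andP[? ?] /andP[? ?] /andP[? ?]]].
rewrite /hexform6.
have : (a0 + a6) * (a2 + a8) <= (25 / 7) * (25 / 7) by apply: ler_pM; lra.
have : (24 / 7) * (24 / 7) <= (a0 + a6) * (a2 + a8) by apply: ler_pM; lra.
have : (23 / 14) * (23 / 14) <= (a2 + a6 - a4) * (a0 + a8 - a10) by apply: ler_pM; lra.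
have : (a2 + a6 - a4) * (a0 + a8 - a10) <= (13 / 7) * (13 / 7) by apply: ler_pM; lra.
lra.
Qed.

(** Between a side normal and a vertex normal: such a functional is 1 / c times
their sum, hence close to c at every point close to the vertex. *)
Lemma mid_rangeP (rho s t x : R) : rho <= 35^-1 -> s <= 1 + rho -> t <= 1 + rho ->
  2 <= s + t -> c * x = s + (s + t) -> mid_range x.
Proof.
have c2 := @sqrt3_sqr R; have := @sqrt3_bounds R.
rewrite /mid_range; move: (Num.sqrt 3) c2 => k k2 [k1 k1'] *; apply/andP; split; nra.
Qed.

Lemma near_standard_side K (rho : R) x k : near_standard K rho -> K x ->
  dot (W (1 + 4 * k)) x <= 1 + rho.
Proof.
move=> [_ _ _ KT] Kx; have [h1 h5 h9] := KT _ Kx.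
have -> : W (1 + 4 * k) = W (1 + 4 * (k %% 3)) by rewrite /twelfth; congr nth; lia.
by case: (k %% 3)%N (ltn_pmod k (isT : (0 < 3)%N)) => [|[|[|//]]].
Qed.

Lemma corner_bounds K (rho : R) q k : rho <= 35^-1 -> near_standard K rho -> K q ->
  2 <= dot (W (3 + 4 * k)) q ->
  mid_range (dot (W (2 + 4 * k)) q) /\ mid_range (dot (W (4 + 4 * k)) q).
Proof.
move=> r35 KT Kq; have h1 := near_standard_side k KT Kq.
have h5 := near_standard_side k.+1 KT Kq.
have -> : (3 + 4 * k = 1 + 4 * k + 2)%N by lia.
rewrite dot_sum4; have -> : (1 + 4 * k + 4 = 1 + 4 * k.+1)%N by lia.
have e4 := dot_sum4 (1 + 4 * k) q; have e2 := dot_sum2 (1 + 4 * k) q.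
have e3 := dot_sum2 (1 + 4 * k + 2) q.
rewrite (_ : 1 + 4 * k + 4 = 1 + 4 * k.+1)%N in e4; last lia.
rewrite (_ : 1 + 4 * k + 1 = 2 + 4 * k)%N in e2; last lia.
rewrite (_ : 1 + 4 * k + 2 + 1 = 4 + 4 * k)%N in e3; last lia.
rewrite (_ : 1 + 4 * k + 2 + 2 = 1 + 4 * k.+1)%N in e3; last lia.
move: e2 e3 e4 h1 h5; rewrite addnAC.
move: (dot (W (1 + 4 * k)) q) (dot (W (1 + 4 * k.+1)) q) (dot (W (1 + 4 * k + 2)) q) => s t u.
move=> e2 e3 e4 h1 h5 st; split.
  by apply: (mid_rangeP r35 h1 h5 st); rewrite e2 e4.
by apply: (mid_rangeP r35 h5 h1); rewrite ?e3 ?e4; lra.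
Qed.

Lemma exists_contacts K : compact K -> K !=set0 ->
  exists p : nat -> plane R, (forall k, p (k + 12)%N = p k) /\
    forall k, extreme_contact K (W k) (p k).
Proof.
move=> cK K0; have /choice[p pP] k := extreme_contact_exists (W k) cK K0.
exists (fun k => p (k %% 12)%N); split=> k; first by rewrite modnDr.
by have -> : W k = W (k %% 12) by rewrite /twelfth modn_mod.
Qed.

Lemma hexform_twelfth K m (p : nat -> plane R) : (m < 2)%N -> (forall k, p (k + 12)%N = p k) ->
  (forall k, extreme_contact K (W k) (p k)) -> forall A, bounded_by_hexagons K A ->
  c / 2 * A <= hexform6 (dot (W m) (p m)) (dot (W m.+2) (p m.+2))
    (dot (W (m + 4)) (p (m + 4)%N)) (dot (W (m + 6)) (p (m + 6)%N))
    (dot (W (m + 8)) (p (m + 8)%N)) (dot (W (m + 10)) (p (m + 10)%N)).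
Proof.
move=> m2 p12 pK A KA; have [c1 _] := @sqrt3_bounds R.
have cE : crs (W m) (W m.+2) = c / 2.
  have c2 := @sqrt3_sqr R.
  by case: m m2 => [|[|//]] _; rewrite /crs /twelfth/=; lra.
have := KA (W m) (W m.+2) (fun i => p (m + i.*2)%N).
rewrite cE ger0_norm; last by lra.
have e i : supp (W m) (W m.+2) (fun i => p (m + i.*2)%N) i =
    dot (W (m + i.*2)) (p (m + i.*2)%N) by rewrite /supp hexdir_twelfth.
rewrite /hexform !e /= !addn0 addn2; apply; first by apply: lt0r_neq0; lra.
split=> [i|i]; first by rewrite -(p12 (m + i.*2)%N); congr p; lia.
by split=> [|s Ks]; [exact: (pK _).1|rewrite hexdir_twelfth//; exact: extreme_contact_le].
Qed.

(** In the extremal case the three sides, unfolded, point in the same direction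
(C, S) of their frames. *)
Lemma unfolding_direction (rho h1 h5 h9 h3 h7 h11 : R) : rho <= 35^-1 ->
  [/\ h1 <= 1 + rho, h5 <= 1 + rho & h9 <= 1 + rho] ->
  [/\ 2 <= h3, 2 <= h7 & 2 <= h11] -> h3 + h7 + h11 <= 2 * (h1 + h5 + h9) ->
  let X := c * (h3 + h7 + h11) in let Y := 2 * (h1 + h5 + h9) - (h3 + h7 + h11) in
  exists C S : R, exists2 N, [/\ C ^+ 2 + S ^+ 2 = 1, 2 * c * S + 1 <= 2 * C &
    C * X + S * Y = N] & [/\ 0 < N, N <= 11 & N ^+ 2 = X ^+ 2 + Y ^+ 2].
Proof.
have := @sqrt3_bounds R; move: (Num.sqrt 3) => k [c1 c1'] r35 [? ? ?] [? ? ?] le X Y.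
have Y0 : 0 <= Y by rewrite /Y; lra.
have Y1 : Y <= 6 / 35 by rewrite /Y; lra.
have X1 : 10 <= X.
  have : 6 * k <= X by rewrite /X mulrC ler_wpM2l; lra.
  lra.
have X2 : X <= 54 / 5.
  have : X <= k * (6 + 6 / 35) by rewrite /X ler_wpM2l; lra.
  lra.
move: X Y {le} Y0 Y1 X1 X2 => X Y Y0 Y1 X1 X2.
pose N := Num.sqrt (X ^+ 2 + Y ^+ 2).
have N2 : N ^+ 2 = X ^+ 2 + Y ^+ 2 by rewrite sqr_sqrtr// addr_ge0 ?sqr_ge0.
have N0 : 0 <= N by exact: sqrtr_ge0.
move: N N0 N2 => N N0 N2.
have NXY : N <= X + Y by nra.
have NX : X <= N by nra.
have Npos : 0 < N by lra.
pose C := X / N; pose S := Y / N.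
have CN : C * N = X by rewrite /C mulfVK// gt_eqF.
have SN : S * N = Y by rewrite /S mulfVK// gt_eqF.
have NN : N ^+ 2 != 0 by rewrite expf_neq0// gt_eqF.
exists C, S, N; split => //; last lra.
- by apply: (mulIf NN); rewrite mul1r mulrDl -!exprMn CN SN N2.
- rewrite -(ler_pM2r Npos) (_ : _ * N = 2 * (k * (S * N)) + N); last by ring.
  rewrite (_ : 2 * C * N = 2 * (C * N)); last by ring.
  rewrite CN SN; have : k * Y <= 26 / 15 * Y by rewrite ler_wpM2r//; lra.
  lra.
- by apply: (mulIf (lt0r_neq0 Npos)); rewrite -[RHS]expr2 N2 -CN -SN; ring.
Qed.

(** As N ^ 2 already bounds the isoperimetric constant times the mixed area, there
is room in the perimeter only for defects of order eps. *)
Lemma defects_le (N Lam L q A eps : R) : 0 <= eps -> 0 < N -> N <= 11 -> 0 <= Lam ->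
  N + Lam / 2 <= L -> L ^+ 2 <= (1 + eps) * (12 * A) -> A <= q -> 12 * q <= N ^+ 2 ->
  Lam <= 11 * eps.
Proof.
move=> e0 N0 N11 Lam0 NL LA Aq qN.
have h : (N + Lam / 2) ^+ 2 <= (1 + eps) * N ^+ 2.
  apply: (@le_trans _ _ (L ^+ 2)); first by rewrite lerXn2r ?nnegrE//; lra.
  by apply: le_trans LA _; rewrite ler_wpM2l//; lra.
have : Lam <= eps * N.
  by rewrite -(ler_pM2r N0); nra.
nra.
Qed.

(** The edges of the polygon, grouped by sides of the triangle. *)
Lemma add_sides (A3 A7 A11 a4 a6 a8 a10 a0 a2 d0 d1 d2 d3 d4 d5 d6 d7 d8 d9 d10 d11 : R) :
  A3 + (a4 + a6) / 2 <= d3 + d4 + d5 + d6 -> A7 + (a8 + a10) / 2 <= d7 + d8 + d9 + d10 ->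
  A11 + (a0 + a2) / 2 <= d11 + d0 + d1 + d2 ->
  A3 + A7 + A11 + (a4 + a6 + (a8 + a10) + (a0 + a2)) / 2 <=
  d0 + (d1 + (d2 + (d3 + (d4 + (d5 + (d6 + (d7 + (d8 + (d9 + (d10 + (d11 + 0))))))))))).
Proof. lra. Qed.

(** The contact points with the twelve supporting lines whose
normals are the multiples of 30 degrees form a polygon, at each of whose
corners three lines nearly meet; the extra length of this polygon controls,
linearly in eps, the distances from the corner points to the other two lines. *)
Lemma corner_defects K (p : nat -> plane R) (rho L A eps : R) :
  rho <= 35^-1 -> 0 <= eps -> near_standard K rho ->
  (forall k, p (k + 12)%N = p k) -> (forall k, extreme_contact K (W k) (p k)) ->
  bounds_contact_polygons K L -> bounded_by_hexagons K A ->
  L ^+ 2 <= (1 + eps) * (6 * c * A) ->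
  dot (W 4) (p 4%N - p 3%N) + dot (W 6) (p 6%N - p 7%N) +
  (dot (W 8) (p 8%N - p 7%N) + dot (W 10) (p 10%N - p 11%N)) +
  (dot (W 0) (p 0%N - p 11%N) + dot (W 2) (p 2%N - p 3%N)) <= 11 * eps.
Proof.
move=> r35 e0 KT p12 pK KL KA LA; set Lam := (X in X <= _).
have [V3 V7 V11 KS] := KT.
have Kp k : K (p k) := (pK k).1.
have le k x : K x -> dot (W k) x <= dot (W k) (p k) by exact: extreme_contact_le.
have [h hE] : exists h : nat -> R, forall k, dot (W k) (p k) = h k.
  by exists (fun k => dot (W k) (p k)).
have hV k : K (2 *: W k) -> 2 <= h k.
  have e : dot (W k) (W k) = 1 by rewrite /dot -!expr2 twelfth_unit.
  by move=> V; have := le k _ V; rewrite dotZ e mulr1 hE.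
have hs k : h (1 + 4 * k)%N <= 1 + rho by rewrite -hE; exact: near_standard_side KT (Kp _).
have hle k : h (k + 2)%N <= h k + h (k + 4)%N.
  by rewrite -!hE dot_sum4; apply: lerD; exact: le.
have p13 : p 13%N = p 1%N by exact: (p12 1%N).
have h13 : h 13%N = h 1%N by rewrite -!hE p13.
have hsum : h 3%N + h 7%N + h 11%N <= 2 * (h 1%N + h 5%N + h 9%N).
  have e1 : h 3%N <= h 1%N + h 5%N by exact: (hle 1%N).
  have e5 : h 7%N <= h 5%N + h 9%N by exact: (hle 5%N).
  have e9 : h 11%N <= h 9%N + h 1%N by rewrite -h13; exact: (hle 9%N).
  move: e1 e5 e9; move: (h 1%N) (h 3%N) (h 5%N) (h 7%N) (h 9%N) (h 11%N) => *; lra.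
have [C [S [N [CS cSC CXSY] [N0 N11 N2]]]] := unfolding_direction r35
  (And3 (hs 0%N) (hs 1%N) (hs 2%N)) (And3 (hV _ V3) (hV _ V7) (hV _ V11)) hsum.
have side k := @reflected_path_length_extra _ (W (k + 5)) (W (k + 2)) (W (k + 1)) (W (k + 3))
   (p k) (p (k + 1)%N) (p (k + 2)%N) (p (k + 3)%N) (p (k + 4)%N) C S (twelfth_unit _).
have {}side k : C * dot (W (k + 5)) (p (k + 4)%N - p k) + S * (2 * dot (W (k + 2)) (p (k + 2)%N) -
     dot (W (k + 2)) (p k) - dot (W (k + 2)) (p (k + 4)%N)) +
    (dot (W (k + 1)) (p (k + 1)%N - p k) + dot (W (k + 3)) (p (k + 3)%N - p (k + 4)%N)) / 2 <=
    dist (p k) (p (k + 1)%N) + dist (p (k + 1)%N) (p (k + 2)%N) +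
    dist (p (k + 2)%N) (p (k + 3)%N) + dist (p (k + 3)%N) (p (k + 4)%N).
  have [r1 r3] := @twelfth_frame R k; apply: side => //.
  right; have := @twelfth_quarter R (k + 2); rewrite -addnA => ->.
  by rewrite opprK -surjective_pairing.
have LP : closed_length (mkseq p 12) <= L.
  apply: (KL _ W) => //.
  - by move=> i _; exact: nonzero_twelfth.
  - by move=> i j k; exact: ccw_twelfth.
  - have ne k : h (3 + 4 * k)%N >= 2 -> h (7 + 4 * k)%N >= 2 -> p (3 + 4 * k)%N != p (7 + 4 * k)%N.
      move=> a b; apply/eqP => e; move: a b; rewrite -!hE -e.
      have := near_standard_side k.+1 KT (Kp (3 + 4 * k)%N).
      have := dot_sum4 (3 + 4 * k) (p (3 + 4 * k)%N).
      rewrite (_ : 3 + 4 * k + 2 = 1 + 4 * k.+1)%N; last lia.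
      rewrite (_ : 3 + 4 * k + 4 = 7 + 4 * k)%N; last lia.
      lra.
    exists 3%N, 7%N, 11%N; split => //; split.
    + by apply: (ne 0%N); exact: hV.
    + by apply: (ne 1%N); exact: hV.
    + have p15 : p 15%N = p 3%N by exact: (p12 3%N).
      have h15 : h 15%N = h 3%N by rewrite -!hE p15.
      by rewrite -p15; apply: (ne 2%N); [exact: (hV _ V11)|rewrite -[(7 + 4 * 2)%N]/15%N h15; exact: (hV _ V3)].
have p0 : p 12%N = p 0%N by exact: (p12 0%N).
have p14 : p 14%N = p 2%N by exact: (p12 2%N).
have p15 : p 15%N = p 3%N by exact: (p12 3%N).
rewrite /closed_length /mkseq /= in LP.
(* tangential and normal parts of the three unfolded sides *)
pose u3 := dot (W 8) (p 7%N - p 3%N); pose u7 := dot (W 0) (p 11%N - p 7%N).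
pose u11 := dot (W 4) (p 3%N - p 11%N).
have uE : u3 + u7 + u11 = c * (h 3%N + h 7%N + h 11%N).
  have c3 : c * h 3%N = dot (W 2) (p 3%N) + dot (W 4) (p 3%N) by rewrite -hE; exact: (@dot_sum2 R 2).
  have c7 : c * h 7%N = dot (W 6) (p 7%N) + dot (W 8) (p 7%N) by rewrite -hE; exact: (@dot_sum2 R 6).
  have c11 : c * h 11%N = dot (W 10) (p 11%N) + dot (W 0) (p 11%N) by rewrite -hE; exact: (@dot_sum2 R 10).
  have o3 : dot (W 2) (p 3%N) = - dot (W 8) (p 3%N) by exact: dot_opp6.
  have o7 : dot (W 6) (p 7%N) = - dot (W 0) (p 7%N) by exact: (@dot_opp6 R 6).
  have o11 : dot (W 10) (p 11%N) = - dot (W 4) (p 11%N) by exact: (@dot_opp6 R 10).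
  by rewrite !mulrDr c3 c7 c11 o3 o7 o11 /u3 /u7 /u11 !dotB; ring.
pose v3 := 2 * h 5%N - dot (W 5) (p 3%N) - dot (W 5) (p 7%N).
pose v7 := 2 * h 9%N - dot (W 9) (p 7%N) - dot (W 9) (p 11%N).
pose v11 := 2 * h 1%N - dot (W 1) (p 11%N) - dot (W 1) (p 3%N).
have vE : v3 + v7 + v11 = 2 * (h 1%N + h 5%N + h 9%N) - (h 3%N + h 7%N + h 11%N).
  have c3 : h 3%N = dot (W 1) (p 3%N) + dot (W 5) (p 3%N) by rewrite -hE; exact: (@dot_sum4 R 1).
  have c7 : h 7%N = dot (W 5) (p 7%N) + dot (W 9) (p 7%N) by rewrite -hE; exact: (@dot_sum4 R 5).
  have c11 : h 11%N = dot (W 9) (p 11%N) + dot (W 1) (p 11%N) by rewrite -hE; exact: (@dot_sum4 R 9).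
  by rewrite c3 c7 c11 /v3 /v7 /v11; ring.
have NE : C * u3 + S * v3 + (C * u7 + S * v7) + (C * u11 + S * v11) = N.
  rewrite -CXSY -uE -vE; ring.
have s3 : C * u3 + S * v3 + (dot (W 4) (p 4%N - p 3%N) + dot (W 6) (p 6%N - p 7%N)) / 2 <=
    dist (p 3%N) (p 4%N) + dist (p 4%N) (p 5%N) + dist (p 5%N) (p 6%N) + dist (p 6%N) (p 7%N).
  by rewrite /v3 -hE; exact: (side 3%N).
have s7 : C * u7 + S * v7 + (dot (W 8) (p 8%N - p 7%N) + dot (W 10) (p 10%N - p 11%N)) / 2 <=
    dist (p 7%N) (p 8%N) + dist (p 8%N) (p 9%N) + dist (p 9%N) (p 10%N) + dist (p 10%N) (p 11%N).
  by rewrite /v7 -hE; exact: (side 7%N).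
have s11 : C * u11 + S * v11 + (dot (W 0) (p 0%N - p 11%N) + dot (W 2) (p 2%N - p 3%N)) / 2 <=
    dist (p 11%N) (p 0%N) + dist (p 0%N) (p 1%N) + dist (p 1%N) (p 2%N) + dist (p 2%N) (p 3%N).
  by rewrite /v11 -hE /u11 -p0 -p13 -p14 -p15; exact: (side 11%N).
have NL : N + Lam / 2 <= L.
  apply: le_trans LP; rewrite -NE /Lam.
  exact: add_sides s3 s7 s11.
have Lam0 : 0 <= Lam.
  have d k j : 0 <= dot (W k) (p k - p j) by rewrite dotB subr_ge0; exact: le.
  exact: (addr_ge0 (addr_ge0 (addr_ge0 (d _ _) (d _ _)) (addr_ge0 (d _ _) (d _ _)))
    (addr_ge0 (d _ _) (d _ _))).
have Aq := hexform_twelfth (isT : (1 < 2)%N) p12 pK KA.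
rewrite !hE in Aq.
apply: (defects_le e0 N0 N11 Lam0 NL (A := c / 2 * A)) Aq _.
  by apply: le_trans LA _; rewrite le_eqVlt; apply/orP; left; apply/eqP; field.
apply: le_trans (hexform_odd_le _ _ _ _ _ _) _.
rewrite N2 exprMn sqr_sqrtr// le_eqVlt; apply/orP; left; apply/eqP.
Qed.

End near_regular.

(** * The triangle of contact points at the corners *)

Section near_regular_triangle.
Context {R : realType}.
Implicit Types (K : set (plane R)) (u v w q x y z a b : plane R).
Local Notation c := (Num.sqrt (3 : R)).
Local Notation W := (@twelfth R).

Lemma hexform6_triangle q1 q2 q3 :
  hexform6 (dot (W 0) q3) (dot (W 2) q1) (dot (W 4) q1) (dot (W 6) q2) (dot (W 8) q2)
    (dot (W 10) q3) = c / 2 * orient q1 q2 q3.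
Proof. by rewrite /hexform6 /orient /dot /twelfth/=; field. Qed.

Lemma square_le_of_defects (L A H Q Lam eps : R) : 0 <= eps -> eps <= (6 * 180) ^- 2 ->
  L ^+ 2 <= (1 + eps) * (12 * A) -> A <= Q -> Q <= H + 2 * Lam -> Lam <= 11 * eps ->
  H <= 141 / 14 -> L ^+ 2 <= 12 * H + 400 * eps.
Proof.
move=> e0 e1 LA AQ QH Le H1.
have e2 : eps <= 10^-1.
  by apply: le_trans e1 _; rewrite lef_pV2 ?posrE ?exprn_gt0//; lra.
apply: le_trans LA _; apply: (@le_trans _ _ ((1 + eps) * (12 * (H + 22 * eps)))).
  by rewrite ler_wpM2l//; lra.
nra.
Qed.

(** The six normals at 30 degrees from those of the triangle's sides see only the
corners of K, so the hexagon with these normals gives the upper bound of the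
mixed area that belongs to the triangle of contact points, up to the defects at
the corners. *)
Lemma perimeter_le_triangle K (p : nat -> plane R) (rho L A eps : R) :
  rho <= 35^-1 -> 0 <= eps -> eps <= (6 * 180) ^- 2 -> near_standard K rho ->
  (forall k, p (k + 12)%N = p k) -> (forall k, extreme_contact K (W k) (p k)) ->
  bounds_contact_polygons K L -> bounded_by_hexagons K A ->
  L ^+ 2 <= (1 + eps) * (6 * c * A) ->
  [/\ 2 <= dot (W 3) (p 3%N), 2 <= dot (W 7) (p 7%N), 2 <= dot (W 11) (p 11%N) &
  L ^+ 2 <= 6 * c * orient (p 3%N) (p 7%N) (p 11%N) + 400 * eps].
Proof.
move=> r35 e0 e1 KT p12 pK KL KA LA.
have Lam := corner_defects r35 e0 KT p12 pK KL KA LA.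
have [V3 V7 V11 _] := KT.
have Kp k : K (p k) := (pK k).1.
have le k x : K x -> dot (W k) x <= dot (W k) (p k) by exact: extreme_contact_le.
have hV k : K (2 *: W k) -> 2 <= dot (W k) (p k).
  have e : dot (W k) (W k) = 1 by rewrite /dot -!expr2 twelfth_unit.
  by move=> V; have := le k _ V; rewrite dotZ e mulr1.
split; [exact: hV|exact: hV|exact: hV|].
have [m2 m4] := corner_bounds (k := 0) r35 KT (Kp 3%N) (hV _ V3).
have [m6 m8] := corner_bounds (k := 1) r35 KT (Kp 7%N) (hV _ V7).
have [m10 m0] := corner_bounds (k := 2) r35 KT (Kp 11%N) (hV _ V11).
have m : [/\ mid_range (dot (W 0) (p 11%N)), mid_range (dot (W 2) (p 3%N)),
  mid_range (dot (W 4) (p 3%N)) & [/\ mid_range (dot (W 6) (p 7%N)),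
  mid_range (dot (W 8) (p 7%N)) & mid_range (dot (W 10) (p 11%N))]] by [].
have l0 k j : 0 <= dot (W k) (p k - p j) by rewrite dotB subr_ge0; exact: le.
have l : [/\ 0 <= dot (W 0) (p 0%N - p 11%N), 0 <= dot (W 2) (p 2%N - p 3%N),
  0 <= dot (W 4) (p 4%N - p 3%N) & [/\ 0 <= dot (W 6) (p 6%N - p 7%N),
  0 <= dot (W 8) (p 8%N - p 7%N) & 0 <= dot (W 10) (p 10%N - p 11%N)]] by [].
have Aq := hexform_twelfth (isT : (0 < 2)%N) p12 pK KA.
have H1 := (hexform6_range m).2; rewrite hexform6_triangle in H1.
rewrite [X in X * _ + _](_ : _ = 12 * (c / 2)); last by field.
rewrite -mulrA.
have PE k j : dot (W k) (p k) = dot (W k) (p j) + dot (W k) (p k - p j).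
  by rewrite dotB addrC subrK.
have {}Lam : dot (W 0) (p 0%N - p 11%N) + dot (W 2) (p 2%N - p 3%N) +
    dot (W 4) (p 4%N - p 3%N) + dot (W 6) (p 6%N - p 7%N) +
    dot (W 8) (p 8%N - p 7%N) + dot (W 10) (p 10%N - p 11%N) <= 11 * eps.
  have re (a4 a6 a8 a10 a0 a2 : R) :
    a0 + a2 + a4 + a6 + a8 + a10 = a4 + a6 + (a8 + a10) + (a0 + a2) by ring.
  by rewrite re.
have e2 : eps <= 110^-1.
  by apply: le_trans e1 _; rewrite lef_pV2 ?posrE ?exprn_gt0//; lra.
have Q := hexform6_perturb m l ltac:(lra).
rewrite -!PE hexform6_triangle in Q.
apply: (square_le_of_defects e0 e1 _ Aq Q Lam H1).
by apply: le_trans LA _; rewrite le_eqVlt; apply/orP; left; apply/eqP; field.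
Qed.

End near_regular_triangle.

(** * Caps beyond the sides of an inscribed triangle *)

Section triangle_with_caps.
Context {R : realType}.
Implicit Types (K : set (plane R)) (u v w q r x y z a b : plane R).

(** Outward normal of the edge from x to y of a counterclockwise polygon. *)
Definition edge_normal x y : plane R := (y.2 - x.2, - (y.1 - x.1)).

Lemma dot_edge_normal x y z : dot (edge_normal x y) (z - x) = - orient x y z.
Proof. by rewrite /dot /edge_normal /orient !planeE /=; ring. Qed.

Lemma crs_edge_normall x y w : crs (edge_normal x y) w = dot w (y - x).
Proof. by rewrite /crs /edge_normal /dot !planeE /=; ring. Qed.

Lemma crs_edge_normalr x y w : crs w (edge_normal x y) = dot w (x - y).
Proof. by rewrite /crs /edge_normal /dot !planeE /=; ring. Qed.

Lemma crs_edge_normals x y z : crs (edge_normal x y) (edge_normal y z) = orient x y z.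
Proof. by rewrite /crs /edge_normal /orient /=; ring. Qed.

Lemma dist_sqr x y : dist x y ^+ 2 = (x.1 - y.1) ^+ 2 + (x.2 - y.2) ^+ 2.
Proof. by rewrite sqr_sqrtr// addr_ge0 ?sqr_ge0. Qed.

Lemma dist_ge0 x y : 0 <= dist x y.
Proof. exact: sqrtr_ge0. Qed.

(** [orient a b q] is, up to sign, dist a b times the height of q over the line
a b. *)
Lemma cap_path_length a b q (C S : R) : 0 < dist a b -> C ^+ 2 + S ^+ 2 = 1 ->
  C * dist a b + S * (2 * (- orient a b q / dist a b)) <= dist a q + dist q b.
Proof.
move=> l0 CS; set l := dist a b in l0 *.
have l2 : l ^+ 2 = (a.1 - b.1) ^+ 2 + (a.2 - b.2) ^+ 2 by exact: dist_sqr.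
have ln0 : l != 0 by rewrite gt_eqF.
pose t : plane R := l^-1 *: (b - a); pose n : plane R := l^-1 *: edge_normal a b.
have t1 : t.1 ^+ 2 + t.2 ^+ 2 = 1.
  rewrite /t !planeE !exprMn -mulrDr [X in _ * X](_ : _ = l ^+ 2); last first.
    by rewrite l2; ring.
  by rewrite -exprMn mulVf// expr1n.
have nE : n = (t.2, - t.1).
  by apply: plane_eq; rewrite /n /t !planeE /=; ring.
apply: le_trans (reflected_path_length a q b t1 (or_intror nE) CS).
rewrite /n /t !dotZl le_eqVlt; apply/orP; left; apply/eqP; congr (_ * _ + _ * _).
  apply: (mulfI ln0); rewrite mulVKf// -expr2 l2 /dot !planeE; ring.
have -> : dot (edge_normal a b) q = dot (edge_normal a b) a - orient a b q.
  by rewrite -dot_edge_normal dotB addrC subrK.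
have -> : dot (edge_normal a b) b = dot (edge_normal a b) a.
  by rewrite /dot /edge_normal /=; ring.
by ring.
Qed.

Lemma six_cases (P : nat -> Prop) :
  P 0%N -> P 1%N -> P 2%N -> P 3%N -> P 4%N -> P 5%N -> forall i, (i < 6)%N -> P i.
Proof. by move=> ? ? ? ? ? ?; case=> [|[|[|[|[|[|//]]]]]]. Qed.

(** Of three among six directions, two pairs of cyclic neighbours are at cyclic
distance at most 2. *)
Lemma ccw_normals_six (v : nat -> plane R) :
  (forall i, (i < 5)%N -> 0 < crs (v i) (v i.+1)) ->
  (forall i, (i < 4)%N -> 0 < crs (v i) (v i.+2)) ->
  [/\ 0 < crs (v 5%N) (v 0%N), 0 < crs (v 4%N) (v 0%N) & 0 < crs (v 5%N) (v 1%N)] ->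
  forall i j k, (i < j)%N -> (j < k)%N -> (k < 6)%N -> ccw_normals (v i) (v j) (v k).
Proof.
move=> gap1 gap2 [g50 g40 g51].
have near i j : (i < j)%N -> (j < 6)%N -> (j <= i + 2)%N -> 0 < crs (v i) (v j).
  move=> ij j6 ji; have [e|e] : j = i.+1 \/ j = i.+2 by lia.
    by rewrite e; apply: gap1; lia.
  by rewrite e; apply: gap2; lia.
have wrap i j : (i < j)%N -> (j < 6)%N -> (i + 6 <= j + 2)%N -> 0 < crs (v j) (v i).
  move=> ij j6 ji; have [[ei ej]|[[ei ej]|[ei ej]]] :
    ((i = 0 /\ j = 5) \/ (i = 0 /\ j = 4) \/ (i = 1 /\ j = 5))%N by lia.
  - by rewrite ei ej.
  - by rewrite ei ej.
  - by rewrite ei ej.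
move=> i j k ij jk k6.
have [d1|d1] := leqP j (i + 2).
  have [d2|d2] := leqP k (j + 2).
    by apply: Or31; split; apply: near => //; lia.
  by apply: Or33; split; [apply: wrap|apply: near]; lia.
by apply: Or32; split; [apply: near|apply: wrap]; lia.
Qed.

(** The t i are the heights of the caps of K beyond the sides of the triangle. The
polygon that visits the tops of the caps consists of three paths, which unfold
to vectors (side, 2 t i); their sum has length at most L. *)
Lemma hexagon_length K (L : R) q1 q2 q3 w1 w2 w3 : compact K ->
  bounds_contact_polygons K L ->
  extreme_contact K w1 q1 -> extreme_contact K w2 q2 -> extreme_contact K w3 q3 ->
  [/\ 0 < crs w1 w2, 0 < crs w2 w3 & 0 < crs w3 w1] ->
  [/\ 0 < dot w1 (q1 - q2), 0 < dot w1 (q1 - q3) & 0 < dot w2 (q2 - q1)] ->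
  [/\ 0 < dot w2 (q2 - q3), 0 < dot w3 (q3 - q1) & 0 < dot w3 (q3 - q2)] ->
  0 < orient q1 q2 q3 ->
  exists t1 t2 t3 : R, [/\ 0 <= t1, 0 <= t2, 0 <= t3,
    forall x, K x -> [/\ - (t3 * dist q1 q2) <= orient q1 q2 x,
      - (t1 * dist q2 q3) <= orient q2 q3 x & - (t2 * dist q3 q1) <= orient q3 q1 x] &
    (dist q1 q2 + dist q2 q3 + dist q3 q1) ^+ 2 + 4 * (t1 + t2 + t3) ^+ 2 <= L ^+ 2].
Proof.
move=> cK KL c1 c2 c3 [w12 w23 w31] [a12 a13 a21] [a23 a31 a32] o.
have K0 : K !=set0 by exists q1; exact: c1.1.
have ne x y w : 0 < dot w (x - y) -> x != y.
  by move=> h; apply: contraTneq h => ->; rewrite subrr /dot !planeE !mulr0 addr0 ltxx.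
have lpos x y : x != y -> 0 < dist x y.
  move=> xy; rewrite sqrtr_gt0 lt_def addr_ge0 ?sqr_ge0// andbT paddr_eq0 ?sqr_ge0//.
  rewrite !sqrf_eq0 !subr_eq0; apply: contra xy => /andP[/eqP e1 /eqP e2].
  exact/eqP/plane_eq.
have l3 := lpos _ _ (ne _ _ _ a12); have l1 := lpos _ _ (ne _ _ _ a23).
have l2 := lpos _ _ (ne _ _ _ a31).
have [r3 cr3] := extreme_contact_exists (edge_normal q1 q2) cK K0.
have [r1 cr1] := extreme_contact_exists (edge_normal q2 q3) cK K0.
have [r2 cr2] := extreme_contact_exists (edge_normal q3 q1) cK K0.
pose v i := nth 0 [:: w1; edge_normal q1 q2; w2; edge_normal q2 q3; w3; edge_normal q3 q1] i.
pose p i := nth 0 [:: q1; r3; q2; r1; q3; r2] i.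
have o2 : 0 < orient q2 q3 q1 by rewrite orient_rot.
have o3 : 0 < orient q3 q1 q2 by rewrite -orient_rot.
have nz u u' : 0 < crs u u' -> nonzero u by move=> /crs_nonzero[].
have gap1 i : (i < 5)%N -> 0 < crs (v i) (v i.+1).
  by case: i => [|[|[|[|[|//]]]]] _; rewrite /v /= ?crs_edge_normalr ?crs_edge_normall.
have gap2 i : (i < 4)%N -> 0 < crs (v i) (v i.+2).
  by case: i => [|[|[|[|//]]]] _; rewrite /v /= ?crs_edge_normals.
have gap5 : 0 < crs (v 5%N) (v 0%N) by rewrite /v /= crs_edge_normall.
have gap40 : 0 < crs (v 4%N) (v 0%N) by [].
have gap51 : 0 < crs (v 5%N) (v 1%N) by rewrite /v /= crs_edge_normals.
have LP : closed_length (mkseq p 6) <= L.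
  apply: (KL _ v).
  - by apply: six_cases.
  - apply: six_cases; [exact: nz (gap1 0%N isT)|exact: nz (gap1 1%N isT)|
      exact: nz (gap1 2%N isT)|exact: nz (gap1 3%N isT)|exact: nz (gap1 4%N isT)|exact: nz gap5].
  - exact: ccw_normals_six.
  - exists 0%N, 2%N, 4%N; split => //; split; [exact: ne a12|exact: ne a23|exact: ne a31].
pose t3 := - orient q1 q2 r3 / dist q1 q2; pose t1 := - orient q2 q3 r1 / dist q2 q3.
pose t2 := - orient q3 q1 r2 / dist q3 q1.
have cap a b r x : extreme_contact K (edge_normal a b) r -> K x -> orient a b r <= orient a b x.
  move=> cr Kx; have := extreme_contact_le cr Kx.
  have e y : dot (edge_normal a b) y = dot (edge_normal a b) a - orient a b y.
    by rewrite -dot_edge_normal dotB addrC subrK.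
  by rewrite (e x) (e r) lerD2l lerN2.
have orient_refl a b : orient a b a = 0 by rewrite /orient; ring.
have cap0 a b r : extreme_contact K (edge_normal a b) r -> K a -> 0 < dist a b ->
    0 <= - orient a b r / dist a b.
  move=> cr Ka l; apply: divr_ge0; last exact: ltW.
  by rewrite oppr_ge0 -(orient_refl a b) cap.
have t30 : 0 <= t3 by exact: cap0 cr3 c1.1 l3.
have t10 : 0 <= t1 by exact: cap0 cr1 c2.1 l1.
have t20 : 0 <= t2 by exact: cap0 cr2 c3.1 l2.
exists t1, t2, t3; split => //.
  move=> x Kx; rewrite /t3 /t1 /t2 !divfK ?gt_eqF// !opprK.
  by split; exact: cap.
set l := _ + _ + _; set s := _ + _ + _.
have l0 : 0 < l by rewrite !addr_gt0.
have s0 : 0 <= s by rewrite !addr_ge0.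
pose M := Num.sqrt (l ^+ 2 + 4 * s ^+ 2).
have M2 : M ^+ 2 = l ^+ 2 + 4 * s ^+ 2 by rewrite sqr_sqrtr// addr_ge0 ?sqr_ge0// mulr_ge0 ?sqr_ge0.
have M0 : 0 < M by rewrite sqrtr_gt0 ltr_pwDl ?exprn_gt0// mulr_ge0 ?sqr_ge0.
have Mn0 : M != 0 by rewrite gt_eqF.
rewrite -M2 lerXn2r ?nnegrE ?(ltW M0)//.
  apply: le_trans LP; rewrite /closed_length /mkseq /=; do ?apply: addr_ge0; rewrite ?dist_ge0//.
apply: le_trans LP.
have CS : (l / M) ^+ 2 + (2 * s / M) ^+ 2 = 1.
  rewrite !expr_div_n -mulrDl exprMn -natrX -M2 divff// expf_neq0//.
have := cap_path_length r3 l3 CS; have := cap_path_length r1 l1 CS.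
have := cap_path_length r2 l2 CS; rewrite -/t1 -/t2 -/t3 => h2 h1 h3.
have ME : M = l / M * l + 2 * s / M * (2 * s).
  by apply: (mulIf Mn0); rewrite -expr2 M2 mulrDl; field.
rewrite {1}ME /closed_length /mkseq /= /p /=.
have re (C S x1 x2 x3 y1 y2 y3 : R) : C * (x3 + x1 + x2) + S * (2 * (y1 + y2 + y3)) =
    C * x3 + S * (2 * y3) + (C * x1 + S * (2 * y1)) + (C * x2 + S * (2 * y2)) by ring.
rewrite (re _ _ (dist q2 q3) (dist q3 q1) (dist q1 q2) t1 t2 t3).
by apply: le_trans (lerD (lerD h3 h1) h2) _; rewrite addr0 !addrA.
Qed.

End triangle_with_caps.

(** * The isoperimetric inequality for triangles, with its defect *)

Section near_equilateral.
Context {R : realType}.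
Implicit Types (K : set (plane R)) (u v w q x y z a b : plane R).
Local Notation c := (Num.sqrt (3 : R)).

Lemma dist_sym x y : dist x y = dist y x.
Proof. by rewrite /dist -sqrrN opprB -[X in _ + X]sqrrN opprB. Qed.

Lemma sqr_le_dists (d X Y : R) : 0 <= X -> 0 <= Y -> d ^+ 2 <= X ^+ 2 * Y ^+ 2 ->
  `|d| <= X * Y.
Proof.
move=> X0 Y0; rewrite -exprMn -[X in X <= _]real_normK ?num_real//.
by rewrite ler_sqr ?nnegrE ?mulr_ge0.
Qed.

Lemma norm_dot_le x y a b : `|dot (x - y) (a - b)| <= dist x y * dist a b.
Proof.
apply: sqr_le_dists; rewrite ?dist_ge0// !dist_sqr -subr_ge0.
rewrite (_ : _ - _ = (crs (x - y) (a - b)) ^+ 2) ?sqr_ge0//.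
by rewrite /dot /crs !planeE; ring.
Qed.

Lemma norm_crs_le x y a b : `|crs (x - y) (a - b)| <= dist x y * dist a b.
Proof.
apply: sqr_le_dists; rewrite ?dist_ge0// !dist_sqr -subr_ge0.
rewrite (_ : _ - _ = (dot (x - y) (a - b)) ^+ 2) ?sqr_ge0//.
by rewrite /dot /crs !planeE; ring.
Qed.

Lemma dist_sub_le a x y : (dist a x - dist a y) ^+ 2 <= dist x y ^+ 2.
Proof.
have := le_trans (ler_norm _) (norm_dot_le a x a y).
have -> : dist x y ^+ 2 = dist a x ^+ 2 + dist a y ^+ 2 - 2 * dot (a - x) (a - y).
  by rewrite !dist_sqr /dot !planeE; ring.
move: (dot _ _) (dist a x) (dist a y) => d X Y; nra.
Qed.

(** The vertex of the counterclockwise equilateral triangle on the side x y. *)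
Definition apex x y : plane R :=
  (x.1 + (y.1 - x.1) / 2 - c / 2 * (y.2 - x.2), x.2 + (y.2 - x.2) / 2 + c / 2 * (y.1 - x.1)).

Lemma dist_apexl x y : dist x (apex x y) = dist x y.
Proof.
rewrite /dist /apex /=; congr Num.sqrt.
transitivity ((1 + c * c) / 4 * ((x.1 - y.1) ^+ 2 + (x.2 - y.2) ^+ 2)); first by field.
by rewrite sqrt3_sqr; field.
Qed.

Lemma dist_apexr x y : dist y (apex x y) = dist x y.
Proof.
rewrite /dist /apex /=; congr Num.sqrt.
transitivity ((1 + c * c) / 4 * ((x.1 - y.1) ^+ 2 + (x.2 - y.2) ^+ 2)); first by field.
by rewrite sqrt3_sqr; field.
Qed.

Lemma orient_apex x y : orient x y (apex x y) = c / 2 * dist x y ^+ 2.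
Proof. by rewrite dist_sqr /orient /apex /=; field. Qed.

(** The defect in the inequality of Weitzenboeck measures the distance to the
equilateral position. *)
Lemma weitzenbock x y z :
  dist x y ^+ 2 + dist y z ^+ 2 + dist z x ^+ 2 =
  2 * c * orient x y z + 2 * dist z (apex x y) ^+ 2.
Proof.
rewrite !dist_sqr /orient /apex /=.
have c2 := @sqrt3_sqr R; apply/eqP; rewrite -subr_eq0; apply/eqP.
transitivity ((3 - c * c) / 2 * ((x.1 - y.1) ^+ 2 + (x.2 - y.2) ^+ 2)); first by field.
by rewrite c2 subrr mul0r mul0r.
Qed.

(** Expanding the square gives three times the sum of the squares of the sides, less
the squares of their differences. The latter are at most a multiple of the square
of the distance from z to the apex, which is smaller than the gain from
[weitzenbock]. *)
Lemma isoperimetric_triangle x y z : 0 < dist x y -> 4 / 3 * dist x y <= dist y z + dist z x ->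
  7 / 4 * dist z (apex x y) ^+ 2 + 6 * c * orient x y z <=
  (dist x y + dist y z + dist z x) ^+ 2.
Proof.
move=> l1 long; have wb := weitzenbock x y z; set a := apex x y in wb *.
have h1 := dist_sub_le y z a; rewrite dist_apexr in h1.
have h2 := dist_sub_le x z a; rewrite dist_apexl (dist_sym x z) in h2.
have h3 := norm_dot_le y x z a; rewrite (dist_sym y x) in h3.
have E : dist y z ^+ 2 - dist z x ^+ 2 = - (2 * dot (y - x) (z - a)).
  by rewrite !dist_sqr /dot /a /apex !planeE /=; field.
have l0 := dist_ge0 x y.
have {E} h4 : (dist y z - dist z x) ^+ 2 * (dist y z + dist z x) ^+ 2 <=
    4 * dist x y ^+ 2 * dist z a ^+ 2.
  have h : dot (y - x) (z - a) ^+ 2 <= (dist x y * dist z a) ^+ 2.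
    by rewrite -[X in X <= _]real_normK ?num_real// lerXn2r ?nnegrE// mulr_ge0 ?dist_ge0.
  rewrite -exprMn -subr_sqr E; move: h; move: (dot _ _) (dist x y) (dist z a) => ? ? ?; nra.
have d0 := dist_ge0 z a; have m0 := dist_ge0 y z; have n0 := dist_ge0 z x.
have h5 : (dist y z - dist z x) ^+ 2 <= 9 / 4 * dist z a ^+ 2.
  have l2 : 16 / 9 * dist x y ^+ 2 <= (dist y z + dist z x) ^+ 2.
    by move: long l0; move: (dist x y) (_ + _) => l m ? ?; nra.
  have l3 : 0 < dist x y ^+ 2 by rewrite exprn_gt0.
  have l4 : (dist y z - dist z x) ^+ 2 * (16 / 9 * dist x y ^+ 2) <=
      4 * dist x y ^+ 2 * dist z a ^+ 2.
    by apply: le_trans h4; rewrite ler_wpM2l ?sqr_ge0.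
  rewrite -(ler_pM2r l3); move: l4.
  move: (_ ^+ 2) (dist x y ^+ 2) (dist z a ^+ 2) => ? ? ?; lra.
rewrite -subr_ge0; move: wb h1 h2 h5.
move: (orient x y z) (dist x y) (dist y z) (dist z x) (dist z a ^+ 2) => o l m n d.
rewrite -(mulrA 2) -(mulrA 6); move: (_ * o) => co; nra.
Qed.

End near_equilateral.

(** * Sandwiches in barycentric coordinates *)

Section sandwich.
Context {R : realType}.
Implicit Types (K : set (plane R)) (u v w q x y z a b d g : plane R).
Local Notation c := (Num.sqrt (3 : R)).
Local Notation W := (@twelfth R).

Lemma orient_sum a b d x : orient a b x + orient b d x + orient d a x = orient a b d.
Proof. by rewrite /orient; ring. Qed.

Lemma barycentric a b d x : orient a b d != 0 ->
  x = (orient b d x / orient a b d) *: a + (orient d a x / orient a b d) *: b +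
      (orient a b x / orient a b d) *: d.
Proof. by move=> o; apply: plane_eq; rewrite !planeE /orient; field. Qed.

Lemma orient_affine a b d x y (r s t : R) : r + s + t = 1 ->
  orient x y (r *: a + s *: b + t *: d) = r * orient x y a + s * orient x y b + t * orient x y d.
Proof. by move=> e; have -> : r = 1 - s - t by [lra|]; rewrite /orient !planeE; ring. Qed.

Lemma segment_closed3 K a b d (r s t : R) : segment_closed K -> K a -> K b -> K d ->
  0 <= r -> 0 <= s -> 0 <= t -> r + s + t = 1 -> K (r *: a + s *: b + t *: d).
Proof.
move=> sK Ka Kb Kd r0 s0 t0 e.
have [t1|t1] := eqVneq t 1.
  have [r00 s00] : r = 0 /\ s = 0 by lra.
  by rewrite r00 s00 t1 !scale0r !add0r scale1r.
have t1' : 0 < 1 - t by rewrite subr_gt0 lt_neqAle t1/=; lra.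
have n : 1 - t != 0 by rewrite gt_eqF.
have h := sK _ _ (r / (1 - t)) Ka Kb (divr_ge0 r0 (ltW t1')).
rewrite ler_pdivrMr// mul1r in h; have {}h := h ltac:(lra).
have := sK _ _ t Kd h t0 ltac:(lra).
congr K; apply: plane_eq; rewrite !planeE.
  have -> : s = 1 - t - r by lra.
  by field.
have -> : s = 1 - t - r by lra.
by field.
Qed.

Lemma regular_homothety a b d g (k : R) : 0 < k -> regular a b d ->
  regular (g + k *: (a - g)) (g + k *: (b - g)) (g + k *: (d - g)).
Proof.
move=> k0 [d0 e1 e2].
have E x y : dist (g + k *: (x - g)) (g + k *: (y - g)) = k * dist x y.
  rewrite /dist -[X in X * _](gtr0_norm k0) -sqrtr_sqr -sqrtrM ?sqr_ge0//; congr Num.sqrt.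
  by rewrite !planeE; ring.
by split; rewrite ?E; [rewrite mulr_gt0|rewrite e1|rewrite e2].
Qed.

(** The homothetic copies of a triangle about its centroid are the sets
where the barycentric coordinates are bounded below by a constant. *)
Lemma triangle_sandwich_barycentric K a b d (k m rho : R) : 0 < k -> regular a b d ->
  (forall r s t : R, (1 - k) / 3 <= r -> (1 - k) / 3 <= s -> (1 - k) / 3 <= t ->
    r + s + t = 1 -> K (r *: a + s *: b + t *: d)) ->
  (forall x, K x -> exists r s t : R, [/\ - m <= r, - m <= s, - m <= t, r + s + t = 1 &
    x = r *: a + s *: b + t *: d]) ->
  0 <= rho -> 1 + 3 * m <= (1 + rho) * k -> triangle_sandwich K rho.
Proof.
move=> k0 reg inner outer rho0 km; pose g := centroid a b d.
pose h x := g + k *: (x - g).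
have gE : centroid (h a) (h b) (h d) = g.
  by apply: plane_eq; rewrite /h /g /centroid !planeE; field.
exists (h a), (h b), (h d) => /=; rewrite gE; split; first exact: regular_homothety.
- move=> _ [_ [r [s [t [r0 s0 t0 e ->]]]] <-].
  exists (r *: h a + s *: h b + t *: h d) => //.
  rewrite (_ : _ + _ = (k * r + (1 - k) / 3) *: a + (k * s + (1 - k) / 3) *: b +
      (k * t + (1 - k) / 3) *: d); last first.
    have tE : t = 1 - r - s by lra.
    by apply: plane_eq; rewrite /h /g /centroid !planeE tE; field.
  by apply: inner; rewrite ?lerDr ?mulr_ge0 ?(ltW k0)//; rewrite addrACA; nra.
- move=> _ [x Kx <-]; have [r [s [t [rm sm tm e ->]]]] := outer x Kx.
  have l0 : 0 < (1 + rho) * k by rewrite mulr_gt0//; lra.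
  pose f (y : R) := 3^-1 + (y - 3^-1) / ((1 + rho) * k).
  have f0 (y : R) : - m <= y -> 0 <= f y.
    move=> ym; rewrite -(pmulr_lge0 _ l0) /f mulrDl divfK ?gt_eqF//; lra.
  have fe : f r + f s + f t = 1.
    have -> : t = 1 - r - s by lra.
    rewrite /f -!addrA; field; rewrite !gt_eqF//; lra.
  exists (f r *: h a + f s *: h b + f t *: h d - g); first last.
    have tE : t = 1 - r - s by lra.
    by apply: plane_eq; rewrite /h /g /centroid !planeE /f tE; field; rewrite !gt_eqF//; lra.
  exists (f r *: h a + f s *: h b + f t *: h d) => //.
  by exists (f r), (f s), (f t); split => //; exact: f0.
Qed.

End sandwich.

(** * From the triangle of contact points to the sandwich *)

Section stability.
Context {R : realType}.
Implicit Types (K : set (plane R)) (u v w q x y z a b d g : plane R).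
Local Notation c := (Num.sqrt (3 : R)).
Local Notation W := (@twelfth R).

Lemma near_standard_dist K (rho : R) x y : rho <= 35^-1 -> near_standard K rho ->
  K x -> K y -> dist x y <= 5.
Proof.
move=> r35 [_ _ _ KT] Kx Ky; have c2 := @sqrt3_sqr R; have [c1 c1'] := @sqrt3_bounds R.
have box z : K z -> [/\ - (9 / 5) <= z.1, z.1 <= 9 / 5, - (36 / 35) <= z.2 & z.2 <= 72 / 35].
  move=> Kz; have := KT _ Kz; rewrite /dot /twelfth /= => -[].
  move: c c1 c1' {c2} z.1 z.2 => k ? ? s t ? ? ?; split; nra.
have [x1 x2 x3 x4] := box _ Kx; have [y1 y2 y3 y4] := box _ Ky.
rewrite -(@ler_pXn2r _ 2)// ?nnegrE ?dist_ge0// dist_sqr.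
have h (s m : R) : - m <= s -> s <= m -> s ^+ 2 <= m ^+ 2.
  by move=> ? ?; rewrite -[s ^+ 2]real_normK ?num_real// lerXn2r ?nnegrE// ?ler_norml; lra.
have := h (x.1 - y.1) (18 / 5) ltac:(lra) ltac:(lra).
have := h (x.2 - y.2) (16 / 5) ltac:(lra) ltac:(lra).
move: ((x.1 - y.1) ^+ 2) ((x.2 - y.2) ^+ 2) => *; lra.
Qed.

(** A triangle close to an equilateral one, with small caps of K beyond its
sides: the equilateral triangle on its side q1 q2, shrunk a little, lies in K,
and stretched a little contains K. *)
Lemma sandwich_of_near_equilateral K q1 q2 q3 (s : R) : segment_closed K ->
  K q1 -> K q2 -> K q3 -> (forall x y, K x -> K y -> dist x y <= 5) ->
  24 / 7 <= dist q1 q2 -> 0 < orient q1 q2 q3 -> 0 <= s -> s <= 80^-1 ->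
  dist q3 (apex q1 q2) <= 16 * s ->
  (forall x, K x -> [/\ - (50 * s) <= orient q1 q2 x,
    - (50 * s) <= orient q2 q3 x & - (50 * s) <= orient q3 q1 x]) ->
  triangle_sandwich K (400 * s).
Proof.
move=> sK K1 K2 K3 diam l3 o s0 s1 es caps.
set a := apex q1 q2 in es.
have a1 : dist a q1 = dist q1 q2 by rewrite (dist_sym a) dist_apexl.
have a2 : dist a q2 = dist q1 q2 by rewrite (dist_sym a) dist_apexr.
have [c1 _] := @sqrt3_bounds R; have l5 := diam _ _ K1 K2.
pose D := orient q1 q2 a.
have D10 : 10 <= D.
  rewrite /D orient_apex.
  have : (24 / 7) ^+ 2 <= dist q1 q2 ^+ 2 by rewrite lerXn2r ?nnegrE//; lra.
  move: (dist _ _ ^+ 2) c1; move: (Num.sqrt 3) => k m; nra.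
have Dn0 : D != 0 by rewrite gt_eqF//; lra.
have e0 := dist_ge0 q3 a.
have crs_small x y : dist x y <= 5 -> `|crs (q3 - a) (x - y)| <= 80 * s.
  move=> xy; apply: le_trans (norm_crs_le _ _ _ _) _.
  rewrite (_ : 80 * s = 16 * s * 5); last by ring.
  by apply: ler_pM; rewrite ?dist_ge0.
have o23 x : orient q2 q3 x = orient q2 a x + crs (q3 - a) (x - q2).
  by rewrite /orient /crs !planeE; ring.
have o31 x : orient q3 q1 x = orient a q1 x - crs (q3 - a) (x - q1).
  by rewrite /orient /crs !planeE; ring.
apply: (@triangle_sandwich_barycentric _ K q1 q2 a (1 - 60 * s) (13 * s)).
- lra.
- split; rewrite ?(dist_sym q2 a) ?a2 ?a1 //; lra.
- move=> r t u; rewrite (_ : (1 - (1 - 60 * s)) / 3 = 20 * s); last by field.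
  move=> rs ts us rtu; set x := _ + _ + _.
  have x2 : crs (q3 - a) (x - q2) = r * crs (q3 - a) (q1 - q2) + u * crs (q3 - a) (a - q2).
    have tE : t = 1 - r - u by lra.
    by rewrite /crs /x !planeE tE; ring.
  have x1 : crs (q3 - a) (x - q1) = t * crs (q3 - a) (q2 - q1) + u * crs (q3 - a) (a - q1).
    have tE : r = 1 - t - u by lra.
    by rewrite /crs /x !planeE tE; ring.
  have b12 : orient q1 q2 x = u * D.
    by rewrite orient_affine// /D /orient; ring.
  have b2a : orient q2 a x = r * D by rewrite orient_affine// /D /orient; ring.
  have ba1 : orient a q1 x = t * D by rewrite orient_affine// /D /orient; ring.
  have on := gt_eqF o.
  rewrite (barycentric x (negbT on)); apply: segment_closed3 => //.
  + apply: divr_ge0; last exact: ltW.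
    rewrite o23 b2a x2.
    have := crs_small q1 q2 l5; have := crs_small a q2.
    rewrite a2 => /(_ l5).
    move: (crs _ _) (crs _ _) => Y X; rewrite !ler_norml => /andP[? _] /andP[? _].
    have ? : u * - (80 * s) <= u * X by apply: ler_wpM2l => //; lra.
    have ? : r * - (80 * s) <= r * Y by apply: ler_wpM2l => //; lra.
    have ? : 10 * r <= r * D by rewrite mulrC ler_wpM2l//; lra.
    have : (r + u) * (80 * s) <= 1 * (80 * s) by apply: ler_wpM2r; lra.
    lra.
  + apply: divr_ge0; last exact: ltW.
    rewrite o31 ba1 x1.
    have := crs_small q2 q1; rewrite (dist_sym q2) => /(_ l5); have := crs_small a q1.
    rewrite a1 => /(_ l5).
    move: (crs _ _) (crs _ _) => Y X; rewrite !ler_norml => /andP[_ ?] /andP[_ ?].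
    have ? : u * X <= u * (80 * s) by apply: ler_wpM2l => //; lra.
    have ? : t * Y <= t * (80 * s) by apply: ler_wpM2l => //; lra.
    have ? : 10 * t <= t * D by rewrite mulrC ler_wpM2l//; lra.
    have : (t + u) * (80 * s) <= 1 * (80 * s) by apply: ler_wpM2r; lra.
    lra.
  + by apply: divr_ge0; [rewrite b12 mulr_ge0//; lra|exact: ltW].
  + rewrite -!mulrDl (_ : _ + _ + _ = orient q1 q2 q3) ?divff ?on//.
    by rewrite -(orient_sum q1 q2 q3 x); ring.
- move=> x Kx; have [h12 h23 h31] := caps x Kx.
  have low (y : R) : - (130 * s) <= y -> - (13 * s) <= y / D.
    move=> ys; rewrite ler_pdivlMr; last lra.
    apply: le_trans ys; nra.
  have /ler_normlP[f1 f2] := crs_small x q2 (diam _ _ Kx K2).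
  have /ler_normlP[g1 g2] := crs_small x q1 (diam _ _ Kx K1).
  exists (orient q2 a x / D), (orient a q1 x / D), (orient q1 q2 x / D); split.
  + by apply: low; move: h23; rewrite o23; lra.
  + by apply: low; move: h31; rewrite o31; lra.
  + by apply: low; lra.
  + rewrite -!mulrDl (_ : _ + _ + _ = D) ?divff//.
    by rewrite /D -(orient_sum q1 q2 a x); ring.
  + exact: barycentric.
- lra.
- move: s0 s1; nra.
Qed.

End stability.

Section normalized_stability.
Context {R : realType}.
Implicit Types (K : set (plane R)) (u v w q x y z a b d g : plane R).
Local Notation c := (Num.sqrt (3 : R)).
Local Notation W := (@twelfth R).

Lemma root_le_inv (s m : R) : 0 <= s -> 0 < m -> s ^+ 2 <= m ^- 2 -> s <= m^-1.
Proof.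
by move=> s0 m0; rewrite -exprVn ler_sqr ?nnegrE// invr_ge0 ltW.
Qed.

Lemma deviations_le (S d t X L2 s : R) : 0 <= s -> 0 <= d -> 0 <= t ->
  7 / 4 * d ^+ 2 + X <= S ^+ 2 -> S ^+ 2 + 4 * t ^+ 2 <= L2 -> L2 <= X + 400 * s ^+ 2 ->
  d <= 16 * s /\ t <= 10 * s.
Proof. by move=> s0 d0 t0 h1 h2 h3; split; nra. Qed.

(** The normal of the side between two corners is the sum of the directions of the
corners: a point of K far out in one of these directions is not far out in the
other. *)
Lemma corners_apart K (rho : R) k a b : rho <= 35^-1 -> near_standard K rho -> K a -> K b ->
  2 <= dot (W (3 + 4 * k)) a -> 2 <= dot (W (3 + 4 * k + 4)) b ->
  0 < dot (W (3 + 4 * k)) (a - b) /\ 0 < dot (W (3 + 4 * k + 4)) (b - a).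
Proof.
move=> r35 KT Ka Kb.
have := near_standard_side k.+1 KT Ka; have := near_standard_side k.+1 KT Kb.
have e : (1 + 4 * k.+1 = 3 + 4 * k + 2)%N by clear; lia.
rewrite e (dot_sum4 _ a) (dot_sum4 _ b) !dotB; clear -r35.
move: (dot (W (3 + 4 * k)) a) (dot (W (3 + 4 * k)) b) => ? ?.
by move: (dot _ a) (dot _ b) => ? ? ? ? ? ?; lra.
Qed.

(** The three contact points at the corners of K span a nearly equilateral
triangle: the perimeter has to pay for their distance from the equilateral
position, and for the caps of K beyond the sides of the triangle. *)
Lemma near_standard_stability K (rho L A eps : R) : compact K -> segment_closed K ->
  rho <= 35^-1 -> 0 <= eps -> eps <= (6 * 180) ^- 2 -> near_standard K rho ->
  bounds_contact_polygons K L -> bounded_by_hexagons K A ->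
  L ^+ 2 <= (1 + eps) * (6 * c * A) -> triangle_sandwich K (400 * Num.sqrt eps).
Proof.
move=> cK sK r35 e0 e1 KT KL KA LA.
have K0 : K !=set0 by case: KT => V3 _ _ _; exists (2 *: W 3).
have [p [p12 pK]] := exists_contacts cK K0.
have [h3 h7 h11 LD] := perimeter_le_triangle r35 e0 e1 KT p12 pK KL KA LA.
have Kp k : K (p k) := (pK k).1.
have [m2 m4] := corner_bounds (k := 0) r35 KT (Kp 3%N) h3.
have [m6 m8] := corner_bounds (k := 1) r35 KT (Kp 7%N) h7.
have [m10 m0] := corner_bounds (k := 2) r35 KT (Kp 11%N) h11.
set q1 := p 3%N in h3 LD m2 m4; set q2 := p 7%N in h7 LD m6 m8.
set q3 := p 11%N in h11 LD m10 m0.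
have diam := near_standard_dist r35 KT.
have side k a b : mid_range (dot (W k) a) -> mid_range (dot (W (k + 6)) b) ->
    24 / 7 <= dist a b.
  move=> /andP[ha _] /andP[hb _].
  have := @dot_le_dist _ (W (k + 6)) a b; rewrite twelfth_unit lexx => /(_ isT).
  by rewrite dotB; have := dot_opp6 k a; lra.
have l3 : 24 / 7 <= dist q1 q2 by exact: (side 2%N).
have l1 : 24 / 7 <= dist q2 q3 by apply: (side 6%N) => //; rewrite twelfth_period.
have l2 : 24 / 7 <= dist q3 q1 by apply: (side 10%N) => //; rewrite (twelfth_period 4).
have o : 0 < orient q1 q2 q3.
  have [] := @hexform6_range R _ _ _ _ _ _ (And4 m0 m2 m4 (And3 m6 m8 m10)).
  rewrite hexform6_triangle => h _; have [c1 _] := @sqrt3_bounds R; nra.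
have [a12 a21] := corners_apart (k := 0) r35 KT (Kp 3%N) (Kp 7%N) h3 h7.
have [a23 a32] := corners_apart (k := 1) r35 KT (Kp 7%N) (Kp 11%N) h7 h11.
have W15 : W 15 = W 3 := twelfth_period 3.
have [a31 a13] := corners_apart (k := 2) r35 KT (Kp 11%N) (Kp 3%N) h11 (eq_ind_r (fun w => 2 <= dot w q1) h3 W15).
rewrite -[(3 + 4 * 2 + 4)%N]/15%N W15 in a13.
have crs3 : 0 < crs (W 11) (W 3) by rewrite -W15; exact: (@crs_twelfth R 11 4).
have [t1 [t2 [t3 [t10 t20 t30 caps SL]]]] := hexagon_length cK KL (pK 3%N) (pK 7%N) (pK 11%N)
  (And3 (@crs_twelfth R 3 4 isT) (@crs_twelfth R 7 4 isT) crs3)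
  (And3 a12 a13 a21) (And3 a23 a31 a32) o.
rewrite -/q1 -/q2 -/q3 in caps SL.
have diams : [/\ dist q1 q2 <= 5, dist q2 q3 <= 5 & dist q3 q1 <= 5].
  by split; apply: diam; exact: Kp.
have [d12 d23 d31] := diams.
set s := Num.sqrt eps.
have s0 : 0 <= s by exact: sqrtr_ge0.
have s2 : s ^+ 2 = eps by rewrite sqr_sqrtr.
have s1 : s <= 80^-1.
  have m1080 : 0 < 6 * 180 :> R by apply: mulr_gt0; rewrite ltr0n.
  rewrite -s2 in e1; apply: le_trans (root_le_inv s0 m1080 e1) _.
  rewrite lef_pV2 ?posrE//; lra.
rewrite -s2 in LD.
have iso := isoperimetric_triangle (x := q1) (y := q2) (z := q3) ltac:(lra) ltac:(lra).
have [es ts] := deviations_le s0 (dist_ge0 q3 (apex q1 q2)) (addr_ge0 (addr_ge0 t10 t20) t30)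
  iso SL LD.
apply: (@sandwich_of_near_equilateral _ K q1 q2 q3) => //; try exact: Kp.
move=> x /caps[c3 c1 c2].
have small (t l : R) : 0 <= t -> 0 <= l -> t <= 10 * s -> l <= 5 -> - (50 * s) <= - (t * l).
  move=> t0 l0 ts' l5; rewrite lerN2 (_ : 50 * s = 10 * s * 5); last by ring.
  exact: ler_pM.
by split; [apply: le_trans c3|apply: le_trans c1|apply: le_trans c2];
  apply: small; rewrite ?dist_ge0//; lra.
Qed.

End normalized_stability.

(** * Similarities *)

Section similarity.
Context {R : realType}.
Implicit Types (K : set (plane R)) (u v w x y z a b d g l : plane R).
Local Notation c := (Num.sqrt (3 : R)).
Local Notation W := (@twelfth R).

(** Multiplication of complex numbers. *)
Definition cmul l x : plane R := (l.1 * x.1 - l.2 * x.2, l.2 * x.1 + l.1 * x.2).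

Definition similarity l z x : plane R := z + cmul l x.

Definition sqr_ratio l : R := l.1 ^+ 2 + l.2 ^+ 2.

Definition unsimilarity l z x : plane R := (sqr_ratio l)^-1 *: cmul (l.1, - l.2) (x - z).

Lemma similarityK l z x : sqr_ratio l != 0 -> similarity l z (unsimilarity l z x) = x.
Proof.
by move=> l0; apply: plane_eq; rewrite /similarity /unsimilarity /cmul !planeE /=;
  move: l0; rewrite /sqr_ratio => l0; field.
Qed.

Lemma unsimilarityK l z x : sqr_ratio l != 0 -> unsimilarity l z (similarity l z x) = x.
Proof.
by move=> l0; apply: plane_eq; rewrite /similarity /unsimilarity /cmul !planeE /=;
  move: l0; rewrite /sqr_ratio => l0; field.
Qed.

Lemma dot_cmul l v w : dot (cmul l v) (cmul l w) = sqr_ratio l * dot v w.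
Proof. by rewrite /dot /cmul /sqr_ratio /=; ring. Qed.

Lemma crs_cmul l v w : crs (cmul l v) (cmul l w) = sqr_ratio l * crs v w.
Proof. by rewrite /crs /cmul /sqr_ratio /=; ring. Qed.

Lemma dot_similarity l z v x : dot (cmul l v) (similarity l z x) =
  dot (cmul l v) z + sqr_ratio l * dot v x.
Proof. by rewrite dotD dot_cmul. Qed.

Lemma crs_similarity l z v x : crs (cmul l v) (similarity l z x) =
  crs (cmul l v) z + sqr_ratio l * crs v x.
Proof. by rewrite -crs_cmul /crs /similarity !planeE; ring. Qed.

Lemma dist_similarity l z x y :
  dist (similarity l z x) (similarity l z y) = Num.sqrt (sqr_ratio l) * dist x y.
Proof.
rewrite /dist -sqrtrM; last by rewrite addr_ge0 ?sqr_ge0.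
by congr Num.sqrt; rewrite /similarity /cmul /sqr_ratio !planeE /=; ring.
Qed.

Lemma similarity_affine l z a b d (r s t : R) : r + s + t = 1 ->
  similarity l z (r *: a + s *: b + t *: d) =
  r *: similarity l z a + s *: similarity l z b + t *: similarity l z d.
Proof.
move=> e; have -> : t = 1 - r - s by lra.
by apply: plane_eq; rewrite /similarity /cmul !planeE /=; ring.
Qed.

Lemma closed_length_similarity l z s : closed_length (map (similarity l z) s) =
  Num.sqrt (sqr_ratio l) * closed_length s.
Proof.
case: s => [|x s] /=; first by rewrite mulr0.
rewrite -map_rcons; elim: (rcons s x) {1 3}x => [|y s' IH] x' /=; first by rewrite mulr0.
by rewrite mulrDr IH dist_similarity.
Qed.

Section preimage.
Context (K : set (plane R)) (l z : plane R) (l0 : 0 < sqr_ratio l).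
Let N := sqr_ratio l.
Let K' := similarity l z @^-1` K.
Let ln0 : sqr_ratio l != 0 := lt0r_neq0 l0.

Lemma compact_similarity : compact K -> compact K'.
Proof.
move=> cK; rewrite (_ : K' = unsimilarity l z @` K); last first.
  apply/seteqP; split=> [x Kx|_ [x Kx <-]]; last by rewrite /K' /preimage /mkset similarityK.
  by exists (similarity l z x) => //; rewrite unsimilarityK.
apply: continuous_compact => //; apply: continuous_subspaceT => x.
have -> : unsimilarity l z = fun y =>
    (dot (N^-1 *: l) y - dot (N^-1 *: l) z, dot (N^-1 *: (- l.2, l.1)) y - dot (N^-1 *: (- l.2, l.1)) z).
  by apply/funext => y; apply: plane_eq;
    rewrite /unsimilarity /cmul /N /dot !planeE /=; ring.
have dc (u : plane R) (m : R) : (fun y : plane R => dot u y - m) @ x --> dot u x - m.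
  by apply: cvgB; [exact: dot_continuous|exact: cvg_cst].
exact: (cvg_pair (dc _ _) (dc _ _)).
Qed.

Lemma segment_closed_similarity : segment_closed K -> segment_closed K'.
Proof.
move=> sK x y t Kx Ky t0 t1; have := sK _ _ t Kx Ky t0 t1.
rewrite /K' /preimage /mkset; congr K.
by apply: plane_eq; rewrite /similarity /cmul !planeE /=; ring.
Qed.

Lemma extreme_contact_similarity v x : extreme_contact K' v x ->
  extreme_contact K (cmul l v) (similarity l z x).
Proof.
move=> [Kx H]; split=> // k Kk.
have Kk' : K' (unsimilarity l z k) by rewrite /K' /preimage /mkset similarityK.
rewrite -(similarityK z k ln0) !dot_similarity !crs_similarity.
rewrite ltrD2l lerD2l ltr_pM2l// ler_pM2l//.
by case: (H _ Kk') => [|[-> ?]]; [left|right].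
Qed.

Lemma bounds_contact_polygons_similarity (P : R) : bounds_contact_polygons K P ->
  bounds_contact_polygons K' (P / Num.sqrt N).
Proof.
move=> KP n v p pK v0 cv [i [j [k [ni nj nk [ij jk ki]]]]].
have s0 : 0 < Num.sqrt N by rewrite sqrtr_gt0.
have inj x y : x != y -> similarity l z x != similarity l z y.
  by apply: contra_neq => e; rewrite -(unsimilarityK z x ln0) e unsimilarityK.
rewrite ler_pdivlMr// mulrC.
rewrite -(closed_length_similarity l z) -map_comp.
apply: (KP n (fun i => cmul l (v i))).
- by move=> m mn; apply: extreme_contact_similarity; exact: pK.
- move=> m /v0; rewrite /nonzero -!negb_and; apply: contra => /andP[/eqP e1 /eqP e2].
  have : dot (cmul l (v m)) (cmul l (v m)) = 0 by rewrite /dot e1 e2 !mulr0 addr0.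
  move=> /eqP; rewrite dot_cmul mulf_eq0 (negbTE ln0) /= /dot -!expr2.
  by rewrite paddr_eq0 ?sqr_ge0// !sqrf_eq0.
- move=> a b d ab bd dn; rewrite /ccw_normals !crs_cmul !pmulr_rgt0//.
  exact: cv ab bd dn.
- by exists i, j, k; split => //; split; exact: inj.
Qed.

Lemma bounded_by_hexagons_similarity (A : R) : bounded_by_hexagons K A ->
  bounded_by_hexagons K' (A / N).
Proof.
move=> KA v w t vw [t6 tK].
have hexE i : hexdir (cmul l v) (cmul l w) i = cmul l (hexdir v w i).
  rewrite /hexdir; have : (i %% 6 < 6)%N by rewrite ltn_mod.
  by case: (i %% 6)%N => [|[|[|[|[|[|//]]]]]] _ //=;
    apply: plane_eq; rewrite /cmul !planeE /=; ring.
have vw' : crs (cmul l v) (cmul l w) != 0 by rewrite crs_cmul mulf_neq0.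
have := KA _ _ (fun i => similarity l z (t i)) vw'.
rewrite crs_cmul normrM (gtr0_norm l0) => h.
rewrite mulrA ler_pdivrMr// -(ler_pM2l l0) mulrA.
apply: le_trans (h _) _; last first.
  have sE i : supp (cmul l v) (cmul l w) (fun i => similarity l z (t i)) i =
      dot (cmul l (hexdir v w i)) z + N * supp v w t i.
    by rewrite /supp hexE dot_similarity.
  rewrite /hexform !sE; move: (supp v w t) => h'; rewrite le_eqVlt; apply/orP; left.
  by apply/eqP; rewrite /hexdir /dot /cmul /N /= ?planeE; ring.
split=> [i|i]; first by rewrite t6.
have [Kt H] := tK i; split=> // s Ks.
rewrite hexE -(similarityK z s ln0) !dot_similarity lerD2l ler_pM2l//.
by apply: H; rewrite /K' /preimage /mkset similarityK.
Qed.

Lemma triangle_sandwich_similarity (rho : R) : triangle_sandwich K' rho ->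
  triangle_sandwich K rho.
Proof.
move=> [a [b [d /= [[ab e1 e2] TK KT]]]].
have s0 : 0 < Num.sqrt (sqr_ratio l) by rewrite sqrtr_gt0.
set g := similarity l z.
have cE : centroid (g a) (g b) (g d) = g (centroid a b d).
  by apply: plane_eq; rewrite /centroid /g /similarity /cmul !planeE /=; field.
have tE x : triangle a b d x -> triangle (g a) (g b) (g d) (g x).
  move=> [r [s [t [r0 s0' t0 e ->]]]]; exists r, s, t; split => //.
  by rewrite /g similarity_affine.
exists (g a), (g b), (g d) => /=; rewrite cE; split.
- by split; rewrite /g !dist_similarity; [exact: mulr_gt0|rewrite e1|rewrite e2].
- move=> _ [_ [r [s [t [r0 s0' t0 e ->]]]] <-].
  exists (r *: g a + s *: g b + t *: g d) => //.
  have /TK[k Kk /addIr kE] : translate_by (triangle a b d) (centroid a b d)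
      (r *: a + s *: b + t *: d - centroid a b d).
    by exists (r *: a + s *: b + t *: d) => //; exists r, s, t.
  rewrite /g -similarity_affine// -kE; exact: Kk.
- move=> _ [x Kx <-].
  have /KT[_ [y Ty <-]] : translate_by K' (centroid a b d) (unsimilarity l z x - centroid a b d).
    by exists (unsimilarity l z x) => //; rewrite /K' /preimage /mkset similarityK.
  move=> E; exists (g y - g (centroid a b d)); first by exists (g y) => //; exact: tE.
  have xE : unsimilarity l z x = centroid a b d + (1 + rho) *: (y - centroid a b d).
    by rewrite E addrC subrK.
  rewrite -(similarityK z x ln0) xE.
  by apply: plane_eq; rewrite /g /similarity /cmul !planeE /=; ring.
Qed.

End preimage.

End similarity.

(** * Normalization, and the theorem *)

Section normalization.
Context {R : realType}.
Implicit Types (K : set (plane R)) (u v w x y z a b d g l : plane R).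
Local Notation c := (Num.sqrt (3 : R)).
Local Notation W := (@twelfth R).

Lemma dist_eq0 x y : dist x y = 0 -> x = y.
Proof.
move=> h; have := dist_sqr x y; rewrite h expr0n /= => /esym/eqP.
rewrite paddr_eq0 ?sqr_ge0// !sqrf_eq0 !subr_eq0 => /andP[/eqP e1 /eqP e2].
exact: plane_eq.
Qed.

(** The dot product of two sides is half the square of the side, so by
Lagrange's identity orient a b d is plus or minus c / 2 times that square. *)
Lemma regular_apex a b d : regular a b d -> 0 <= orient a b d -> d = apex a b.
Proof.
move=> [ab e1 e2] o; have wb := weitzenbock a b d.
rewrite -e2 -e1 in wb.
have o2 : orient a b d ^+ 2 = 3 / 4 * (dist a b ^+ 2) ^+ 2.
  have p : orient a b d ^+ 2 =
      dist a b ^+ 2 * dist d a ^+ 2 - ((dist a b ^+ 2 + dist d a ^+ 2 - dist b d ^+ 2) / 2) ^+ 2.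
    by rewrite !dist_sqr /orient; field.
  by rewrite p -e2 -e1; field.
have c0 : 0 <= c by exact: sqrtr_ge0.
have oE : orient a b d = c / 2 * dist a b ^+ 2.
  apply/eqP; rewrite -(@eqrXn2 _ 2)// ?o2 ?mulr_ge0 ?exprn_ge0 ?divr_ge0 ?dist_ge0//.
  have -> : (c / 2 * dist a b ^+ 2) ^+ 2 = c * c / 4 * (dist a b ^+ 2) ^+ 2 by field.
  by rewrite sqrt3_sqr.
apply: dist_eq0; apply/eqP; rewrite -sqrf_eq0; apply/eqP.
move: wb; rewrite oE.
rewrite (_ : 2 * c * (c / 2 * dist a b ^+ 2) = c * c * dist a b ^+ 2); last by field.
rewrite sqrt3_sqr; move: (_ ^+ 2) (dist d _ ^+ 2) => *; lra.
Qed.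

Lemma triangle_swap a b d : triangle a d b `<=` triangle a b d.
Proof.
move=> x [r [s [t [r0 s0 t0 e ->]]]]; exists r, t, s; split => //.
  by rewrite addrAC.
by rewrite addrAC.
Qed.

(** After exchanging two vertices the triangle is counterclockwise. With complex
numbers, the similarity is x |-> z + l x where 2 i l = a - z. *)
Lemma near_standard_exists K (rho : R) : 0 <= rho -> triangle_sandwich K rho ->
  exists l z, 0 < sqr_ratio l /\ near_standard (similarity l z @^-1` K) rho.
Proof.
move=> rho0 [a [b [d /=]]].
wlog o : b d / 0 <= orient a b d.
  move=> H h; have [pos|neg] := leP 0 (orient a b d); first exact: H h.
  apply: (H d b); first by rewrite orient_swapr oppr_ge0 ltW.
  have zE : centroid a d b = centroid a b d by rewrite /centroid addrAC.
  have tE : triangle a d b = triangle a b d by apply/seteqP; split; exact: triangle_swap.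
  case: h => -[ab e1 e2] TK KT; rewrite zE tE; split => //.
  by split; rewrite !(dist_sym a d, dist_sym d b, dist_sym b a) -?e2 -?e1.
move=> [reg TK KT]; have dE := regular_apex reg o.
have [ab _ _] := reg.
set z := centroid a b d in TK KT.
pose l : plane R := ((a - z).2 / 2, - (a - z).1 / 2).
have c2 := @sqrt3_sqr R; have ct (t : R) : c * (c * t) = 3 * t by rewrite mulrA c2.
have aE : similarity l z (2 *: W 3) = a.
  by apply: plane_eq; rewrite /similarity /cmul /l /twelfth !planeE /=; field.
have vE : similarity l z (2 *: W 7) = b /\ similarity l z (2 *: W 11) = d.
  have := ct a.1; have := ct a.2; have := ct b.1; have := ct b.2.
  split; apply: plane_eq; rewrite /similarity /cmul /l /z /centroid dE /apex /twelfth !planeE /=; lra.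
have [bE dE'] := vE.
have l0 : 0 < sqr_ratio l.
  rewrite lt_def addr_ge0 ?sqr_ge0// andbT; apply/eqP => l00.
  have := dist_similarity l z (2 *: W 3) (2 *: W 7).
  by rewrite l00 sqrtr0 mul0r aE bE => h; move: ab; rewrite h ltxx.
exists l, z; split=> //.
have TinK x : triangle a b d x -> K x.
  by move=> Tx; have /TK[k Kk /addIr <-] : translate_by (triangle a b d) z (x - z) by exists x.
split; rewrite /preimage /mkset.
- rewrite aE; apply: TinK; exists 1, 0, 0; split => //; first by ring.
  by rewrite scale1r !scale0r !addr0.
- rewrite bE; apply: TinK; exists 0, 1, 0; split => //; first by ring.
  by rewrite scale1r !scale0r add0r addr0.
- rewrite dE'; apply: TinK; exists 0, 0, 1; split => //; first by ring.
  by rewrite scale1r !scale0r !add0r.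
move=> x Kx; have /KT[_ [y [r [s [t [r0 s0 t0 e ->]]]] <-]] :
  translate_by K z (similarity l z x - z) by exists (similarity l z x).
rewrite -{1}aE -{1}bE -{1}dE' -similarity_affine// /similarity !(addrC z) !addrK => xE.
have h k : dot (W k) x = (1 + rho) *
    dot (W k) (r *: (2 *: W 3) + s *: (2 *: W 7) + t *: (2 *: W 11)).
  apply: (mulfI (lt0r_neq0 l0)).
  by rewrite -dot_cmul -xE dotZ dot_cmul mulrCA.
have e1 : 0 <= 1 + rho by lra.
have tE : t = 1 - r - s by lra.
split; rewrite h -[X in _ <= X]mulr1; apply: ler_wpM2l => //;
  rewrite /dot /twelfth !planeE /= tE; move: (ct r) (ct s) (ct 1); lra.
Qed.

(** An infinite perimeter has an infinite square. *)
Lemma finite_perimeter K (X : R) : (perimeter K ^+ 2 <= X%:E)%E ->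
  exists2 P : R, perimeter K = P%:E & P ^+ 2 <= X.
Proof.
have P0 : (0 <= perimeter K)%E.
  apply: ereal_sup_ubound; exists 0%N, (fun i : 'I_0 => 0); split.
    by split=> [[]|[]].
  by rewrite /polygon_length big_ord0.
case: (perimeter K) P0 => [P| |]// _; rewrite expe2; first by rewrite -EFinM lee_fin; exists P.
Qed.

End normalization.

Section stability_theorem.
Context {R : realType}.
Implicit Types (K : set (plane R)).

Lemma sandwich_improved K (rho eps : R) : convex_domain K ->
  0 <= rho -> rho <= 35^-1 -> triangle_sandwich K rho ->
  0 <= eps -> eps <= (6 * 180) ^- 2 ->
  (perimeter K ^+ 2 <=
    ((1 + eps) * (6 * Num.sqrt 3) * mixed_area K (reflect_set K))%:E)%E ->
  triangle_sandwich K (400 * Num.sqrt eps).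
Proof.
move=> [cK /convex_set_segment sK _] rho0 r35 TK e0 e1 /finite_perimeter[P PE PA].
have [l [z [l0 KT]]] := near_standard_exists rho0 TK.
have KP : bounds_contact_polygons K P.
  by move=> n v p cp v0 cv ne; rewrite -lee_fin -PE; exact: perimeter_ge_contacts cp v0 cv ne.
have KA : bounded_by_hexagons K (mixed_area K (reflect_set K)).
  by move=> v w t vw tK; exact: mixed_area_le.
apply: (triangle_sandwich_similarity l0).
apply: (near_standard_stability (compact_similarity l0 cK) (segment_closed_similarity sK)
  r35 e0 e1 KT (bounds_contact_polygons_similarity l0 KP)
  (bounded_by_hexagons_similarity l0 KA)).
by rewrite expr_div_n sqr_sqrtr ?(ltW l0)// !mulrA ler_pM2r ?invr_gt0// -(mulrA _ 6).
Qed.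

Lemma dtr_le K (rho : R) : 0 <= rho -> triangle_sandwich K rho -> dtr K <= rho.
Proof.
move=> rho0 h; apply: ge_inf; last by split.
by exists 0 => r [].
Qed.

End stability_theorem.

Theorem proposition4p1 (R : realType) (K : set (plane R)) (eps : R) :
  convex_domain K ->
  dtr K <= 6 ^- 2 ->
  0 <= eps -> eps <= (6 * 180) ^- 2 ->
  (perimeter K ^+ 2 <=
    ((1 + eps) * (6 * Num.sqrt 3) * mixed_area K (reflect_set K))%:E)%E ->
  dtr K <= 400 * Num.sqrt eps.
Proof.
move=> KD d36 e0 e1 LA.
have s0 : 0 <= 400 * Num.sqrt eps by rewrite mulr_ge0 ?sqrtr_ge0.
have [[r [r0 h]]|none] := pselect (exists r : R, 0 <= r /\ triangle_sandwich K r); last first.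
  rewrite /dtr (_ : [set rho | _] = set0) ?inf0//.
  by apply/seteqP; split=> [r rP|r []]; apply: none; exists r.
have [rho [rho0 TK] rho_lt] : exists2 rho : R, 0 <= rho /\ triangle_sandwich K rho & rho < 35^-1.
  apply: inf_lt; first by exists r.
  apply: le_lt_trans d36 _; rewrite ltf_pV2 ?posrE ?exprn_gt0//.
  by rewrite expr2; lra.
apply: dtr_le => //.
exact: (sandwich_improved KD rho0 (ltW rho_lt) TK e0 e1 LA).
Qed.
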